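(* Let $\mu_0>0$ and let $\omega_0=\operatorname{curl}u_0$ be an initial vorticity with $|\!|\!|\omega_0|\!|\!|_0\le M<\infty$, and let $T>0$ (depending on $M$ and $\mu_0$ only) be a time, with an associated $\gamma>0$, such that for every $\nu\in(0,1]$ the vorticity $\omega$ of the Navier–Stokes solution with viscosity $\nu$ and initial vorticity $\omega_0$ satisfies $\sup_{t\in[0,T]}|\!|\!|\omega(t)|\!|\!|_t\le CM$, where $C$ depends only on $\mu_0$ and $\theta_0$ (such $\gamma$, $T$ and $C$ exist by the uniform vorticity bound for the Navier–Stokes equations). For $\nu>0$ denote by $u^\nu$ the solution on $[0,T]$ of $$\partial_tu-\nu\Delta u+u\cdot\nabla u+\nabla p=0,\qquad \operatorname{div}u=0,\qquad u|_{t=0}=u_0,\qquad u|_{z=0}=0$$ in $\mathbb H^3_+$, and denote by $\bar u$ the solution of the Euler equations (the same system with $\nu=0$ and the boundary condition replaced by $\bar u_3|_{z=0}=0$) with the same initial datum. Then $$\lim_{\nu\to0}\ \sup_{t\in[0,T]}\|u^\nu(t)-\bar u(t)\|_{L^2(\mathbb H^3_+)}=0.$$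
   Context: **Domain.** $\mathbb H^3_+=\mathbb T\times\mathbb T\times\mathbb R_+=\{(x,y,z)\in\mathbb T\times\mathbb T\times\mathbb R: z\ge 0\}$. For a vector $v$, $v_h=(v_1,v_2)$ is the horizontal part and $v_3$ the vertical part; $\nabla_h=(\partial_x,\partial_y)$, $|\nabla_h|=\sqrt{-\Delta_h}$. **Notation.** $f_\xi(z)$, $\xi\in\mathbb Z^2$, is the Fourier coefficient of $f$ in $(x,y)$. For a multi-index $\alpha$ of nonnegative integers, $\nabla^\alpha=\partial_x^{\alpha_1}\partial_y^{\alpha_2}\partial_z^{\alpha_3}$ and $D^\alpha=\partial_x^{\alpha_1}\partial_y^{\alpha_2}(z\partial_z)^{\alpha_3}$. For $\mu>0$, $$\Omega_\mu=\{z\in\mathbb C:0\le\operatorname{Re}z\le1,\ |\operatorname{Im}z|\le\mu\operatorname{Re}z\}\cup\{z\in\mathbb C:1\le\operatorname{Re}z\le1+\mu,\ |\operatorname{Im}z|\le1+\mu-\operatorname{Re}z\}.$$ The analytic norms below are for functions whose Fourier coefficients $f_\xi$ extend analytically to $\Omega_\mu$. Inside exponentials and in the weight $w$, $z$ stands for $\operatorname{Re}z$. The weight is $w(z)=\max(\sqrt\nu,z)$ for $0\le z\le1$ and $w(z)=1$ otherwise. The norms depend on $\nu$ through $w$; the hypothesis $|\!|\!|\omega_0|\!|\!|_0\le M$ is understood with $M$ independent of $\nu\in(0,1]$. **Constants.** $\theta_0>0$ is the universal constant in the following bound: the Green's function of $\partial_t-\nu(\partial_z^2-|\xi|^2)$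 on the half line with boundary condition $\nu(\partial_z+|\xi|)\,\cdot\,|_{z=0}=0$ equals the homogeneous Neumann heat kernel plus $R^{(1)}_\xi+R^{(2)}_\xi$, where $|\partial_z^kR^{(1)}_\xi(t,z,\bar z)|\lesssim b^{k+1}e^{-\theta_0b(z+\bar z)}$ with $b=|\xi|+\nu^{-1/2}$, and $|\partial_z^kR^{(2)}_\xi(t,z,\bar z)|\lesssim(\nu t)^{-(k+1)/2}e^{-(z+\bar z)^2/(\nu t)}e^{-\nu|\xi|^2t/8}$, for all integers $k\ge 0$. $\epsilon_0\in(0,1)$ is a sufficiently small constant depending only on $\theta_0$, and $a\in(0,\tfrac12)$ is a fixed constant. **Norms.** $$\|f\|_{\bar{\mathcal X}_\mu}=\sum_{\xi\in\mathbb Z^2}\sup_{z\in\Omega_\mu}w(z)e^{\epsilon_0(1+\mu-z)_+|\xi|}|f_\xi(z)|,\qquad \|f\|_{\mathcal X_\mu}=\sum_{\xi\in\mathbb Z^2}\sup_{z\in\Omega_\mu}e^{\epsilon_0(1+\mu-z)_+|\xi|}|f_\xi(z)|,$$ $$\|f\|_{X_\mu}=\|f_h\|_{\bar{\mathcal X}_\mu}+\|f_3\|_{\mathcal X_\mu},\qquad \|f\|_{Y_\mu}=\sum_{\xi\in\mathbb Z^2}\ \sup_{0\le\theta<\mu}\big\|e^{\epsilon_0(1+\mu-z)_+|\xi|}f_\xi\big\|_{L^1(\partial\Omega_\theta)},$$ $$\|f\|_{X(t)}=\sup_{\mu<\mu_0-\gamma t}\Big(\sum_{|\alpha|\le1}\|D^\alpha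 f\|_{X_\mu}+\sum_{|\alpha|=2}(\mu_0-\mu-\gamma t)^{1/2+a}\|D^\alpha f\|_{X_\mu}\Big),$$ $$\|f\|_{Y(t)}=\sup_{\mu<\mu_0-\gamma t}\Big(\sum_{|\alpha|\le1}\|D^\alpha(1+|\nabla_h|)f\|_{Y_\mu}+\sum_{|\alpha|=2}(\mu_0-\mu-\gamma t)^{a}\|D^\alpha(1+|\nabla_h|)f\|_{Y_\mu}\Big),$$ $$\|f\|_{Z}=\sum_{|\alpha|\le5}\|\nabla^\alpha f\|_S,\qquad \|f\|_S^2=\sum_{\xi\in\mathbb Z^2}\|zf_\xi\|_{L^2(z\ge1/2)}^2,$$ $$|\!|\!|f|\!|\!|_t=\|f\|_{X(t)}+\|f\|_{Y(t)}+\|f\|_Z .$$ Times $t$ are restricted to $t\le\mu_0/(2\gamma)$, with $|\!|\!|\cdot|\!|\!|_0$ the case $t=0$. *)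

(* Defs.v *)
From HB Require Import structures.
From mathcomp Require Import all_boot all_order all_algebra.
From mathcomp Require Import all_classical all_reals all_analysis.
From mathcomp Require Import complex.

Set Implicit Arguments.
Unset Strict Implicit.
Unset Printing Implicit Defensive.

Import Order.TTheory GRing.Theory Num.Theory.
Import numFieldNormedType.Exports.

Local Open Scope classical_set_scope.
Local Open Scope ring_scope.
Local Open Scope complex_scope.

(* Functions on T x T x R_+, with T = R / 2 pi Z, are functions on R * R * R
   that are 2 pi-periodic in the first two variables; only their values at
   z >= 0 are ever used. *)
Definition scalar_field (R : realType) := R * R * R -> R.
Definition vector_field (R : realType) := 'I_3 -> R * R * R -> R.

Section Domain.
Context {R : realType}.
Implicit Types (f : scalar_field R) (v : vector_field R).

Definition half_space : set (R * R * R) := [set X | 0 <= X.2].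

(* A fundamental domain of the action of the periods on the half-space. *)
Definition cell : set (R * R * R) :=
  [set X | [/\ 0 <= X.1.1 < 2 * pi, 0 <= X.1.2 < 2 * pi & 0 <= X.2]].

Definition periodic_h f :=
  forall x y z, 0 <= z ->
    f (x + 2 * pi, y, z) = f (x, y, z) /\ f (x, y + 2 * pi, z) = f (x, y, z).

Definition volume :=
  ((@lebesgue_measure R \x @lebesgue_measure R) \x @lebesgue_measure R)%E.

Definition L2norm (I : finType) (v : I -> R * R * R -> R) : \bar R :=
  ((\int[volume]_(X in cell) (\sum_i v i X ^+ 2)%:E) `^ (2^-1))%E.

(* Derivatives relative to a set D are limits of the difference quotients with
   both endpoints in D: the usual derivative at an interior point, a one-sided
   one at a boundary point such as z = 0. *)
Definition quotient_in (V : normedModType R) (D : set V) (v : V) (f : V -> R)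
    (x : V) : set_system R :=
  (h^-1 * (f (x + h *: v) - f x)) @[h --> within [set h | D (x + h *: v)] 0^'].

Definition derivable_in (V : normedModType R) (D : set V) (v : V) (f : V -> R)
    (x : V) : Prop := cvg (quotient_in D v f x).

Definition derive_in (V : normedModType R) (D : set V) (v : V) (f : V -> R)
    (x : V) : R := lim (quotient_in D v f x).

Definition basis (i : 'I_3) : R * R * R :=
  ((i == 0%N :> nat)%:R, (i == 1%N :> nat)%:R, (i == 2%N :> nat)%:R).

Definition partial (i : 'I_3) f : scalar_field R :=
  derive_in half_space (basis i) f.

Definition gradient v : 'I_3 * 'I_3 -> R * R * R -> R :=
  fun ij => partial ij.2 (v ij.1).

Definition curl v : vector_field R := fun i =>
  match val i with
  | 0 => partial (inord 1) (v (inord 2)) \- partial (inord 2) (v (inord 1))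
  | 1 => partial (inord 2) (v (inord 0)) \- partial (inord 0) (v (inord 2))
  | _ => partial (inord 0) (v (inord 1)) \- partial (inord 1) (v (inord 0))
  end.

End Domain.

Section Solutions.
Context {R : realType}.
Implicit Types (J : set R) (T nu : R) (g p : R -> scalar_field R)
  (u : R -> vector_field R).

Definition continuous_st J g :=
  {within [set q : R * (R * R * R) | J q.1 /\ half_space q.2],
    continuous (fun q => g q.1 q.2)}.

(* g and its space derivatives of order at most k are continuous on
   J x {z >= 0}. *)
Fixpoint space_class J (k : nat) g : Prop :=
  continuous_st J g /\
  if k is k'.+1 then
    forall i : 'I_3,
      (forall t X, J t -> half_space X ->
         derivable_in half_space (basis i) (g t) X) /\
      space_class J k' (fun t => partial i (g t))
  else True.

Definition time_derive T g (t : R) : scalar_field R := fun X =>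
  derive_in (`[0, T] : set R) (1 : R) (fun s => g s X) t.

Definition time_class T J g :=
  (forall t X, J t -> half_space X ->
     derivable_in (`[0, T] : set R) (1 : R) (fun s => g s X) t) /\
  continuous_st J (time_derive T g).

Definition momentum T J nu u p :=
  forall t X (i : 'I_3), J t -> half_space X ->
    time_derive T (fun s => u s i) t X
    - nu * (\sum_(j < 3) partial j (partial j (u t i)) X)
    + \sum_(j < 3) u t j X * partial j (u t i) X
    + partial i (p t) X = 0.

Definition divergence_free J u :=
  forall t X, J t -> half_space X -> \sum_(j < 3) partial j (u t j) X = 0.

(* The solutions take their initial value in L^2, and remain of finite energy
   and bounded, with bounded gradient, on every [s, T] with s in J. *)
Definition finite_energy T J u p :=
  [/\ forall t, 0 <= t <= T -> (L2norm (u t) < +oo)%E,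
      forall t, 0 <= t <= T ->
        L2norm (fun i => u s i \- u t i) @[s --> within `[0, T] (nbhs t)]
          --> 0%E &
      forall s, J s -> exists B : R, forall t, s <= t <= T ->
        [/\ forall i X, half_space X -> `|u t i X| <= B,
            forall ij X, half_space X -> `|gradient (u t) ij X| <= B,
            (L2norm (gradient (u t)) <= B%:E)%E &
            (L2norm (fun i : 'I_3 => partial i (p t)) <= B%:E)%E]].

Definition periodic_flow T u p :=
  forall t, 0 <= t <= T ->
    (forall i, periodic_h (u t i)) /\ periodic_h (p t).

Definition initial_value u (u0 : vector_field R) :=
  forall i X, half_space X -> u 0 i X = u0 i X.

(* Classical finite-energy solution on [0, T]. The equations hold for
   0 < t <= T only: u0 need not satisfy the compatibility conditions under
   which second derivatives would be continuous up to t = 0. *)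
Definition navier_stokes nu T (u0 : vector_field R) u p :=
  let J := (`]0, T])%classic in
  [/\ periodic_flow T u p,
      finite_energy T J u p,
      [/\ forall i, space_class J 2 (fun t => u t i),
          forall i, time_class T J (fun t => u t i) &
          space_class J 1 p],
      momentum T J nu u p /\ divergence_free J u &
      initial_value u u0 /\
      forall t i x y, 0 <= t <= T -> u t i (x, y, 0) = 0].

Definition euler T (u0 : vector_field R) u p :=
  let J := (`[0, T])%classic in
  [/\ periodic_flow T u p,
      finite_energy T J u p,
      [/\ forall i, space_class J 1 (fun t => u t i),
          forall i, time_class T J (fun t => u t i) &
          space_class J 1 p],
      momentum T J 0 u p /\ divergence_free J u &
      initial_value u u0 /\
      forall t x y, 0 <= t <= T -> u t (inord 2) (x, y, 0) = 0].

End Solutions.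

Section Norms.
Context {R : realType}.
Implicit Types (f : scalar_field R) (xi : int * int) (alpha : 'I_3 -> nat)
  (mu nu : R).

Definition freq_norm xi : R := Num.sqrt (xi.1%:~R ^+ 2 + xi.2%:~R ^+ 2).

Definition fourier f xi (z : R) : R[i] :=
  let I (k : R -> R) :=
    (2 * pi) ^- 2 *
    \int[(@lebesgue_measure R \x @lebesgue_measure R)%E]_(q in
        `[0, 2 * pi] `*` `[0, 2 * pi])
      (f (q.1, q.2, z) * k (xi.1%:~R * q.1 + xi.2%:~R * q.2)) in
  I cos -i* I sin.

(* Symbol of d_x^(alpha_1) d_y^(alpha_2). *)
Definition symbol_h xi alpha : R[i] :=
  (0 +i* xi.1%:~R) ^+ alpha (inord 0) * (0 +i* xi.2%:~R) ^+ alpha (inord 1).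

Definition modulus (n : nat) (v : 'I_n -> R[i]) : R :=
  Num.sqrt (\sum_i Normc.normc (v i) ^+ 2).

Definition Omega mu : set R[i]^o :=
  [set z | 0 <= complex.Re z <= 1 /\ `|complex.Im z| <= mu * complex.Re z] `|`
  [set z | 1 <= complex.Re z <= 1 + mu /\
           `|complex.Im z| <= 1 + mu - complex.Re z].

Definition analytic_on (D : set R[i]^o) (F : R[i]^o -> R[i]^o) :=
  (forall z, D° z -> derivable F z 1) /\ {within D, continuous F}.

(* G is the analytic extension of (z d_z)^k g to Omega mu. *)
Fixpoint conormal_extension mu (g : R -> R[i]) (k : nat)
    (G : R[i]^o -> R[i]^o) : Prop :=
  analytic_on (Omega mu) G /\
  if k is k'.+1 then
    exists2 F, conormal_extension mu g k' F &
      forall z, (Omega mu)° z -> G z = z * derive1 F z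
  else forall x : R, 0 <= x <= 1 + mu -> G x%:C = g x.

Definition exp_weight (eps0 : R) mu xi (z : R[i]) : R :=
  expR (eps0 * Num.max 0 (1 + mu - complex.Re z) * freq_norm xi).

Definition weight nu (z : R) : R :=
  if 0 <= z <= 1 then Num.max (Num.sqrt nu) z else 1.

(* The extension is unique, so that the infimum below is its size; it is +oo if
   there is no extension. *)
Definition mode_norm (n : nat) (size : ('I_n -> R[i]^o -> R[i]^o) -> \bar R)
    mu (k : nat) (g : 'I_n -> R -> R[i]) : \bar R :=
  ereal_inf [set size G | G in
    [set G | forall i, conormal_extension mu (g i) k (G i)]].

(* || D^alpha f || in the sup norms with weight wt: wt = weight nu for the
   barred norm, wt = 1 for the other. *)
Definition sup_norm (wt : R -> R) (eps0 : R) mu alpha (n : nat)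
    (f : 'I_n -> scalar_field R) : \bar R :=
  \esum_(xi in [set: int * int])
    mode_norm (fun G => ereal_sup [set
        (wt (complex.Re z) * exp_weight eps0 mu xi z *
          modulus (fun i => symbol_h xi alpha * G i z))%:E | z in Omega mu])
      mu (alpha (inord 2)) (fun i => fourier (f i) xi).

Definition horizontal (v : vector_field R) : 'I_2 -> scalar_field R :=
  fun i => v (inord i).
Definition vertical (v : vector_field R) : 'I_1 -> scalar_field R :=
  fun=> v (inord 2).

Definition X_norm nu (eps0 : R) mu alpha (v : vector_field R) : \bar R :=
  (sup_norm (weight nu) eps0 mu alpha (horizontal v) +
   sup_norm (fun=> 1%R) eps0 mu alpha (vertical v))%E.

(* Integral of h against arc length over the upper (s = 1) or lower (s = -1)
   half of the boundary of Omega theta. *)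
Definition half_contour (s theta : R) (h : R[i] -> R) : \bar R :=
  let h1 r := h (r +i* (s * (theta * r))) in
  let h2 r := h (r +i* (s * (1 + theta - r))) in
  ((Num.sqrt (1 + theta ^+ 2)%R)%:E *
     \int[lebesgue_measure]_(r in `[0%R, 1%R]) (h1 r)%:E +
   (Num.sqrt 2)%:E *
     \int[lebesgue_measure]_(r in `[1%R, (1 + theta)%R]) (h2 r)%:E)%E.

(* Omega 0 is the segment [0, 1], which is its own boundary. *)
Definition contour_L1 (theta : R) (h : R[i] -> R) : \bar R :=
  (half_contour 1 theta h +
   if theta == 0%R then 0 else half_contour (-1)%R theta h)%E.

(* || D^alpha (1 + |grad_h|) v ||_(Y_mu) *)
Definition Y_norm (eps0 : R) mu alpha (v : vector_field R) : \bar R :=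
  \esum_(xi in [set: int * int])
    mode_norm (fun G => ereal_sup [set contour_L1 theta (fun z =>
        exp_weight eps0 mu xi z *
        modulus (fun i =>
          symbol_h xi alpha * (1 + freq_norm xi)%:C * G i z))
        | theta in `[0, mu[])
      mu (alpha (inord 2)) (fun i => fourier (v i) xi).

Definition degree (k : nat) (alpha : {ffun 'I_3 -> 'I_k}) : nat :=
  (\sum_i alpha i)%N.

Definition Xt_norm nu (eps0 a mu0 gamma t : R) (v : vector_field R) : \bar R :=
  ereal_sup [set
    (\sum_(al : {ffun 'I_3 -> 'I_3} | (degree al <= 1)%N)
        X_norm nu eps0 mu (fun i => al i) v +
     \sum_(al : {ffun 'I_3 -> 'I_3} | degree al == 2%N)
        ((mu0 - mu - gamma * t) `^ (2^-1 + a))%:E *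
        X_norm nu eps0 mu (fun i => al i) v)%E
    | mu in `]0, mu0 - gamma * t[].

Definition Yt_norm (eps0 a mu0 gamma t : R) (v : vector_field R) : \bar R :=
  ereal_sup [set
    (\sum_(al : {ffun 'I_3 -> 'I_3} | (degree al <= 1)%N)
        Y_norm eps0 mu (fun i => al i) v +
     \sum_(al : {ffun 'I_3 -> 'I_3} | degree al == 2%N)
        ((mu0 - mu - gamma * t) `^ a)%:E *
        Y_norm eps0 mu (fun i => al i) v)%E
    | mu in `]0, mu0 - gamma * t[].

(* h is the L^1_loc derivative of g on [1/2, +oo[ (g is locally absolutely
   continuous there). *)
Definition real_vderiv (g h : R -> R) :=
  forall b, 2^-1 <= b ->
    lebesgue_measure.-integrable `[2^-1, b] (EFin \o h) /\
    g b = g 2^-1 + \int[lebesgue_measure]_(z in `[2^-1, b]) h z.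

Definition vderiv (g h : R -> R[i]) :=
  real_vderiv (@complex.Re R \o g) (@complex.Re R \o h) /\
  real_vderiv (@complex.Im R \o g) (@complex.Im R \o h).

Fixpoint iter_vderiv (g : R -> R[i]) (k : nat) (h : R -> R[i]) : Prop :=
  if k is k'.+1 then exists2 h', iter_vderiv g k' h' & vderiv h' h
  else forall z, 2^-1 <= z -> h z = g z.

(* || nabla^alpha v ||_S, +oo if some Fourier coefficient lacks the vertical
   derivative; the infimum is over the a.e. versions of that derivative. *)
Definition S_norm alpha (v : vector_field R) : \bar R :=
  ((\esum_(xi in [set: int * int])
     ereal_inf [set
       (\int[lebesgue_measure]_(z in `[(2^-1)%R, +oo[)
          ((z * modulus (fun i => symbol_h xi alpha * h i z)) ^+ 2)%:E)%E
       | h in [set h : 'I_3 -> R -> R[i] | forall i,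
           iter_vderiv (fourier (v i) xi) (alpha (inord 2)) (h i)]])
   `^ (2^-1))%E.

Definition Z_norm (v : vector_field R) : \bar R :=
  (\sum_(al : {ffun 'I_3 -> 'I_6} | (degree al <= 5)%N)
     S_norm (fun i => al i) v)%E.

Definition triple_norm nu (eps0 a mu0 gamma t : R) (v : vector_field R) : \bar R :=
  (Xt_norm nu eps0 a mu0 gamma t v + Yt_norm eps0 a mu0 gamma t v + Z_norm v)%E.

End Norms.

Section GreenFunction.
Context {R : realType}.
Implicit Types (nu k t z zb : R) (G : R -> R -> R -> R).

Definition neumann_kernel nu k t z zb : R :=
  (Num.sqrt (4 * pi * nu * t))^-1 *
  (expR (- ((z - zb) ^+ 2 / (4 * nu * t))) +
   expR (- ((z + zb) ^+ 2 / (4 * nu * t)))) * expR (- (nu * k ^+ 2 * t)).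

(* Green's function of d_t - nu (d_z^2 - k^2) on the half line, with boundary
   condition nu (d_z + k) G = 0 at z = 0. *)
Definition green_function nu k G :=
  [/\ {within [set q : R * R * R | [/\ 0 < q.1.1, 0 <= q.1.2 & 0 <= q.2]],
        continuous (fun q => G q.1.1 q.1.2 q.2)},
      forall t z zb, 0 < t -> 0 < z -> 0 <= zb ->
        [/\ derivable (fun s => G s z zb) t 1,
            derivable (fun y => G t y zb) z 1,
            derivable (derive1 (fun y => G t y zb)) z 1 &
            derive1 (fun s => G s z zb) t =
            nu * (derive1n 2 (fun y => G t y zb) z - k ^+ 2 * G t z zb)],
      forall t zb, 0 < t -> 0 <= zb ->
        derivable_in (`[0, +oo[ : set R) (1 : R) (fun y => G t y zb) 0 /\
        nu * (derive_in (`[0, +oo[ : set R) (1 : R) (fun y => G t y zb) 0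
              + k * G t 0 zb) = 0 &
      forall (phi : R -> R) (B z : R),
        {within `[0, +oo[, continuous phi} ->
        (forall y, 0 <= y -> `|phi y| <= B) -> 0 <= z ->
        (forall t, 0 < t -> lebesgue_measure.-integrable `[0, +oo[
           (fun zb => (G t z zb * phi zb)%:E)) /\
        \int[lebesgue_measure]_(zb in `[0, +oo[) (G t z zb * phi zb)
          @[t --> 0^'+] --> phi z].

(* |d_z^j r(t, z, zb)| <= bound j t (z + zb) for all j and 0 < t <= tau. *)
Definition kernel_bound (tau : R) (r : R -> R -> R -> R)
    (bound : nat -> R -> R -> R) :=
  forall (j : nat) t z zb, 0 < t <= tau -> 0 < z -> 0 <= zb ->
    derivable (derive1n j (fun y => r t y zb)) z 1 /\
    `|derive1n j (fun y => r t y zb) z| <= bound j t (z + zb).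

(* The implicit constants A may depend on j and on a bound tau for t, but not on
   nu and xi. The rate in the Gaussian factor of the second remainder is
   determined up to a universal constant c only. *)
Definition green_rate (theta0 : R) :=
  0 < theta0 /\
  exists2 c : R, 0 < c &
    forall tau : R, 0 < tau -> exists A : nat -> R,
      forall nu (xi : int * int), 0 < nu <= 1 ->
        exists G R1 R2 : R -> R -> R -> R,
          let k : R := freq_norm xi in
          let b := k + (Num.sqrt nu)^-1 in
          [/\ green_function nu k G,
              forall t z zb, 0 < t -> 0 <= z -> 0 <= zb ->
                G t z zb = neumann_kernel nu k t z zb + R1 t z zb + R2 t z zb,
              kernel_bound tau R1 (fun j t s =>
                A j * (b ^+ j.+1 * expR (- (theta0 * b * s)))) &
              kernel_bound tau R2 (fun j t s =>
                A j * (Num.sqrt (nu * t) ^- j.+1 *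
                  expR (- (c * s ^+ 2 / (nu * t))) *
                  expR (- (nu * k ^+ 2 * t / 8))))].

End GreenFunction.

(* Main.v *)
(* Kato's energy argument for v = u^nu - ubar, q = p - pbar. Subtracting the two
   momentum equations,
     d_t |v|^2 / 2 + div (u |v|^2 / 2 + q v - nu sum_i v_i grad u_i)
       = - sum_ij v_i v_j d_j ubar_i - nu grad v : grad u,
   whose right-hand side is at most C |v|^2 + nu |grad ubar|^2. This is integrated
   over [t1, t2] x (cell with z <= Z).
   - At z = 0 one has v = - ubar and ubar_3 = 0, so the flux is nu ubar . d_z u.
     No slip turns d_z u_h into the horizontal vorticity and d_z u_3 into 0. The
     weight of the X norm is sqrt nu at z = 0, so the moduli of the Fourier
     coefficients of the vorticity sum there to at most C M / sqrt nu; Fejer means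
     give the same bound for the vorticity itself, and the flux is O(sqrt nu).
   - At z = Z the flux is small for arbitrarily large Z: |v|^2 and |grad u|^2 are
     integrable in z, the slice integral of q^2 is at most C (1 + Z), and
     1 / (1 + z) is not integrable.
   - The equations hold for t > 0 only, so t1 -> 0 by L^2 continuity.
   Gronwall's lemma takes the form: if ||v(t)||^2 <= N e^(K t) on [0, T], then the
   same holds with N / 2 + O(sqrt nu) in place of N. *)
Require Import Defs.
From HB Require Import structures.
From mathcomp Require Import all_boot all_order all_algebra.
From mathcomp Require Import all_classical all_reals all_analysis.
From mathcomp Require Import measurable_realfun ring lra complex.

Set Implicit Arguments.
Unset Strict Implicit.
Unset Printing Implicit Defensive.

Import Order.TTheory GRing.Theory Num.Theory.
Import numFieldNormedType.Exports.
Local Open Scope classical_set_scope.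
Local Open Scope ring_scope.

(** * Iterated integrals of continuous functions *)

(** Nothing makes the energy on the whole cell differentiable in time or the flux at infinity
    vanish. So the balance is used on finite boxes, integrated in time, and the height Z at which
    the top flux is small depends on t1, t2 and the tolerance. What survives is a bound at time t2
    deduced from an a priori bound on [t1, t2]. Inserting N e^(K t) makes the time integral of the
    source explicit and gains a factor 1 / K, so a large K halves N. A finite first N comes from L^2
    continuity and compactness of [0, T]; iterating removes it and leaves only the O(sqrt nu) data.
    The L^2 norm itself is thus O(nu^(1/4)). Fejer means are used because the X norm controls the
    sum of the moduli of the Fourier coefficients, not directly the function. A nonnegative kernel
    of fixed mass that concentrates at a point bounds the value there by that sum, without any
    convergence of the Fourier series. Solutions are extended by constants in time and below the
    wall, so that every integrand is continuous on the whole space and integrals behave as positive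
    linear functionals. *)

Section Continuity.
Context {R : realType} {T : topologicalType}.
Implicit Types f g : T -> R.

Lemma cont_cst {U : topologicalType} (c : U) : continuous (fun _ : T => c).
Proof. by move=> x; exact: cvg_cst. Qed.

Lemma cont_id : continuous (fun x : T => x).
Proof. by move=> x; exact: cvg_id. Qed.

Lemma contD f g : continuous f -> continuous g -> continuous (fun x => f x + g x).
Proof. by move=> cf cg x; apply: continuousD; [exact: cf | exact: cg]. Qed.

Lemma contN f : continuous f -> continuous (fun x => - f x).
Proof. by move=> cf x; apply: continuousN; exact: cf. Qed.

Lemma contM f g : continuous f -> continuous g -> continuous (fun x => f x * g x).
Proof. by move=> cf cg x; apply: continuousM; [exact: cf | exact: cg]. Qed.

Lemma contX f n : continuous f -> continuous (fun x => f x ^+ n).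
Proof.
move=> cf; elim: n => [|n IH].
  by under eq_fun do rewrite expr0; exact: cont_cst.
by under eq_fun do rewrite exprS; exact: contM.
Qed.

Lemma cont_norm f : continuous f -> continuous (fun x => `|f x|).
Proof. by move=> cf x; apply: cvg_norm; exact: cf. Qed.

Lemma cont_sum (I : Type) (s : seq I) (F : I -> T -> R) :
  (forall i, continuous (F i)) -> continuous (fun x => \sum_(i <- s) F i x).
Proof.
move=> cF; elim: s => [|i s IH].
  by under eq_fun do rewrite big_nil; exact: cont_cst.
by under eq_fun do rewrite big_cons; exact: contD.
Qed.

Lemma cont_comp {U W : topologicalType} (h : U -> W) (k : T -> U) :
  continuous h -> continuous k -> continuous (fun x => h (k x)).
Proof. by move=> ch ck x; apply: continuous_comp; [exact: ck | exact: ch]. Qed.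

Lemma cont_pair {U W : topologicalType} (h : T -> U) (k : T -> W) :
  continuous h -> continuous k -> continuous (fun x => (h x, k x)).
Proof. by move=> ch ck x; apply: cvg_pair; [exact: ch | exact: ck]. Qed.

Lemma cont_fst {U W : topologicalType} (k : T -> U * W) :
  continuous k -> continuous (fun x => (k x).1).
Proof. by move=> ck x; apply: cvg_comp (ck x) _; exact: cvg_fst. Qed.

Lemma cont_snd {U W : topologicalType} (k : T -> U * W) :
  continuous k -> continuous (fun x => (k x).2).
Proof. by move=> ck x; apply: cvg_comp (ck x) _; exact: cvg_snd. Qed.

End Continuity.

(** The cases [pair _], [+%R _], [*%R _] and [-%R] are for functions in eta-contracted form. *)
Ltac cont := repeat match goal with
    | H : continuous ?h |- continuous ?h => exact: H
    | |- continuous (fun _ => ?c) => exact: cont_cst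
    | |- continuous (fun x => x) => exact: cont_id
    | |- continuous id => exact: cont_id
    | |- continuous fst => exact: (cont_fst (@cont_id _))
    | |- continuous snd => exact: (cont_snd (@cont_id _))
    | |- continuous (pair _) => apply: cont_pair
    | |- continuous (+%R _) => apply: contD
    | |- continuous ( *%R _) => apply: contM
    | |- continuous -%R => apply: contN
    | |- continuous (fun x => - _) => apply: contN
    | |- continuous (fun x => _ + _) => apply: contD
    | |- continuous (fun x => _ * _) => apply: contM
    | |- continuous (fun x => _ ^+ _) => apply: contX
    | |- continuous (fun x => `|_|) => apply: cont_norm
    | |- continuous (fun x => \sum_(_ <- _) _) => apply: cont_sum => ?
    | |- continuous (fun x => (_, _)) => apply: cont_pair
    | H : continuous ?h |- continuous (fun x => ?h _) => apply: (cont_comp H)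
    | H : forall i, continuous (?h i) |- continuous (?h ?i) => exact: (H i)
    | H : forall i, continuous (?h i) |- continuous (fun x => ?h ?i _) =>
        apply: (cont_comp (H i))
    | H : forall i j, continuous (?h i j) |- continuous (?h ?i ?j) => exact: (H i j)
    | H : forall i j, continuous (?h i j) |- continuous (fun x => ?h ?i ?j _) =>
        apply: (cont_comp (H i j))
    | |- continuous (fun x => (_).1) => apply: cont_fst
    | |- continuous (fun x => (_).2) => apply: cont_snd
    end.

(* Iterated integrals as positive linear functionals on continuous functions, for
   which no integrability side conditions arise. *)
Record integral_on (R : realType) (V : topologicalType) (K : set V)
    (L : (V -> R) -> R) : Prop := IntegralOn {
  integral_on_continuous : forall (U : topologicalType) (f : U * V -> R),
    continuous f -> continuous (fun u => L (fun v => f (u, v)));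
  integral_onD : forall f g : V -> R, continuous f -> continuous g ->
    L (fun v => f v + g v) = L f + L g;
  integral_onZ : forall (c : R) (f : V -> R), continuous f ->
    L (fun v => c * f v) = c * L f;
  integral_on_le : forall f g : V -> R, continuous f -> continuous g ->
    (forall v, K v -> f v <= g v) -> L f <= L g }.

Definition integral1 {R : realType} (a b : R) (f : R -> R) : R :=
  \int[lebesgue_measure]_(x in `[a, b]) f x.

Definition integral_prod {R : realType} {V W : Type} (L : (V -> R) -> R)
    (M : (W -> R) -> R) (f : V * W -> R) : R :=
  L (fun v => M (fun w => f (v, w))).

Section IntegralOn.
Context {R : realType} {V : topologicalType} (K : set V) (L : (V -> R) -> R)
  (HL : integral_on K L).
Implicit Types f g : V -> R.

Lemma integral_on_eq f g : continuous f -> continuous g ->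
  (forall v, K v -> f v = g v) -> L f = L g.
Proof.
move=> cf cg fg; apply/eqP; rewrite eq_le.
by rewrite !(integral_on_le HL)// => v Kv; rewrite fg.
Qed.

Lemma integral_onN f : continuous f -> L (fun v => - f v) = - L f.
Proof.
move=> cf; rewrite -mulN1r -(integral_onZ HL)//; congr L.
by apply/funext => v; rewrite mulN1r.
Qed.

Lemma integral_onB f g : continuous f -> continuous g ->
  L (fun v => f v - g v) = L f - L g.
Proof.
by move=> cf cg; rewrite (integral_onD HL) ?integral_onN//; cont.
Qed.

Lemma integral_on0 : L (fun=> 0) = 0.
Proof.
have h := integral_onZ HL 0 (f := fun=> 0) (@cont_cst _ _ 0); rewrite [X in _ = X]mul0r in h.
by rewrite -[RHS]h; congr L; apply/funext => v; rewrite mul0r.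
Qed.

Lemma integral_on_cst c : L (fun=> c) = c * L (fun=> 1).
Proof.
rewrite -(integral_onZ HL c (f := fun=> 1)); last by cont.
by congr L; apply/funext => v; rewrite mulr1.
Qed.

Lemma integral_on_ge0 f : continuous f -> (forall v, K v -> 0 <= f v) ->
  0 <= L f.
Proof.
by move=> cf f0; rewrite -integral_on0; apply: (integral_on_le HL) => //; cont.
Qed.

Lemma integral_on_sum (I : Type) (s : seq I) (F : I -> V -> R) :
  (forall i, continuous (F i)) ->
  L (fun v => \sum_(i <- s) F i v) = \sum_(i <- s) L (F i).
Proof.
move=> cF; elim: s => [|i s IH].
  by rewrite big_nil -[RHS]integral_on0; congr L; apply/funext => v; rewrite big_nil.
rewrite big_cons -IH -(integral_onD HL)//; last by cont.
by congr L; apply/funext => v; rewrite big_cons.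
Qed.

(** The parameter space in [integral_on_continuous] is arbitrary so that it can be enlarged to
    [U * V] here: the inner integral is continuous in both, then the outer one in [U]. *)
Lemma integral_on_prod {W : topologicalType} (K' : set W) M :
  integral_on K' M -> integral_on (K `*` K') (integral_prod L M).
Proof.
move=> HM.
have cM (f : V * W -> R) : continuous f -> continuous (fun v => M (fun w => f (v, w))).
  exact: (integral_on_continuous HM).
split.
- move=> U f cf.
  apply: (integral_on_continuous HL (f := fun q : U * V => M (fun w => f (q.1, (q.2, w))))).
  apply: (integral_on_continuous HM (f := fun q : U * V * W => f (q.1.1, (q.1.2, q.2)))).
  by cont.
- move=> f g cf cg; rewrite /integral_prod -(integral_onD HL); [|exact: cM..].
  congr L; apply/funext => v; rewrite -(integral_onD HM)//; cont.
- move=> c f cf; rewrite /integral_prod -(integral_onZ HL); last exact: cM.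
  congr L; apply/funext => v; rewrite -(integral_onZ HM)//; cont.
- move=> f g cf cg fg; apply: (integral_on_le HL); [exact: cM..|].
  move=> v Kv; apply: (integral_on_le HM); cont.
  by move=> w Kw; apply: fg.
Qed.

End IntegralOn.

Section Integral1.
Context {R : realType}.
Implicit Types (a b : R).

Lemma cont_integrable a b (f : R -> R) : continuous f ->
  lebesgue_measure.-integrable `[a, b] (EFin \o f).
Proof.
move=> cf; apply: continuous_compact_integrable; first exact: segment_compact.
exact: continuous_subspaceT.
Qed.

Lemma integral1_cst a b : a <= b -> integral1 a b (fun=> 1) = b - a.
Proof.
move=> ab; rewrite /integral1 Rintegral_cst//.
have h : lebesgue_measure [set` `[a, b]] = (b - a)%:E.
  rewrite lebesgue_measure_itv/= lte_fin.
  by case: ltgtP ab => // ->; rewrite subrr.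
by rewrite mul1r -[RHS]/(fine (b - a)%:E); congr fine; exact: h.
Qed.

Lemma integral_on_integral1 a b : integral_on `[a, b] (integral1 a b).
Proof.
split.
- move=> U f cf u; rewrite /continuous_at.
  have [ba|ab] := ltP b a.
    rewrite /integral1 set_itv_ge ?bnd_simp -?ltNge//.
    by under eq_fun do rewrite Rintegral_set0; rewrite Rintegral_set0; exact: cvg_cst.
  apply/cvgrPdist_le => e e0.
  (* The added 1 avoids a division by zero when a = b. *)
  have d0 : 0 < e / (b - a + 1) by rewrite divr_gt0// ltr_wpDl// subr_ge0.
  (* Tube lemma: compactness of [a, b] makes the closeness of f (u', .) to f (u, .) uniform, so it
     passes to the integral. *)
  have hcov : \forall u' \near u, `[a, b] `<=`
      (fun v => `|f (u, v) - f (u', v)| <= e / (b - a + 1)).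
    apply: (proj1 (compact_near_coveringP _) (@segment_compact R a b) U (nbhs u)
      (fun u' v => `|f (u, v) - f (u', v)| <= e / (b - a + 1))).
    move=> v _.
    have := cf (u, v) => /cvgrPdist_le /(_ _ (divr_gt0 d0 (ltr0Sn _ 1))) nf.
    have nf1 : \forall q \near (v, u), `|f (u, v) - f (q.2, q.1)| <= e / (b - a + 1) / 2.
      have cs : continuous (fun q : R * U => (q.2, q.1)) by cont.
      exact: (cs (v, u) _ nf).
    case: nf1 => -[A B] /= [An Bn] AB.
    exists (A, B) => //= -[v' u'] [/= Av Bu].
    have h1 := AB (v', u') (conj Av Bu).
    have h2 := AB (v', u) (conj Av (nbhs_singleton Bn)).
    rewrite /= in h1 h2.
    rewrite -(subrK (f (u, v)) (f (u, v'))) -addrA.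
    apply: (le_trans (ler_normD _ _)); rewrite [leRHS]splitr lerD// distrC//.
  near=> u'.
  have hA : `[a, b] `<=` (fun v => `|f (u, v) - f (u', v)| <= e / (b - a + 1)) by near: u'.
  rewrite /integral1 -RintegralB//; try by apply: cont_integrable; cont.
  apply: (le_trans (le_normr_Rintegral _ _)) => //.
    by apply: (@cont_integrable a b (fun x => f (u, x) - f (u', x))); cont.
  apply: (@le_trans _ _ (\int[lebesgue_measure]_(x in `[a, b]) (e / (b - a + 1) * 1))).
    apply: le_Rintegral => //; [| |].
    + by apply: (@cont_integrable a b (fun x => `|f (u, x) - f (u', x)|)); cont.
    + by apply: (@cont_integrable a b (fun x => e / (b - a + 1) * 1)); cont.
    + by move=> x xab; rewrite mulr1; apply: hA.
  rewrite RintegralZl//; last by apply: (@cont_integrable a b (fun x => 1)); cont.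
  rewrite -/(integral1 a b (fun=> 1)) integral1_cst// -mulrA ler_piMr ?(ltW e0)//.
  by rewrite mulrC ler_pdivrMr ?mul1r ?lerDl// ltr_wpDl// subr_ge0.
- by move=> f g cf cg; rewrite /integral1 RintegralD//; exact: cont_integrable.
- by move=> c f cf; rewrite /integral1 RintegralZl//; exact: cont_integrable.
- by move=> f g cf cg fg; apply: le_Rintegral => //; exact: cont_integrable.
Unshelve. all: by end_near. Qed.

(** The derivative is required in the open interval only: the extended solutions need not be
    differentiable in z at the wall, nor in t at the two end times. *)
Lemma integral1_FTC a b (F f : R -> R) : a <= b ->
  continuous f -> continuous F ->
  (forall x, a < x < b -> is_derive x 1 F (f x)) ->
  integral1 a b f = F b - F a.
Proof.
move=> ab cf cF dF.
case: (ltgtP a b) ab => // [ab _|<- _]; last first.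
  by rewrite /integral1 set_itv1 Rintegral_set1 subrr.
rewrite /integral1 /Rintegral (@continuous_FTC2 _ _ F)//.
- exact: continuous_subspaceT.
- split; first by move=> x; rewrite in_itv/= => /dF; case.
  + by apply: cvg_at_right_filter; exact: cF.
  + by apply: cvg_at_left_filter; exact: cF.
- by move=> x; rewrite in_itv/= => /dF h; rewrite derive1E; exact: derive_val.
Qed.

End Integral1.

(** * Joint measurability of functions continuous in one variable *)

Section Sections.
Context {R : realType} {d : measure_display} {T : measurableType d}.

Let grid (n : nat) (x : R) : R := (Num.floor (n.+1%:R * x))%:~R / n.+1%:R.

Let cvg_grid (x : R) : grid n x @[n --> \oo] --> x.
Proof.
apply/cvgrPdist_le => e e0; near=> n.
have n0 : 0 < n.+1%:R :> R by [].
rewrite -[x in `|x - _|](mulfK (lt0r_neq0 n0)) -mulrBl normrM [`|_^-1|]ger0_norm//.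
rewrite [x * _]mulrC ger0_norm ?subr_ge0 ?floor_le//.
apply: (@le_trans _ _ (1 / n.+1%:R)).
  rewrite ler_pM2r ?invr_gt0// lerBlDr addrC -[1 in leRHS]/(1%:~R) -intrD.
  by apply: ltW; case/andP: (floor_itv (n.+1%:R * x)).
rewrite div1r; near: n.
have /cvgrPdist_le/(_ _ e0) := @cvg_harmonic R.
apply: filterS => n; rewrite sub0r normrN ger0_norm//= invr_ge0 //.
Unshelve. all: by end_near. Qed.

Let grid_cell (n : nat) (k : int) :
  [set x : R | Num.floor (n.+1%:R * x) = k] =
  `[(k%:~R / n.+1%:R)%R, ((k + 1)%:~R / n.+1%:R)%R[%classic.
Proof.
have n0 : 0 < n.+1%:R :> R by [].
apply/seteqP; split => x /=; rewrite in_itv/= ler_pdivrMr// ltr_pdivlMr// [x * _]mulrC.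
  by move=> <-; exact: floor_itv.
by move/floor_def.
Qed.

(* Caratheodory: f is the limit of the functions f(x_n, t), where x_n is x
   rounded down to a multiple of 1/(n+1). *)
Lemma measurable_sections (f : R * T -> R) :
  (forall t, continuous (fun x => f (x, t))) ->
  (forall x, measurable_fun setT (fun t => f (x, t))) ->
  measurable_fun setT f.
Proof.
move=> cf mf.
apply: (@measurable_fun_cvg _ _ _ _ (fun n q => f (grid n q.1, q.2))); last first.
  move=> [x t] _ /=.
  have h := continuous_cvg _ (cf t x) (@cvg_grid x); exact: (h _).
move=> n _ Y mY; rewrite setTI.
have -> : (fun q : R * T => f (grid n q.1, q.2)) @^-1` Y =
   \bigcup_(k : int) ([set x : R | Num.floor (n.+1%:R * x) = k] `*`
     ((fun t => f (k%:~R / n.+1%:R, t)) @^-1` Y)).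
  apply/seteqP; split => [[x t] /= Yxt|[x t] [k _] [/= <-]//].
  by exists (Num.floor (n.+1%:R * x)).
apply: countable_bigcupT_measurable; first exact: countableP.
move=> k; apply: measurableX; first by rewrite grid_cell; exact: measurable_itv.
by rewrite -[_ @^-1` _]setTI; exact: mf.
Qed.

Lemma measurable_sections_r (f : T * R -> R) :
  (forall t, continuous (fun x => f (t, x))) ->
  (forall x, measurable_fun setT (fun t => f (t, x))) ->
  measurable_fun setT f.
Proof.
move=> cf mf.
have -> : f = (fun q : R * T => f (q.2, q.1)) \o (fun q : T * R => (q.2, q.1)).
  by apply/funext => -[].
apply: measurableT_comp; first exact: measurable_sections.
by apply/measurable_fun_pairP; split; [exact: measurable_snd | exact: measurable_fst].
Qed.

End Sections.

(** * Tonelli on rectangles, and exhaustion of the cell by boxes *)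

Section Rectangles.
Context {R : realType}.

Section Tonelli.
Context {d1 d2 : measure_display} {T1 : measurableType d1} {T2 : measurableType d2}
  (m1 : {sigma_finite_measure set T1 -> \bar R})
  (m2 : {sigma_finite_measure set T2 -> \bar R}).
Local Open Scope ereal_scope.

Lemma ge0_integral_setX (A : set T1) (B : set T2) (f : T1 * T2 -> \bar R) :
  measurable A -> measurable B -> measurable_fun setT f -> (forall q, 0 <= f q) ->
  \int[m1 \x m2]_(q in A `*` B) f q = \int[m1]_(x in A) \int[m2]_(y in B) f (x, y)
  /\ \int[m1 \x m2]_(q in A `*` B) f q = \int[m2]_(y in B) \int[m1]_(x in A) f (x, y).
Proof.
move=> mA mB mf f0.
have mAB : measurable (A `*` B) by exact: measurableX.
have mg : measurable_fun setT (f \_ (A `*` B)).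
  by apply/measurable_restrict => //; rewrite setTI; exact: measurable_funTS.
have g0 q : 0 <= (f \_ (A `*` B)) q by rewrite patchE; case: ifPn.
split; rewrite integral_mkcond.
  rewrite fubini_tonelli1// [RHS]integral_mkcond; apply: eq_integral => x _.
  rewrite /fubini_F !patchE; case: ifPn => xA.
    rewrite [RHS]integral_mkcond; apply: eq_integral => y _; rewrite !patchE.
    by rewrite in_setX xA.
  by apply: integral0_eq => y _; rewrite patchE in_setX (negbTE xA).
rewrite fubini_tonelli2// [RHS]integral_mkcond; apply: eq_integral => y _.
rewrite /fubini_G !patchE; case: ifPn => yB.
  rewrite [RHS]integral_mkcond; apply: eq_integral => x _; rewrite !patchE.
  by rewrite in_setX yB andbT.
by apply: integral0_eq => x _; rewrite patchE in_setX (negbTE yB) andbF.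
Qed.
End Tonelli.

Lemma integral1E (a b : R) (f : R -> R) : continuous f ->
  (\int[lebesgue_measure]_(x in `[a, b]) (f x)%:E = (integral1 a b f)%:E)%E.
Proof.
by move=> cf; rewrite /integral1 /Rintegral fineK//; apply: integrable_fin_num => //;
  exact: cont_integrable.
Qed.

Lemma cont_measurable2 (f : R * R -> R) : continuous f -> measurable_fun setT f.
Proof.
move=> cf; apply: measurable_sections => x.
  by cont.
by apply: continuous_measurable_fun; cont.
Qed.

Lemma cont_measurable3 (f : R * R * R -> R) : continuous f -> measurable_fun setT f.
Proof.
move=> cf; apply: measurable_sections_r => x; first by cont.
by apply: cont_measurable2; cont.
Qed.


Notation leb2 := (@lebesgue_measure R \x @lebesgue_measure R)%E.

Lemma ge0_integral_rect (a b c d : R) (f : R * R -> R) :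
  continuous f -> (forall q, 0 <= f q) ->
  (\int[leb2]_(q in `[a, b] `*` `[c, d]) (f q)%:E =
   (integral_prod (integral1 a b) (integral1 c d) f)%:E)%E /\
  (\int[leb2]_(q in `[a, b] `*` `[c, d]) (f q)%:E =
   (integral_prod (integral1 c d) (integral1 a b) (fun q => f (q.2, q.1)))%:E)%E.
Proof.
move=> cf f0.
have [| | | |e1 e2] := @ge0_integral_setX _ _ _ _ (@lebesgue_measure R)
    (@lebesgue_measure R) `[a, b]%classic `[c, d]%classic (EFin \o f).
- exact: measurable_itv.
- exact: measurable_itv.
- by apply/measurable_EFinP; exact: cont_measurable2.
- by move=> q; rewrite lee_fin.
split.
  rewrite e1 -integral1E; last by apply: (integral_on_continuous (integral_on_integral1 c d)).
  by apply: eq_integral => x _; rewrite integral1E//; cont.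
rewrite e2 -integral1E; last first.
  by apply: (integral_on_continuous (integral_on_integral1 a b) (f := fun q : R * R => f (q.2, q.1))); cont.
by apply: eq_integral => x _; rewrite integral1E//; cont.
Qed.


(** Reduces signed integrands to nonnegative ones, to which Tonelli applies without integrability
    conditions; both parts remain continuous. *)
Lemma pos_neg_parts {T : topologicalType} (f : T -> R) : continuous f ->
  exists g h : T -> R, [/\ continuous g, continuous h, forall x, 0 <= g x,
    forall x, 0 <= h x & f = (fun x => g x - h x)].
Proof.
move=> cf; exists (fun x => 2^-1 * (`|f x| + f x)), (fun x => 2^-1 * (`|f x| - f x)).
split; [cont|cont| | |].
- by move=> x; rewrite mulr_ge0 ?invr_ge0//; have := ler_norm (- f x); rewrite normrN; lra.
- by move=> x; rewrite mulr_ge0 ?invr_ge0// subr_ge0 ler_norm.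
- by apply/funext => x; field.
Qed.

Lemma integral1_comm (a b c d : R) (f : R * R -> R) : continuous f ->
  integral1 a b (fun x => integral1 c d (fun y => f (x, y))) =
  integral1 c d (fun y => integral1 a b (fun x => f (x, y))).
Proof.
move=> /pos_neg_parts [g [h [cg ch g0 h0 ->]]].
have [e1 e2] := ge0_integral_rect a b c d cg g0.
have [e3 e4] := ge0_integral_rect a b c d ch h0.
have [I1 I2] := (integral_on_integral1 a b, integral_on_integral1 c d).
have := integral_onB (integral_on_prod I1 I2) cg ch.
have := integral_onB (integral_on_prod I2 I1) (f := fun q : R * R => g (q.2, q.1)) (g := fun q : R * R => h (q.2, q.1)).
rewrite {1 4}/integral_prod /= => -> //; [|by cont|by cont].
rewrite {1}/integral_prod => ->.
exact: (congr2 (fun x y => x - y) (EFin_inj (etrans (esym e1) e2))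
  (EFin_inj (etrans (esym e3) e4))).
Qed.

Lemma integral_rectE (a b c d : R) (f : R * R -> R) : continuous f ->
  \int[leb2]_(q in `[a, b] `*` `[c, d]) f q =
  integral_prod (integral1 a b) (integral1 c d) f.
Proof.
move=> /pos_neg_parts [g [h [cg ch g0 h0 ->]]].
have I1 := integral_on_prod (integral_on_integral1 a b) (integral_on_integral1 c d).
rewrite (integral_onB I1)//.
have intP (k : R * R -> R) : continuous k -> (forall q, 0 <= k q) ->
    leb2.-integrable (`[a, b] `*` `[c, d]) (EFin \o k).
  move=> ck k0; apply/integrableP; split.
    by apply/measurable_EFinP; apply: measurable_funTS; exact: cont_measurable2.
  have [e _] := ge0_integral_rect a b c d ck k0.
  by under eq_integral do rewrite /= ger0_norm ?k0//; rewrite e ltry.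
rewrite RintegralB; [|by apply: measurableX; exact: measurable_itv|exact: intP..].
by rewrite /Rintegral (ge0_integral_rect a b c d cg g0).1 (ge0_integral_rect a b c d ch h0).1.
Qed.

(** Tonelli for [volume] needs its first factor, itself a product, as a sigma-finite measure. *)
Lemma sigma_finite_leb2 : sigma_finite setT leb2.
Proof.
have /sigma_finiteP[F [TF ndF Foo]] := sigma_finiteT (@lebesgue_measure R).
exists (fun n => F n `*` F n).
  rewrite -setXTT TF predeqE => -[x y]; split.
    move=> [/= [n _ Fnx] [k _ Gky]]; exists (maxn n k) => //; split.
    - by move: x Fnx; apply/subsetPset/ndF/leq_maxl.
    - by move: y Gky; apply/subsetPset/ndF/leq_maxr.
  by move=> [n _ []/= ? ?]; split; exists n.
move=> k; have [? ?] := Foo k; split; first exact: measurableX.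
by rewrite product_measure1E// lte_mul_pinfty// ge0_fin_numE.
Qed.

Definition square_integral : (R * R -> R) -> R :=
  integral_prod (integral1 0 (2 * pi)) (integral1 0 (2 * pi)).

Definition box_integral (Z : R) : (R * R * R -> R) -> R :=
  integral_prod square_integral (integral1 0 Z).

(** Half-open horizontally, as [cell] is, so that [cell] is exactly the increasing union of these
    sets. *)
Definition lower_cell (Z : R) : set (R * R * R) :=
  (`[0, 2 * pi[ `*` `[0, 2 * pi[) `*` `[0, Z].

Lemma measurable_lower_cell Z : measurable (lower_cell Z).
Proof. by do 2 (apply: measurableX; last exact: measurable_itv); exact: measurable_itv. Qed.

Lemma integral_lower_cell (Z : R) (f : R * R * R -> R) :
  continuous f -> (forall q, 0 <= f q) ->
  (\int[volume]_(q in lower_cell Z) (f q)%:E = (box_integral Z f)%:E)%E.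
Proof.
move=> cf f0.
have [IZ I1] := (integral_on_integral1 0 Z, integral_on_integral1 0 (2 * pi : R)).
have cg : continuous (fun q => integral1 0 Z (fun z => f (q, z))).
  exact: (integral_on_continuous IZ).
have g0 q : 0 <= integral1 0 Z (fun z => f (q, z)).
  by apply: (integral_on_ge0 IZ); [cont | move=> z _; exact: f0].
have mQ : measurable (`[0, 2 * pi[ `*` `[0, 2 * pi[ : set (R * R)).
  by apply: measurableX; exact: measurable_itv.
pose m2 : {sigma_finite_measure set _ -> \bar R} :=
  HB.pack leb2 (Measure_isSigmaFinite.Build _ _ _ leb2 sigma_finite_leb2).
have [| | | |-> _] := @ge0_integral_setX _ _ _ _
    m2
    (@lebesgue_measure R) (`[0, 2 * pi[ `*` `[0, 2 * pi[)%classic `[0, Z]%classic (EFin \o f).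
- by [].
- exact: measurable_itv.
- by apply/measurable_EFinP; exact: cont_measurable3.
- by move=> q; rewrite lee_fin.
transitivity (\int[leb2]_(q in (`[0%R, (2 * pi)%R[ `*` `[0%R, (2 * pi)%R[)%classic)
    (integral1 0 Z (fun z => f (q, z)))%:E)%E.
  by apply: eq_integral => q _; rewrite -integral1E//; cont.
have [| | | |-> _] := @ge0_integral_setX _ _ _ _ (@lebesgue_measure R)
    (@lebesgue_measure R) `[0, 2 * pi[%classic `[0, 2 * pi[%classic
    (fun q => (integral1 0 Z (fun z => f (q, z)))%:E).
- exact: measurable_itv.
- exact: measurable_itv.
- by apply/measurable_EFinP; exact: cont_measurable2.
- by move=> q; rewrite lee_fin.
(* The missing end point is a null set; this passes from the half-open periods of [cell] to the
   closed ones of [square_integral]. *)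
have bnd (k : R -> R) : continuous k ->
    (\int[lebesgue_measure]_(x in `[0%R, (2 * pi)%R[) (k x)%:E =
      (integral1 0 (2 * pi)%R k)%:E)%E.
  move=> ck; rewrite -integral1E// integral_itv_bndo_bndc//.
  by apply: measurable_funTS; apply/measurable_EFinP; exact: continuous_measurable_fun.
rewrite /box_integral/integral_prod/square_integral/integral_prod.
rewrite -[RHS]bnd; last exact: (integral_on_continuous I1 cg).
by apply: eq_integral => x _; rewrite bnd//; apply: (cont_comp cg); cont.
Qed.

Lemma cell_bigcup : cell = \bigcup_n lower_cell n%:R.
Proof.
apply/seteqP; split => [[[x y] z] [/= hx hy hz]|[[x y] z] [n _] [[/= hx hy] hz]].
  exists (Num.truncn z).+1 => //; rewrite /lower_cell /=; split; first by split; rewrite /= in_itv.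
  by rewrite /= in_itv/= hz/= ltW// truncnS_gt.
by move: hx hy hz; rewrite /= !in_itv/= => hx hy /andP[hz _].
Qed.

Lemma measurable_cell : measurable (@cell R).
Proof. by rewrite cell_bigcup; apply: bigcupT_measurable => n; exact: measurable_lower_cell. Qed.

(** Monotone convergence. Only some arbitrarily large heights are required, since the top flux is
    controlled at exceptional heights and not at all of them. *)
Lemma integral_cell_le (f : R * R * R -> R) (c : R) :
  continuous f -> (forall q, 0 <= f q) ->
  (forall Z0, exists2 Z, Z0 <= Z & box_integral Z f <= c) ->
  (\int[volume]_(q in cell) (f q)%:E <= c%:E)%E.
Proof.
move=> cf f0 fc; rewrite cell_bigcup.
have mono (Z Z' : R) : Z <= Z' -> lower_cell Z `<=` lower_cell Z'.
  move=> ZZ [[x y] z] [hxy /=]; rewrite !in_itv/= => /andP[h1 h2].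
  by split => //=; rewrite in_itv/= h1 (le_trans h2).
have mf (A : set _) : measurable_fun A (EFin \o f).
  by apply: measurable_funTS; apply/measurable_EFinP; exact: cont_measurable3.
have cv : (\int[volume]_(q in lower_cell n%:R) (f q)%:E)%E @[n --> \oo] -->
    (\int[volume]_(q in \bigcup_n lower_cell n%:R) (f q)%:E)%E.
  apply: ge0_nondecreasing_set_cvg_integral.
  - by move=> m n mn; rewrite subsetEset; apply: mono; rewrite ler_nat.
  - by move=> n; exact: measurable_lower_cell.
  - by move=> n; exact: mf.
  - by move=> n q _; rewrite lee_fin.
rewrite -(cvg_lim _ cv)//.
have sub (Z Z' : R) : Z <= Z' -> (\int[volume]_(q in lower_cell Z) (f q)%:E <=
    \int[volume]_(q in lower_cell Z') (f q)%:E)%E.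
  move=> ZZ; apply: ge0_subset_integral.
  - exact: measurable_lower_cell.
  - exact: measurable_lower_cell.
  - exact: mf.
  - by move=> *; rewrite lee_fin.
  - exact: mono.
apply: lime_le.
  by apply: ereal_nondecreasing_is_cvgn => m n mn; apply: sub; rewrite ler_nat.
near=> n; have [Z nZ hZ] := fc n%:R.
by apply: le_trans (sub _ _ nZ) _; rewrite integral_lower_cell// lee_fin.
Unshelve. all: by end_near. Qed.

Lemma box_integral_le_cell (f : R * R * R -> R) Z :
  continuous f -> (forall q, 0 <= f q) ->
  ((box_integral Z f)%:E <= \int[volume]_(q in cell) (f q)%:E)%E.
Proof.
move=> cf f0; rewrite -integral_lower_cell//.
apply: ge0_subset_integral => //.
- exact: measurable_lower_cell.
- exact: measurable_cell.
- by apply: measurable_funTS; apply/measurable_EFinP; exact: cont_measurable3.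
- by move=> *; rewrite lee_fin.
- by move=> [[x y] z] [[/=]]; rewrite /cell/= !in_itv/= => hx hy /andP[hz _].
Qed.

End Rectangles.

(** * Fejer kernels *)

Section Derivatives.
Context {R : realType}.
Implicit Types (f g : R -> R) (x a b : R).

Lemma is_derive_add f g x a b : is_derive x 1 f a -> is_derive x 1 g b ->
  is_derive x 1 (fun y => f y + g y) (a + b).
Proof. by move=> *; exact: is_deriveD. Qed.

Lemma is_derive_opp f x a : is_derive x 1 f a -> is_derive x 1 (fun y => - f y) (- a).
Proof. by move=> *; exact: is_deriveN. Qed.

Lemma is_derive_mul f g x a b : is_derive x 1 f a -> is_derive x 1 g b ->
  is_derive x 1 (fun y => f y * g y) (f x * b + g x * a).
Proof. by move=> *; exact: is_deriveM. Qed.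

Lemma is_derive_scale c f x a : is_derive x 1 f a ->
  is_derive x 1 (fun y => c * f y) (c * a).
Proof.
move=> h; apply: (is_derive_eq (is_derive_mul (is_derive_cst c _ _) h)).
by rewrite mulr0 addr0.
Qed.

End Derivatives.

Section Fejer.
Context {R : realType}.
Implicit Types (N : nat) (x d : R).

(** This is |sum_(j < N) e^(i j x)|^2 / N expanded over pairs, a form in which the integer
    frequencies j - k are visible; positivity is recovered in [fejerE]. *)
Definition fejer N x : R :=
  N%:R^-1 * \sum_(j < N) \sum_(k < N) cos ((j%:R - k%:R) * x).

Let C N x : R := \sum_(j < N) cos (j%:R * x).
Let S N x : R := \sum_(j < N) sin (j%:R * x).

Lemma fejerE N x : fejer N x = N%:R^-1 * (C N x ^+ 2 + S N x ^+ 2).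
Proof.
congr (_ * _); rewrite !expr2 !big_distrlr/= -big_split/=; apply: eq_bigr => j _.
rewrite -big_split/=; apply: eq_bigr => k _.
by rewrite mulrBl cosB.
Qed.

Lemma fejer_ge0 N x : 0 <= fejer N x.
Proof. by rewrite fejerE mulr_ge0 ?invr_ge0 ?addr_ge0 ?sqr_ge0. Qed.

(* C N x + i S N x is a geometric sum of ratio e^(i x), and
   |1 - e^(i x)|^2 = 2 (1 - cos x). *)
Lemma fejer_geometric N x :
  (C N x ^+ 2 + S N x ^+ 2) * (1 - cos x) = 1 - cos (N%:R * x).
Proof.
have [re im] : (1 - cos x) * C N x + sin x * S N x = 1 - cos (N%:R * x) /\
    (1 - cos x) * S N x - sin x * C N x = - sin (N%:R * x).
  elim: N => [|N [IH1 IH2]].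
    by rewrite /C /S !big_ord0 mul0r cos0 sin0; split; ring.
  rewrite /C /S !big_ord_recr/= -/(C N x) -/(S N x) -natr1
    [(N%:R + 1) * x]mulrDl mul1r cosD sinD.
  split.
    transitivity ((1 - cos x) * C N x + sin x * S N x
      + (1 - cos x) * cos (N%:R * x) + sin x * sin (N%:R * x)); first by ring.
    by rewrite IH1; ring.
  transitivity ((1 - cos x) * S N x - sin x * C N x
    + (1 - cos x) * sin (N%:R * x) - sin x * cos (N%:R * x)); first by ring.
  by rewrite IH2; ring.
have e1 := cos2Dsin2 x; have e2 := cos2Dsin2 (N%:R * x).
have : ((1 - cos x) * C N x + sin x * S N x) ^+ 2 +
    ((1 - cos x) * S N x - sin x * C N x) ^+ 2 =
    (C N x ^+ 2 + S N x ^+ 2) * (1 - 2 * cos x + (cos x ^+ 2 + sin x ^+ 2)).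
  by ring.
rewrite re im e1.
have -> : (1 - cos (N%:R * x)) ^+ 2 + (- sin (N%:R * x)) ^+ 2 =
  1 - 2 * cos (N%:R * x) + (cos (N%:R * x) ^+ 2 + sin (N%:R * x) ^+ 2) by ring.
by rewrite e2; lra.
Qed.

Lemma cont_cos_comp {T : topologicalType} (f : T -> R) :
  continuous f -> continuous (fun t => cos (f t)).
Proof. by move=> cf; apply: cont_comp => //; exact: continuous_cos. Qed.

Lemma cont_fejer N : continuous (fejer N).
Proof.
apply: contM; [cont | apply: cont_sum => j; apply: cont_sum => k].
by apply: cont_cos_comp; cont.
Qed.

Lemma integral_cos_int (m : int) (x0 : R) : m != 0 ->
  integral1 0 (2 * pi) (fun x => cos (m%:~R * (x - x0))) = 0.
Proof.
move=> m0; have m0' : m%:~R != 0 :> R by rewrite intr_eq0.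
have csin : continuous (fun x => m%:~R^-1 * sin (m%:~R * (x - x0))).
  by apply: contM; [cont | apply: (cont_comp (@continuous_sin R)); cont].
have ccos : continuous (fun x => cos (m%:~R * (x - x0))) by apply: cont_cos_comp; cont.
have dsin (x : R) : is_derive x 1 (fun x => m%:~R^-1 * sin (m%:~R * (x - x0)))
    (cos (m%:~R * (x - x0))).
  apply: is_derive_eq.
  by rewrite /GRing.scale/= subr0 mulr1 mulrC -mulrA mulfV// mulr1.
have pi0 : 0 <= 2 * pi :> R by rewrite mulr_ge0 ?pi_ge0.
rewrite (integral1_FTC pi0 ccos csin (fun x _ => dsin x)).
suff -> : sin (m%:~R * (2 * pi - x0)) = sin (m%:~R * (0 - x0)) by rewrite subrr.
rewrite mulrBr sub0r mulrN sinB sinN.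
have [-> ->] : cos (m%:~R * (2 * pi : R)) = 1 /\ sin (m%:~R * (2 * pi : R)) = 0.
  have nat_case (n : nat) : cos (n%:R * (2 * pi : R)) = 1 /\ sin (n%:R * (2 * pi : R)) = 0.
    elim: n => [|n [IHc IHs]]; first by rewrite mul0r cos0 sin0.
    have [c2 s2] : cos (2 * pi : R) = 1 /\ sin (2 * pi : R) = 0.
      by rewrite mulr_natl cos2pi mulr2n sinD sinpi mulr0 mul0r addr0.
    by rewrite -natr1 mulrDl mul1r cosD sinD IHc IHs c2 s2; split; ring.
  case: m {m0 m0' csin ccos dsin} => n; first exact: nat_case.
  by rewrite NegzE mulrNz mulNr cosN sinN -pmulrn; have [-> ->] := nat_case n.+1; rewrite oppr0.
by ring.
Qed.

(** Only the N diagonal terms j = k have a nonzero integral over a period. *)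
Lemma integral_fejer N x0 : (0 < N)%N ->
  integral1 0 (2 * pi) (fun x => fejer N (x - x0)) = 2 * pi.
Proof.
move=> N0; have I1 := integral_on_integral1 0 (2 * pi : R).
rewrite /fejer (integral_onZ I1); last first.
  by apply: cont_sum => j; apply: cont_sum => k; apply: cont_cos_comp; cont.
rewrite (integral_on_sum I1); last first.
  by move=> j; apply: cont_sum => k; apply: cont_cos_comp; cont.
transitivity (N%:R^-1 * \sum_(j < N) (2 * pi : R)).
  congr (_ * _); apply: eq_bigr => j _.
  rewrite (integral_on_sum I1); last by move=> k; apply: cont_cos_comp; cont.
  rewrite (bigD1 j)//= big1 ?addr0.
    have -> : (fun x => cos ((j%:R - j%:R) * (x - x0))) = (fun=> 1).
      by apply/funext => x; rewrite subrr mul0r cos0.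
    by rewrite integral1_cst ?subr0// mulr_ge0 ?pi_ge0.
  move=> k kj; transitivity (integral1 0 (2 * pi) (fun x => cos ((j%:Z - k%:Z)%:~R * (x - x0)))).
    by congr (integral1 _ _ _); apply/funext => x; rewrite intrB.
  rewrite integral_cos_int//.
  by rewrite subr_eq0 eqz_nat eq_sym.
by rewrite sumr_const card_ord -[X in _ * X]mulr_natl mulKf// pnatr_eq0 -lt0n.
Qed.

(** By [fejer_geometric] the kernel is (1 - cos (N x)) / (N (1 - cos x)). The numerator is at most
    2, and cos x <= cos d when x stays at distance d from 0 and from the next periods. *)
Lemma fejer_small N x d : (0 < N)%N -> 0 < d -> d <= `|x| <= 2 * pi - d ->
  fejer N x <= 2 / (1 - cos d) / N%:R.
Proof.
move=> N0 d0 /andP[dx xd].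
have dpi : d <= pi by have := pi_gt0 R; lra.
have cosx : cos x <= cos d.
  have -> : cos x = cos `|x| by case: (ger0P x) => // _; rewrite cosN.
  have le_cos y : d <= y -> y <= pi -> cos y <= cos d.
    move=> dy ypi; have [<-|dy'] := eqVneq d y; first by [].
    by rewrite ltW// ltr_cos ?in_itv/= ?ypi ?dpi ?(ltW d0) ?(le_trans (ltW d0) dy)// lt_neqAle dy'.
  have [xpi|pix] := leP `|x| pi; first exact: le_cos.
  have -> : cos `|x| = cos (2 * pi - `|x|).
    rewrite -[LHS]cosN -[LHS]cosD2pi; congr cos; rewrite -mulr_natl; ring.
  by apply: le_cos; lra.
have cd : cos d < 1.
  by rewrite -cos0 ltr_cos ?in_itv/= ?lexx ?pi_ge0// (ltW d0).
rewrite fejerE mulrC ler_pM2r ?invr_gt0 ?ltr0n// ler_pdivlMr ?subr_gt0//.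
apply: (@le_trans _ _ ((C N x ^+ 2 + S N x ^+ 2) * (1 - cos x))).
  by rewrite ler_wpM2l ?addr_ge0 ?sqr_ge0// lerB.
by rewrite fejer_geometric; have := cos_geN1 (N%:R * x); lra.
Qed.

(** cos A cos B exceeds cos (A + B) by sin A sin B, and the double sum of sin ((j - k) z) vanishes
    because exchanging j and k changes its sign. *)
Lemma fejer_prod N x y : fejer N x * fejer N y = N%:R ^- 2 *
  \sum_(q : 'I_N * 'I_N) \sum_(p : 'I_N * 'I_N)
    cos ((p.1%:R - q.1%:R) * x + (p.2%:R - q.2%:R) * y).
Proof.
rewrite /fejer mulrACA -invfM -expr2; congr (_ * _).
transitivity (\sum_(q : 'I_N * 'I_N) \sum_(p : 'I_N * 'I_N)
    (cos ((p.1%:R - q.1%:R) * x) * cos ((p.2%:R - q.2%:R) * y))).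
  rewrite -(pair_bigA _ (fun k m : 'I_N => \sum_(p : 'I_N * 'I_N)
    (cos ((p.1%:R - k%:R) * x) * cos ((p.2%:R - m%:R) * y))))/=.
  rewrite exchange_big/= [X in _ * X]exchange_big/= big_distrlr/=.
  apply: eq_bigr => k _; apply: eq_bigr => m _.
  rewrite -(pair_bigA _ (fun j l : 'I_N =>
    (cos ((j%:R - k%:R) * x) * cos ((l%:R - m%:R) * y))))/=.
  by rewrite big_distrlr.
have odd0 z : \sum_(j < N) \sum_(k < N) sin ((j%:R - k%:R) * z) = 0 :> R.
  have : \sum_(j < N) \sum_(k < N) sin ((j%:R - k%:R) * z) =
      - \sum_(j < N) \sum_(k < N) sin ((j%:R - k%:R) * z) :> R.
    rewrite {1}exchange_big -sumrN; apply: eq_bigr => j _; rewrite -sumrN.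
    by apply: eq_bigr => k _; rewrite -sinN -mulNr opprB.
  lra.
suff sin0 : \sum_(q : 'I_N * 'I_N) \sum_(p : 'I_N * 'I_N)
    (sin ((p.1%:R - q.1%:R) * x) * sin ((p.2%:R - q.2%:R) * y)) = 0.
  rewrite -[LHS]subr0 -[X in _ - X]sin0 -sumrB; apply: eq_bigr => q _.
  by rewrite -sumrB; apply: eq_bigr => p _; rewrite cosD.
rewrite -(pair_bigA _ (fun k m : 'I_N => \sum_(p : 'I_N * 'I_N)
  (sin ((p.1%:R - k%:R) * x) * sin ((p.2%:R - m%:R) * y))))/=.
transitivity ((\sum_(k < N) \sum_(j < N) sin ((j%:R - k%:R) * x)) *
    \sum_(m < N) \sum_(l < N) sin ((l%:R - m%:R) * y)).
  rewrite big_distrlr/=; apply: eq_bigr => k _; apply: eq_bigr => m _.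
  rewrite -(pair_bigA _ (fun j l : 'I_N =>
    (sin ((j%:R - k%:R) * x) * sin ((l%:R - m%:R) * y))))/=.
  by rewrite big_distrlr.
by rewrite exchange_big odd0 mul0r.
Qed.

End Fejer.

Lemma cont_bounded {R : realType} {T : topologicalType} (K : set T) (f : T -> R) :
  compact K -> continuous f -> exists M, forall x, K x -> `|f x| <= M.
Proof.
move=> cK cf; have /compact_bounded[M [_ hM]] :=
  continuous_compact (continuous_subspaceT cf) cK.
by exists (M + 1) => x Kx; apply: (hM _ _ (f x)); [rewrite ltrDl | exists x].
Qed.

(** * Pointwise bounds from sums of Fourier coefficients *)

Section FourierSup.
Context {R : realType}.

Lemma square_integral_on :
  integral_on (`[0, 2 * pi] `*` `[0, 2 * pi]) (@square_integral R).
Proof. by apply: integral_on_prod; exact: integral_on_integral1. Qed.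

Lemma square_integralM (f g : R -> R) : continuous f -> continuous g ->
  square_integral (fun q => f q.1 * g q.2) =
  integral1 0 (2 * pi) f * integral1 0 (2 * pi) g.
Proof.
move=> cf cg; have I1 := integral_on_integral1 0 (2 * pi : R).
rewrite mulrC -(integral_onZ I1)//; congr (integral1 _ _ _); apply/funext => x.
by rewrite /= (integral_onZ I1)// mulrC.
Qed.

(** Here f and g are values of the two one-dimensional Fejer kernels and b is the value of the
    function. Where b may fall below B, one kernel is at most k, so the loss M f g is at most M k (f
    + g), which is linear in the kernels and has a known integral. *)
Lemma kernel_lower_bound (B b M k f g : R) :
  0 <= M -> 0 <= k -> 0 <= f -> 0 <= g -> B - b <= M ->
  [\/ f <= k, g <= k | B <= b] ->
  B * (f * g) - M * k * (f + g) <= b * (f * g).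
Proof.
move=> M0 k0 f0 g0 bM far.
have fg0 := mulr_ge0 f0 g0.
have t1 := ler_wpM2r fg0 bM.
have t2 : 0 <= M * (k * f) by apply: mulr_ge0 => //; exact: mulr_ge0.
have t3 : 0 <= M * (k * g) by apply: mulr_ge0 => //; exact: mulr_ge0.
case: far => [fk|gk|Bb].
- have := ler_wpM2l M0 (ler_wpM2r g0 fk); lra.
- have := ler_wpM2l M0 (ler_wpM2l f0 gk); lra.
- have := ler_wpM2r fg0 Bb; lra.
Qed.

Lemma scaled_bound (P A B m : R) : 0 < P ->
  B * P - m * (P + P) <= P * A -> B <= A + 2 * m.
Proof. by move=> P0 h; rewrite -(ler_pM2l P0); lra. Qed.

Lemma dist_far (d z z0 : R) : d <= z0 -> d <= 2 * pi - z0 ->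
  0 <= z -> z <= 2 * pi -> d <= `|z - z0| -> d <= `|z - z0| <= 2 * pi - d.
Proof. by move=> *; apply/andP; split => //; rewrite ler_norml; lra. Qed.

Lemma limit_bound (A B M c : R) : A < B ->
  exists2 N : nat, (0 < N)%N & A + 2 * M * (c / N%:R) < B.
Proof.
move=> AB; have BA : 0 < B - A by rewrite subr_gt0.
exists (Num.truncn (2 * M * c / (B - A))).+1 => //.
have := truncnS_gt (2 * M * c / (B - A)).
rewrite ltr_pdivrMr// => h.
by rewrite -ltrBrDl [ltLHS]mulrA ltr_pdivrMr ?ltr0n// [ltRHS]mulrC.
Qed.

(* The Fejer mean of h at (x0, y0) is an average over pairs q in [0, N)^2 of
   sums of Fourier modes of h over the translates p - q of [0, N)^2. *)
Lemma fejer_mean_le (h : R * R -> R) (c : int * int -> R) (A : R) (x0 y0 : R) N :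
  (0 < N)%N -> continuous h ->
  (forall xi phi, square_integral (fun q =>
     h q * cos (xi.1%:~R * q.1 + xi.2%:~R * q.2 - phi)) <= (2 * pi) ^+ 2 * c xi) ->
  (forall s : seq (int * int), uniq s -> \sum_(xi <- s) c xi <= A) ->
  square_integral (fun q => h q * (fejer N (q.1 - x0) * fejer N (q.2 - y0)))
    <= (2 * pi) ^+ 2 * A.
Proof.
move=> N0 ch hc hA; have IQ := square_integral_on.
pose xi (p q : 'I_N * 'I_N) : int * int := (p.1%:Z - q.1%:Z, p.2%:Z - q.2%:Z).
pose phi p q : R := (xi p q).1%:~R * x0 + (xi p q).2%:~R * y0.
pose k p q (X : R * R) := h X *
  cos ((xi p q).1%:~R * X.1 + (xi p q).2%:~R * X.2 - phi p q).
have ck p q : continuous (k p q) by apply: contM => //; apply: cont_cos_comp; cont.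
rewrite (_ : (fun X => _) = fun X => N%:R ^- 2 *
    \sum_(q : 'I_N * 'I_N) \sum_(p : 'I_N * 'I_N) k p q X); last first.
  apply/funext => X; rewrite fejer_prod mulrCA; congr (_ * _).
  rewrite mulr_sumr; apply: eq_bigr => q _; rewrite mulr_sumr; apply: eq_bigr => p _.
  by congr (_ * cos _); rewrite /phi /xi/= !intrB/= -!pmulrn; ring.
rewrite (integral_onZ IQ); last by apply: cont_sum => q; apply: cont_sum => p.
rewrite (integral_on_sum IQ); last by move=> q; apply: cont_sum => p.
rewrite ler_pdivrMl ?exprn_gt0 ?ltr0n//.
apply: (@le_trans _ _ (\sum_(q : 'I_N * 'I_N) ((2 * pi) ^+ 2 * A))); last first.
  by rewrite sumr_const card_prod card_ord -[leLHS]mulr_natl natrM expr2.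
apply: ler_sum => q _; rewrite (integral_on_sum IQ)//.
apply: (@le_trans _ _ (\sum_(p : 'I_N * 'I_N) ((2 * pi) ^+ 2 * c (xi p q)))).
  by apply: ler_sum => p _; exact: hc.
rewrite -mulr_sumr ler_wpM2l ?sqr_ge0//.
(* For fixed q the frequencies p - q are pairwise distinct, which is what makes the hypothesis on
   duplicate-free lists applicable. *)
have -> : \sum_(p : 'I_N * 'I_N) c (xi p q) =
    \sum_(z <- [seq xi p q | p <- index_enum _]) c z by rewrite big_map.
apply: hA; rewrite map_inj_uniq ?index_enum_uniq// => -[a b] [a' b'] [] /=.
by move=> /addIr [e1] /addIr [e2]; congr (_, _); apply: val_inj.
Qed.

(** If A < B < h (x0, y0), then h >= B near the point, and the mean against the normalized kernel is
    at least B - O(1/N), while [fejer_mean_le] keeps it below A. All phases phi occur because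
    centring the kernel at (x0, y0) shifts the cosines. The point is interior because periodicity of
    h is not assumed: differences x - x0 then stay away from the neighbouring peaks of the kernel at
    2 pi and - 2 pi. *)
Lemma fourier_sup_le (h : R * R -> R) (c : int * int -> R) (A x0 y0 : R) :
  continuous h ->
  (forall xi phi, square_integral (fun q =>
     h q * cos (xi.1%:~R * q.1 + xi.2%:~R * q.2 - phi)) <= (2 * pi) ^+ 2 * c xi) ->
  (forall s : seq (int * int), uniq s -> \sum_(xi <- s) c xi <= A) ->
  0 < x0 < 2 * pi -> 0 < y0 < 2 * pi -> h (x0, y0) <= A.
Proof.
move=> ch hc hA /andP[x00 x01] /andP[y00 y01]; rewrite leNgt; apply/negP => Ah.
have IQ := square_integral_on.
pose B := (A + h (x0, y0)) / 2.
have [AB Bh] : A < B /\ B < h (x0, y0) by rewrite /B; split; lra.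
have [d [d0 [dx dx'] [dy dy'] hd]] : exists d : R, [/\ 0 < d,
    d <= x0 /\ d <= 2 * pi - x0, d <= y0 /\ d <= 2 * pi - y0 &
    forall x y, `|x - x0| < d -> `|y - y0| < d -> B <= h (x, y)].
  have /cvgrPdist_lt/(_ (h (x0, y0) - B)) := ch (x0, y0).
  rewrite subr_gt0 => /(_ Bh) [[U V] /= [/nbhs_ballP[e e0 eU] /nbhs_ballP[e' e'0 eV] UV]].
  pose d := Num.min (Num.min e e') (Num.min (Num.min x0 (2 * pi - x0))
    (Num.min y0 (2 * pi - y0))).
  exists d; rewrite /d !lt_min !ge_min !lexx !orbT /= e0 e'0 x00 y00 !subr_gt0 x01 y01.
  split => // x y; rewrite !lt_min => /andP[/andP[xe _] _] /andP[/andP[_ ye] _].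
  have /= := UV (x, y); rewrite /= => /(_ _)/ltW.
  move=> /(_ (conj (eU _ _) (eV _ _))); rewrite /ball/= ![`|_ - x|]distrC ![`|_ - y|]distrC.
  by move=> /(_ xe ye); have := ler_norm (h (x0, y0) - h (x, y)); lra.
have [M hM] : exists M, forall q, (`[0, 2 * pi] `*` `[0, 2 * pi])%classic q -> `|h q - B| <= M.
  apply: cont_bounded; last by cont.
  by apply: compact_setX; exact: segment_compact.
have pi20 : 0 < 2 * pi :> R by rewrite mulr_gt0 ?pi_gt0.
have M0 : 0 <= M.
  by apply: le_trans (hM (x0, y0) _); rewrite //= !in_itv/= !ltW.
(* The constant of [fejer_small]: off the d-neighbourhood the kernel is at most c1 / N. *)
pose c1 := 2 / (1 - cos d) : R.
have cd : 0 <= c1 by rewrite divr_ge0// subr_ge0 cos_le1.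
suff main N : (0 < N)%N -> B <= A + 2 * M * (c1 / N%:R).
  have [N N0] := limit_bound M c1 AB.
  by rewrite ltNge main.
move=> N0.
  pose F1 (q : R * R) := fejer N (q.1 - x0); pose F2 (q : R * R) := fejer N (q.2 - y0).
  have cF : continuous (fun x => fejer N (x - x0)).
    by apply: (cont_comp (@cont_fejer R N)); cont.
  have cG : continuous (fun x => fejer N (x - y0)).
    by apply: (cont_comp (@cont_fejer R N)); cont.
  have c1' : continuous (fun _ : R => 1 : R) by cont.
  have cF1 : continuous F1 by apply: (cont_comp cF); cont.
  have cF2 : continuous F2 by apply: (cont_comp cG); cont.
  have I1 : integral1 0 (2 * pi) (fun=> 1) = 2 * pi :> R.
    by rewrite integral1_cst ?subr0// ltW.
  have J1 : square_integral F1 = (2 * pi) ^+ 2.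
    rewrite (_ : F1 = fun q => fejer N (q.1 - x0) * 1); last by apply/funext => q; rewrite mulr1.
    by rewrite (square_integralM cF c1') integral_fejer// I1 expr2.
  have J2 : square_integral F2 = (2 * pi) ^+ 2.
    rewrite (_ : F2 = fun q => 1 * fejer N (q.2 - y0)); last by apply/funext => q; rewrite mul1r.
    by rewrite (square_integralM c1' cG) integral_fejer// I1 expr2.
  have J12 : square_integral (fun q => F1 q * F2 q) = (2 * pi) ^+ 2.
    by rewrite (square_integralM cF cG) !integral_fejer// expr2.
  have up := fejer_mean_le x0 y0 N0 ch hc hA.
  have low : square_integral (fun q => B * (F1 q * F2 q) - M * (c1 / N%:R) * (F1 q + F2 q))
      <= square_integral (fun q => h q * (F1 q * F2 q)).
    apply: (integral_on_le IQ); [by cont|by cont|].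
    move=> [x y] /= [hx hy].
    have hxy := hM (x, y) (conj hx hy).
    move: hx hy; rewrite /= !in_itv/= => /andP[hx0 hx1] /andP[hy0 hy1].
    have [f1 f2] : 0 <= F1 (x, y) /\ 0 <= F2 (x, y) by split; exact: fejer_ge0.
    have cN : 0 <= c1 / N%:R by rewrite divr_ge0.
    have hM1 : B - h (x, y) <= M.
      by apply: le_trans hxy; rewrite -normrN opprB ler_norm.
    apply: kernel_lower_bound => //.
    have [far|near1] := leP d `|x - x0|.
      apply: Or31; apply: fejer_small => //; exact: dist_far.
    have [far|near2] := leP d `|y - y0|.
      apply: Or32; apply: fejer_small => //; exact: dist_far.
    by apply: Or33; apply: hd.
  move: low; rewrite (integral_onB IQ); [|by cont|by cont].
  rewrite (integral_onZ IQ); last by cont.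
  rewrite (@integral_onZ _ _ _ _ IQ _ (fun q => F1 q + F2 q)); last by cont.
  rewrite (integral_onD IQ)// J12 J1 J2 => low.
  have := le_trans low up; have := exprn_gt0 2 pi20.
  by rewrite -mulrA; exact: scaled_bound.
Qed.

End FourierSup.

(** * The local energy balance *)

Section Commutation.
Context {R : realType}.

Definition commuting {V W : topologicalType} (L : (V -> R) -> R) (M : (W -> R) -> R) :=
  forall f : V * W -> R, continuous f ->
    L (fun v => M (fun w => f (v, w))) = M (fun w => L (fun v => f (v, w))).

Lemma commuting_integral1 (a b c d : R) : commuting (integral1 a b) (integral1 c d).
Proof. by move=> f; exact: integral1_comm. Qed.

Lemma commuting_prod {V W1 W2 : topologicalType} (K : set V) (K1 : set W1) (K2 : set W2)
    (L : (V -> R) -> R) M1 M2 :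
  integral_on K L -> integral_on K1 M1 -> integral_on K2 M2 ->
  commuting L M1 -> commuting L M2 -> commuting L (integral_prod M1 M2).
Proof.
move=> HL H1 H2 c1 c2 f cf; rewrite /integral_prod.
rewrite (c1 (fun q => M2 (fun w => f (q.1, (q.2, w))))); last first.
  by apply: (integral_on_continuous H2 (f := fun q : V * W1 * W2 => f (q.1.1, (q.1.2, q.2)))); cont.
congr M1; apply/funext => w.
by rewrite (c2 (fun q => f (q.1, (w, q.2))))//; cont.
Qed.

Lemma box_integral_on (Z : R) :
  integral_on ((`[0, 2 * pi] `*` `[0, 2 * pi]) `*` `[0, Z]) (@box_integral R Z).
Proof. by apply: integral_on_prod; [exact: square_integral_on | exact: integral_on_integral1]. Qed.

Lemma commuting_square a b : commuting (integral1 a b) (@square_integral R).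
Proof.
by apply: commuting_prod; (exact: integral_on_integral1 || exact: commuting_integral1).
Qed.

Lemma commuting_box a b Z : commuting (integral1 a b) (@box_integral R Z).
Proof.
apply: commuting_prod; [exact: integral_on_integral1|exact: square_integral_on|
  exact: integral_on_integral1|exact: commuting_square|exact: commuting_integral1].
Qed.

End Commutation.

Lemma sum_ord3 (V : nmodType) (F : 'I_3 -> V) :
  \sum_j F j = F (inord 0) + F (inord 1) + F (inord 2).
Proof.
rewrite !big_ord_recl big_ord0 addr0 addrA.
by congr (F _ + F _ + F _); apply: val_inj; rewrite /= inordK.
Qed.

(** * Partial derivatives along coordinate lines and the divergence theorem on a box *)

Section Coordinates.
Context {R : realType}.
Implicit Types (j : 'I_3) (X : R * R * R) (f g : R * R * R -> R).

Definition coord j X : R :=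
  match val j with 0 => X.1.1 | 1 => X.1.2 | _ => X.2 end.

Definition set_coord j X s : R * R * R :=
  match val j with 0 => (s, X.1.2, X.2) | 1 => (X.1.1, s, X.2) | _ => (X.1, s) end.

(** The vertical derivative is asked for at z > 0 only: a function extended by constants to z < 0
    has in general a corner at z = 0. *)
Definition has_partial j f g := forall X, (val j = 2%N -> 0 < X.2) ->
  is_derive (coord j X) 1 (fun s => f (set_coord j X s)) (g X).

Lemma set_coordK j X : set_coord j X (coord j X) = X.
Proof. by rewrite /set_coord /coord; case: X => [[x y] z]; case: (val j) => [|[|k]]. Qed.

Lemma has_partialD j f f' g g' : has_partial j f g -> has_partial j f' g' ->
  has_partial j (fun X => f X + f' X) (fun X => g X + g' X).
Proof. by move=> h h' X jX; apply: is_derive_add; [exact: h | exact: h']. Qed.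

Lemma has_partialN j f g : has_partial j f g ->
  has_partial j (fun X => - f X) (fun X => - g X).
Proof. by move=> h X jX; apply: is_derive_opp; exact: h. Qed.

Lemma has_partialB j f f' g g' : has_partial j f g -> has_partial j f' g' ->
  has_partial j (fun X => f X - f' X) (fun X => g X - g' X).
Proof. by move=> h h'; apply: has_partialD => //; exact: has_partialN. Qed.

Lemma has_partialM j f f' g g' : has_partial j f g -> has_partial j f' g' ->
  has_partial j (fun X => f X * f' X) (fun X => f X * g' X + g X * f' X).
Proof.
move=> h h' X jX; have := is_derive_mul (h X jX) (h' X jX).
by rewrite set_coordK [f' X * _]mulrC.
Qed.

Lemma has_partialZ j f g c : has_partial j f g ->
  has_partial j (fun X => c * f X) (fun X => c * g X).
Proof. by move=> h X jX; apply: is_derive_scale; exact: h. Qed.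

Lemma has_partial_sum j (F G : 'I_3 -> R * R * R -> R) :
  (forall i, has_partial j (F i) (G i)) ->
  has_partial j (fun X => \sum_i F i X) (fun X => \sum_i G i X).
Proof.
move=> h X jX; elim: (index_enum _) => [|i s IH].
  under eq_fun do rewrite big_nil.
  by rewrite big_nil; exact: is_derive_cst.
under eq_fun do rewrite big_cons.
by rewrite big_cons; apply: is_derive_add => //; exact: h.
Qed.

Lemma has_partial_eq j f g g' : has_partial j f g -> (forall X, g X = g' X) ->
  has_partial j f g'.
Proof. by move=> h e X jX; rewrite -e; exact: h. Qed.

Lemma integral1_0 (a b : R) : integral1 a b (fun=> 0) = 0.
Proof. exact: (integral_on0 (integral_on_integral1 a b)). Qed.

(** For each j the integrals are exchanged until the differentiated variable is innermost and the
    fundamental theorem applies. Periodicity cancels the lateral faces, so that only the top and the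
    bottom remain. *)
Lemma divergence (Z : R) (F G : 'I_3 -> R * R * R -> R) :
  0 <= Z -> (forall j, continuous (F j)) -> (forall j, continuous (G j)) ->
  (forall j, has_partial j (F j) (G j)) ->
  (forall y z, F (inord 0) (2 * pi, y, z) = F (inord 0) (0, y, z)) ->
  (forall x z, F (inord 1) (x, 2 * pi, z) = F (inord 1) (x, 0, z)) ->
  box_integral Z (fun X => \sum_j G j X) =
  square_integral (fun q => F (inord 2) (q, Z) - F (inord 2) (q, 0)).
Proof.
move=> Z0 cF cG FG per0 per1.
have pi0 : 0 <= 2 * pi :> R by rewrite mulr_ge0 ?pi_ge0.
have [IB IQ] := (@box_integral_on R Z, @square_integral_on R).
have E := integral_on_sum IB (index_enum _) cG.
transitivity (\sum_j box_integral Z (G j)); first exact: E.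
rewrite sum_ord3.
have cg i : continuous (fun q : R * R => integral1 0 Z (fun z => G i (q, z))).
  exact: (integral_on_continuous (integral_on_integral1 0 Z)).
have -> : box_integral Z (G (inord 0)) = 0.
  rewrite /box_integral /square_integral /integral_prod.
  rewrite (integral1_comm 0 (2 * pi) 0 (2 * pi) (cg (inord 0))).
  rewrite -[RHS](integral1_0 0 (2 * pi)); congr (integral1 _ _ _); apply/funext => y.
  rewrite (@integral1_comm _ _ _ _ _ (fun q => G (inord 0) (q.1, y, q.2))); last by cont.
  rewrite -[RHS](integral1_0 0 Z); congr (integral1 _ _ _); apply/funext => z.
  transitivity (F (inord 0) (2 * pi, y, z) - F (inord 0) (0, y, z)); last by rewrite per0 subrr.
  apply: (@integral1_FTC _ _ _ (fun x => F (inord 0) (x, y, z))) => //; [by cont..|].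
  move=> x _; have := FG (inord 0) (x, y, z).
  by rewrite /set_coord /coord /= inordK//; apply.
have -> : box_integral Z (G (inord 1)) = 0.
  rewrite /box_integral /square_integral /integral_prod.
  rewrite -[RHS](integral1_0 0 (2 * pi)); congr (integral1 _ _ _); apply/funext => x.
  rewrite (@integral1_comm _ _ _ _ _ (fun q => G (inord 1) (x, q.1, q.2))); last by cont.
  rewrite -[RHS](integral1_0 0 Z); congr (integral1 _ _ _); apply/funext => z.
  transitivity (F (inord 1) (x, 2 * pi, z) - F (inord 1) (x, 0, z)); last by rewrite per1 subrr.
  apply: (@integral1_FTC _ _ _ (fun y => F (inord 1) (x, y, z))) => //; [by cont..|].
  move=> y _; have := FG (inord 1) (x, y, z).
  by rewrite /set_coord /coord /= inordK//; apply.
rewrite !add0r; apply: (integral_on_eq IQ); [exact: cg|by cont|].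
move=> [x y] _; apply: (@integral1_FTC _ _ _ (fun z => F (inord 2) (x, y, z))) => //; [by cont..|].
move=> z /andP[z0 _]; have := FG (inord 2) (x, y, z).
by rewrite /set_coord /coord /= inordK//; apply.
Qed.

End Coordinates.

(** * Pointwise identities and inequalities for the energy balance *)

Section Algebra.
Context {R : realType}.
Implicit Types (u w ut wt dp dq : 'I_3 -> R) (du dw ddu : 'I_3 -> 'I_3 -> R).

(** The sum over j on the left is the divergence of the flux expanded by the product rule. The
    convective terms combine through u.grad u - w.grad w = u.grad (u - w) + (u - w).grad w. Once the
    time derivatives and one diagonal entry of each gradient are eliminated, the identity is
    polynomial. *)
Lemma energy_identity (nu p q : R) u w ut wt dp dq du dw ddu :
  (forall i, ut i + \sum_j u j * du i j + dp i = nu * \sum_j ddu i j) ->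
  (forall i, wt i + \sum_j w j * dw i j + dq i = 0) ->
  \sum_j du j j = 0 -> \sum_j dw j j = 0 ->
  \sum_i (u i - w i) * (ut i - wt i) +
  \sum_j (u j * (\sum_i (u i - w i) * (du i j - dw i j)) +
     du j j * (2^-1 * \sum_i (u i - w i) ^+ 2) +
     ((p - q) * (du j j - dw j j) + (dp j - dq j) * (u j - w j)) -
     nu * \sum_i ((u i - w i) * ddu i j + (du i j - dw i j) * du i j)) =
  - (\sum_i \sum_j (u i - w i) * (u j - w j) * dw i j)
  - nu * \sum_i \sum_j (du i j - dw i j) * du i j.
Proof.
move=> mu mw; rewrite !sum_ord3 => divu divw.
have eu i : ut i = nu * \sum_j ddu i j - \sum_j u j * du i j - dp i by rewrite -mu; ring.
have ew i : wt i = - \sum_j w j * dw i j - dq i by have := mw i; lra.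
have {}divu : du (inord 2) (inord 2) = - (du (inord 0) (inord 0) + du (inord 1) (inord 1)) by lra.
have {}divw : dw (inord 2) (inord 2) = - (dw (inord 0) (inord 0) + dw (inord 1) (inord 1)) by lra.
rewrite !eu !ew !sum_ord3 divu divw.
by ring.
Qed.

(** The convective part uses |v_i v_j| <= (v_i^2 + v_j^2) / 2, whose sum over the nine pairs is 3
    |v|^2. The viscous part completes the square in du - dw / 2, so no bound on the gradient of u is
    needed. *)
Lemma source_le (nu B : R) u w du dw : 0 <= nu -> 0 <= B ->
  (forall i j, `|dw i j| <= B) ->
  - (\sum_i \sum_j (u i - w i) * (u j - w j) * dw i j)
  - nu * \sum_i \sum_j (du i j - dw i j) * du i j <=
  3 * B * \sum_i (u i - w i) ^+ 2 + nu * \sum_i \sum_j dw i j ^+ 2.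
Proof.
move=> nu0 B0 dwB; apply: lerD.
  rewrite -sumrN; apply: (@le_trans _ _ (\sum_i \sum_j
      B * (2^-1 * ((u i - w i) ^+ 2 + (u j - w j) ^+ 2)))).
    apply: ler_sum => i _; rewrite -sumrN; apply: ler_sum => j _.
    apply: (@le_trans _ _ (`|dw i j| * `|(u i - w i) * (u j - w j)|)).
      by rewrite -normrM [_ * (_ * _)]mulrC -normrN ler_norm.
    apply: ler_pM => //; rewrite ler_norml.
    have := sqr_ge0 ((u i - w i) - (u j - w j)).
    have := sqr_ge0 ((u i - w i) + (u j - w j)).
    by move=> *; apply/andP; split; lra.
  by rewrite !sum_ord3; lra.
rewrite -mulrN ler_wpM2l// -sumrN; apply: ler_sum => i _; rewrite -sumrN; apply: ler_sum => j _.
have := sqr_ge0 (du i j - 2^-1 * dw i j); have := sqr_ge0 (dw i j); lra.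
Qed.

(** Here r is the pressure difference. The Young weight eta / (1 + Z) on r^2 offsets the linear
    growth in Z of the slices of the pressure. The price is the factor 1 + Z on terms integrable in
    z, which [good_height] absorbs. *)
Lemma flux_le (nu Bu eta Z r : R) u v d : 0 <= nu -> 0 <= Bu -> 0 < eta -> 0 <= Z ->
  (forall i : 'I_3, `|u i| <= Bu) -> forall j : 'I_3,
  - (u j * (2^-1 * \sum_i v i ^+ 2) + r * v j - nu * \sum_i v i * d i) <=
  eta * (r ^+ 2 / (1 + Z)) +
  (1 + Z) * ((Bu + eta^-1 + nu) * (\sum_i v i ^+ 2 + \sum_i d i ^+ 2)) :> R.
Proof.
move=> nu0 B0 eta0 Z0 uB j.
set E := \sum_i v i ^+ 2; set D := \sum_i d i ^+ 2.
have E0 : 0 <= E by apply: sumr_ge0 => i _; exact: sqr_ge0.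
have D0 : 0 <= D by apply: sumr_ge0 => i _; exact: sqr_ge0.
have vE : v j ^+ 2 <= E.
  by rewrite /E (bigD1 j)//= lerDl; apply: sumr_ge0 => i _; exact: sqr_ge0.
have t1 : - (u j * (2^-1 * E)) <= Bu * E.
  rewrite -mulNr; apply: (@le_trans _ _ (Bu * (2^-1 * E))).
    apply: ler_wpM2r; first by rewrite mulr_ge0.
    by rewrite (le_trans _ (uB j))// -normrN ler_norm.
  by apply: ler_wpM2l => //; lra.
have t3 : nu * \sum_i v i * d i <= nu * (E + D).
  apply: ler_wpM2l => //; rewrite -big_split/=; apply: ler_sum => i _.
  have := sqr_ge0 (v i - d i); have := sqr_ge0 (v i); have := sqr_ge0 (d i); lra.
have Z1 : 0 < 1 + Z by lra.
have t2 : - (r * v j) <= eta * (r ^+ 2 / (1 + Z)) + (1 + Z) * (eta^-1 * E).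
  have k0 : 0 < eta / (1 + Z) by rewrite divr_gt0.
  have := mulr_ge0 (ltW k0) (sqr_ge0 (r + (1 + Z) / eta * v j / 2)).
  have -> : eta / (1 + Z) * (r + (1 + Z) / eta * v j / 2) ^+ 2 =
    eta * (r ^+ 2 / (1 + Z)) + r * v j + (1 + Z) * (eta^-1 * v j ^+ 2) / 4.
    by field; rewrite !lt0r_neq0.
  have i0 : 0 <= eta^-1 by rewrite invr_ge0 ltW.
  have h1 := ler_wpM2l (ltW Z1) (ler_wpM2l i0 vE).
  have h2 := mulr_ge0 (ltW Z1) (mulr_ge0 i0 E0).
  lra.
have h4 := mulr_ge0 Z0 (mulr_ge0 B0 E0).
have h5 := mulr_ge0 Z0 (mulr_ge0 nu0 (addr_ge0 E0 D0)).
have h6 := mulr_ge0 B0 D0.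
have h7 := mulr_ge0 Z0 h6.
have h8 : 0 <= eta^-1 * D by rewrite mulr_ge0// invr_ge0 ltW.
have h9 := mulr_ge0 Z0 h8.
lra.
Qed.

End Algebra.

(** * One-variable integral inequalities *)

Section Reals.
Context {R : realType}.

(** The variance of f about its mean m over [0, Z] is nonnegative. *)
Lemma integral1_cauchy_schwarz (Z : R) (f : R -> R) : 0 <= Z -> continuous f ->
  integral1 0 Z f ^+ 2 <= Z * integral1 0 Z (fun z => f z ^+ 2).
Proof.
rewrite le_eqVlt => /orP[/eqP <- cf|Z0 cf].
  by rewrite mul0r /integral1 set_itv1 Rintegral_set1 expr0n.
have I1 := integral_on_integral1 0 Z.
pose m := integral1 0 Z f / Z.
have : 0 <= integral1 0 Z (fun z => (f z - m) ^+ 2).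
  by apply: (integral_on_ge0 I1) => [|z _]; [cont | exact: sqr_ge0].
rewrite (_ : (fun z => _) = fun z => (f z ^+ 2 - (2 * m) * f z) + m ^+ 2); last first.
  by apply/funext => z; ring.
rewrite (integral_onD I1); [|by cont|by cont].
rewrite (integral_onB I1); [|by cont|by cont].
rewrite (integral_onZ I1)// (integral_on_cst I1) integral1_cst ?(ltW Z0)// subr0.
have -> : integral1 0 Z f = m * Z by rewrite /m divfK ?lt0r_neq0.
by move=> h; have := mulr_ge0 (ltW Z0) h; lra.
Qed.

(** Otherwise A would exceed e / (1 + Z) at every height beyond Z0, and its integral would
    diverge. *)
Lemma good_height (A : R -> R) (C : R) : continuous A ->
  (forall Z, 0 <= Z -> integral1 0 Z A <= C) ->
  (forall Z, 0 <= A Z) ->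
  forall e Z0, 0 < e -> 0 <= Z0 -> exists2 Z, Z0 <= Z & (1 + Z) * A Z <= e.
Proof.
move=> cA hC A0 e Z0 e0 Z00; apply: contrapT => hn.
have low Z : Z0 <= Z -> e / (1 + Z) < A Z.
  move=> ZZ; rewrite ltr_pdivrMr ?ltr_wpDr//; last by rewrite (le_trans Z00).
  by rewrite ltNge mulrC; apply/negP => h; apply: hn; exists Z.
have grow n : exists2 Z, Z0 <= Z & n%:R * (e / 2) <= integral1 0 Z A.
  elim: n => [|n [Z ZZ IH]].
    exists Z0 => //; rewrite mul0r.
    by apply: (integral_on_ge0 (integral_on_integral1 0 Z0)) => // v _; exact: A0.
  have Zpos : 0 <= Z by exact: le_trans ZZ.
  have ZZ' : Z <= 2 * Z + 1 by lra.
  (* 1 + z doubles over [Z, 2 Z + 1], an interval of length Z + 1 on which e / (1 + z) is at least e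
     / (2 Z + 2): each such step adds e / 2. *)
  exists (2 * Z + 1); first exact: le_trans ZZ'.
  have split_ : integral1 0 (2 * Z + 1) A = integral1 0 Z A + integral1 Z (2 * Z + 1) A.
    rewrite /integral1 -(Rintegral_itv_obnd_cbnd (r := Z)).
    rewrite -(Rintegral_itvB (a := BLeft 0) (b := BRight (2 * Z + 1)) (x := Z)).
    - by rewrite addrCA subrr addr0.
    - exact: cont_integrable.
    - by rewrite bnd_simp.
    - by rewrite bnd_simp.
    - apply: (integrableS _ _ _ (cont_integrable Z (2 * Z + 1) cA)) => //.
      by apply: subset_itvr; rewrite bnd_simp.
  have e2 : e / 2 <= integral1 Z (2 * Z + 1) A.
    have -> : e / 2 = e / (2 * Z + 2) * integral1 Z (2 * Z + 1) (fun=> 1).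
      rewrite integral1_cst//; field; apply: lt0r_neq0; lra.
    rewrite -(integral_on_cst (integral_on_integral1 _ _)).
    apply: (integral_on_le (integral_on_integral1 _ _)) => //; first by cont.
    move=> z; rewrite /= in_itv/= => /andP[z1 z2].
    apply: (le_trans _ (ltW (low z _))); last exact: le_trans z1.
    apply: ler_wpM2l; first exact: ltW.
    by rewrite lef_pV2 ?posrE; lra.
  by rewrite split_ -natr1; lra.
have [Z ZZ hZ] := grow (Num.truncn (2 * C / e)).+1.
have := le_trans hZ (hC Z (le_trans Z00 ZZ)).
have := truncnS_gt (2 * C / e); rewrite ltr_pdivrMr//; lra.
Qed.

Lemma integral_exp (a b k : R) : a <= b -> 0 < k ->
  integral1 a b (fun s => expR (k * s)) <= expR (k * b) / k.
Proof.
move=> ab k0.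
have ce : continuous (fun s => expR (k * s)) by apply: (cont_comp (@continuous_expR R)); cont.
have -> : integral1 a b (fun s => expR (k * s)) = expR (k * b) / k - expR (k * a) / k.
  apply: (@integral1_FTC _ _ _ (fun s => expR (k * s) / k)) => //; first by cont.
  move=> x _; apply: is_derive_eq.
  by rewrite /GRing.scale/= mulr0 add0r mulr1 mulrC mulfK// lt0r_neq0.
by rewrite lerBlDr lerDl divr_ge0 ?expR_ge0// ltW.
Qed.

End Reals.

Definition slice {R : realType} (f : R * (R * R * R) -> R) (t : R) : R * R * R -> R :=
  fun X => f (t, X).

(** What is kept of a solution once it is extended by constants: continuity and the equations hold
    at all points, derivatives only where the extension has them. The derivatives are data, tied to
    u and p by the fields. The right-hand side f lets one record serve both systems, with the
    viscous term for Navier-Stokes and 0 for Euler. *)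
Record flow (R : realType) (t1 t2 : R) (u : 'I_3 -> R * (R * R * R) -> R)
    (du : 'I_3 -> 'I_3 -> R * (R * R * R) -> R) (ut : 'I_3 -> R * (R * R * R) -> R)
    (p : R * (R * R * R) -> R) (dp f : 'I_3 -> R * (R * R * R) -> R) : Prop := Flow {
  flow_u : forall i, continuous (u i);
  flow_du : forall i j, continuous (du i j);
  flow_ut : forall i, continuous (ut i);
  flow_p : continuous p;
  flow_dp : forall i, continuous (dp i);
  flow_partial : forall t i j, has_partial j (slice (u i) t) (slice (du i j) t);
  flow_partial_p : forall t j, has_partial j (slice p t) (slice (dp j) t);
  flow_time : forall t X i, t1 < t < t2 ->
    is_derive t 1 (fun s => u i (s, X)) (ut i (t, X));
  flow_div : forall q, \sum_j du j j q = 0;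
  flow_momentum : forall i q, ut i q + \sum_j u j q * du i j q + dp i q = f i q;
  flow_periodic : forall t y z,
    [/\ forall i, u i (t, (2 * pi, y, z)) = u i (t, (0, y, z)) /\
                   u i (t, (y, 2 * pi, z)) = u i (t, (y, 0, z)),
        forall i j, du i j (t, (2 * pi, y, z)) = du i j (t, (0, y, z)) /\
                   du i j (t, (y, 2 * pi, z)) = du i j (t, (y, 0, z)) &
        p (t, (2 * pi, y, z)) = p (t, (0, y, z)) /\
        p (t, (y, 2 * pi, z)) = p (t, (y, 0, z))];
  flow_bottom : forall t x y, u (inord 2) (t, (x, y, 0)) = 0 }.

(** * The energy balance integrated over a box and a time interval *)

Section EnergyBalance.
Context {R : realType} (t1 t2 nu : R).
Context {u w : 'I_3 -> R * (R * R * R) -> R} {du dw ddu : 'I_3 -> 'I_3 -> R * (R * R * R) -> R}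
  {ut wt : 'I_3 -> R * (R * R * R) -> R} {p pb : R * (R * R * R) -> R}
  {dp dpb : 'I_3 -> R * (R * R * R) -> R}.
Context (hu : flow t1 t2 u du ut p dp (fun i q => nu * \sum_j ddu i j q))
  (hw : flow t1 t2 w dw wt pb dpb (fun _ _ => 0))
  (cddu : forall i j, continuous (ddu i j))
  (hddu : forall t i j, has_partial j (slice (du i j) t) (slice (ddu i j) t))
  (t12 : t1 <= t2).

Let st : Type := (R * (R * R * R))%type.
Implicit Types q : st.

Definition density q : R := 2^-1 * \sum_i (u i q - w i q) ^+ 2.

Definition flux j q : R :=
  u j q * density q + (p q - pb q) * (u j q - w j q)
  - nu * \sum_i (u i q - w i q) * du i j q.

Definition source q : R :=
  - (\sum_i \sum_j (u i q - w i q) * (u j q - w j q) * dw i j q)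
  - nu * \sum_i \sum_j (du i j q - dw i j q) * du i j q.

Let dflux j q : R :=
  u j q * (\sum_i (u i q - w i q) * (du i j q - dw i j q)) + du j j q * density q
  + ((p q - pb q) * (du j j q - dw j j q) + (dp j q - dpb j q) * (u j q - w j q))
  - nu * \sum_i ((u i q - w i q) * ddu i j q + (du i j q - dw i j q) * du i j q).

Let power q : R := \sum_i (u i q - w i q) * (ut i q - wt i q).

Let cu := flow_u hu. Let cw := flow_u hw.
Let cdu := flow_du hu. Let cdw := flow_du hw.
Let cut := flow_ut hu. Let cwt := flow_ut hw.
Let cdp := flow_dp hu. Let cdpb := flow_dp hw.
Let cp := flow_p hu. Let cpb := flow_p hw.

Lemma cont_density : continuous density.
Proof. rewrite /density; cont. Qed.

Lemma cont_flux j : continuous (flux j).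
Proof. have := cont_density; rewrite /flux => ?; cont. Qed.

Lemma cont_source : continuous source.
Proof. rewrite /source; cont. Qed.

Let cont_dflux j : continuous (dflux j).
Proof. have := cont_density; rewrite /dflux => ?; cont. Qed.

Let cont_power : continuous power.
Proof. rewrite /power; cont. Qed.

Let balance q : power q + \sum_j dflux j q = source q.
Proof.
exact: energy_identity (flow_momentum hu ^~ q) (flow_momentum hw ^~ q)
  (flow_div hu q) (flow_div hw q).
Qed.

Let flux_partial t j : has_partial j (slice (flux j) t) (slice (dflux j) t).
Proof.
have hv i : has_partial j (fun X => u i (t, X) - w i (t, X))
    (fun X => du i j (t, X) - dw i j (t, X)).
  by apply: has_partialB; [exact: (flow_partial hu) | exact: (flow_partial hw)].
apply: has_partialB; last first.
  apply: has_partialZ; apply: has_partial_sum => i.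
  by apply: has_partialM; [exact: hv | exact: hddu].
apply: has_partialD; last first.
  apply: has_partialM; last exact: hv.
  by apply: has_partialB; [exact: (flow_partial_p hu) | exact: (flow_partial_p hw)].
apply: has_partialM; first exact: (flow_partial hu).
apply: (has_partial_eq (g := fun X => 2^-1 * \sum_i
  ((u i (t, X) - w i (t, X)) * (du i j (t, X) - dw i j (t, X)) +
   (du i j (t, X) - dw i j (t, X)) * (u i (t, X) - w i (t, X))))).
  by apply: has_partialZ; apply: has_partial_sum => i; apply: has_partialM; exact: hv.
move=> X; rewrite mulr_sumr; by apply: eq_bigr => i _; field.
Qed.

Let density_time X t : t1 < t < t2 ->
  is_derive t 1 (fun s => density (s, X)) (power (t, X)).
Proof.
move=> ht.
have hv i : is_derive t 1 (fun s => u i (s, X) - w i (s, X)) (ut i (t, X) - wt i (t, X)).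
  apply: is_derive_add; first exact: (flow_time hu).
  by apply: is_derive_opp; exact: (flow_time hw).
have h : is_derive t 1 (fun s => \sum_i (u i (s, X) - w i (s, X)) ^+ 2)
    (2 * power (t, X)).
  rewrite /power mulr_sumr; elim: (index_enum _) => [|i s IH].
    under eq_fun do rewrite big_nil.
    by rewrite big_nil; exact: is_derive_cst.
  under eq_fun do rewrite big_cons.
  rewrite big_cons; apply: is_derive_add => //.
  apply: (is_derive_eq (is_derive_mul (hv i) (hv i))); ring.
by apply: (is_derive_eq (is_derive_scale 2^-1 h)); rewrite mulKf.
Qed.

Let per0 t y z : flux (inord 0) (t, (2 * pi, y, z)) = flux (inord 0) (t, (0, y, z)).
Proof.
have [hu1 hu2 [hu3 _]] := flow_periodic hu t y z.
have [hw1 _ [hw3 _]] := flow_periodic hw t y z.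
rewrite /flux /density (hu1 _).1 (hw1 _).1 hu3 hw3.
congr (_ * (_ * _) + _ - _ * _); apply: eq_bigr => i _.
  by rewrite (hu1 i).1 (hw1 i).1.
by rewrite (hu1 i).1 (hw1 i).1 (hu2 i _).1.
Qed.

Let per1 t x z : flux (inord 1) (t, (x, 2 * pi, z)) = flux (inord 1) (t, (x, 0, z)).
Proof.
have [hu1 hu2 [_ hu3]] := flow_periodic hu t x z.
have [hw1 _ [_ hw3]] := flow_periodic hw t x z.
rewrite /flux /density (hu1 _).2 (hw1 _).2 hu3 hw3.
congr (_ * (_ * _) + _ - _ * _); apply: eq_bigr => i _.
  by rewrite (hu1 i).2 (hw1 i).2.
by rewrite (hu1 i).2 (hw1 i).2 (hu2 i _).2.
Qed.

(** The energy of the box is never differentiated in time: time and space integrals are exchanged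
    and the fundamental theorem is applied in t at each fixed point. *)
Lemma energy_balance (Z : R) : 0 <= Z ->
  box_integral Z (slice density t2) - box_integral Z (slice density t1) +
  integral1 t1 t2 (fun t => square_integral
    (fun q : R * R => flux (inord 2) (t, (q, Z)) - flux (inord 2) (t, (q, 0)))) =
  integral1 t1 t2 (fun t => box_integral Z (slice source t)).
Proof.
move=> Z0.
have IB := @box_integral_on R Z; have IT := integral_on_integral1 t1 t2.
have cD := @cont_density; have cS := @cont_source; have cP := @cont_power; have cF := @cont_flux; have cdF := @cont_dflux.
have e1 t : box_integral Z (slice power t) + square_integral
    (fun q : R * R => flux (inord 2) (t, (q, Z)) - flux (inord 2) (t, (q, 0))) =
    box_integral Z (slice source t).
  rewrite -(divergence Z0 (F := fun j => slice (flux j) t) (G := fun j => slice (dflux j) t)).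
  - rewrite -(integral_onD IB).
    + congr (box_integral Z _); apply/funext => X; exact: balance.
    + by rewrite /slice; cont.
    + by rewrite /slice; cont.
  - by move=> j; rewrite /slice; cont.
  - by move=> j; rewrite /slice; cont.
  - exact: flux_partial.
  - by move=> y z; exact: per0.
  - by move=> x z; exact: per1.
have cbox f : continuous f -> continuous (fun t => box_integral Z (slice f t)).
  exact: (integral_on_continuous IB).
have e2 : box_integral Z (slice density t2) - box_integral Z (slice density t1) =
    integral1 t1 t2 (fun t => box_integral Z (slice power t)).
  rewrite (commuting_box t1 t2 Z cP) -(integral_onB IB); [|by rewrite /slice; cont..].
  apply: (integral_on_eq IB).
  - by rewrite /slice; cont.
  - apply: (integral_on_continuous IT (f := fun r : R * R * R * R => power (r.2, r.1))); cont.
  - move=> X _; apply/esym; apply: (@integral1_FTC _ _ _ (fun t => density (t, X))) => //.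
    + by cont.
    + by cont.
    + by move=> t ht; exact: density_time.
rewrite e2 -(integral_onD IT).
- by congr (integral1 _ _ _); apply/funext => t; exact: e1.
- exact: cbox.
- by apply: (integral_on_continuous (@square_integral_on R)
    (f := fun r : R * (R * R) => flux (inord 2) (r.1, (r.2, Z)) - flux (inord 2) (r.1, (r.2, 0)))); cont.
Qed.

End EnergyBalance.

(** * Estimates of the boundary fluxes and one step of the Gronwall argument *)

Section EnergyStep.
Context {R : realType} (t1 t2 nu : R).
Context {u w : 'I_3 -> R * (R * R * R) -> R} {du dw ddu : 'I_3 -> 'I_3 -> R * (R * R * R) -> R}
  {ut wt : 'I_3 -> R * (R * R * R) -> R} {p pb : R * (R * R * R) -> R}
  {dp dpb : 'I_3 -> R * (R * R * R) -> R}.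
Context (hu : flow t1 t2 u du ut p dp (fun i q => nu * \sum_j ddu i j q))
  (hw : flow t1 t2 w dw wt pb dpb (fun _ _ => 0))
  (cddu : forall i j, continuous (ddu i j))
  (hddu : forall t i j, has_partial j (slice (du i j) t) (slice (ddu i j) t))
  (t12 : t1 <= t2) (nu0 : 0 <= nu).

Let cu := flow_u hu. Let cw := flow_u hw.
Let cdu := flow_du hu. Let cdw := flow_du hw.
Let cdp := flow_dp hu. Let cdpb := flow_dp hw.
Let cp := flow_p hu. Let cpb := flow_p hw.

Let IT := integral_on_integral1 t1 t2.
Let IQ := @square_integral_on R.

Let vertical := inord 2 : 'I_3.

Lemma integral1_le_cst (f : R -> R) c : continuous f ->
  (forall t, t1 <= t <= t2 -> f t <= c) -> integral1 t1 t2 f <= (t2 - t1) * c.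
Proof.
move=> cf fc; rewrite mulrC -(integral1_cst t12) -(integral_on_cst IT).
by apply: (integral_on_le IT); [by []|cont|move=> t; rewrite /= in_itv/=; exact: fc].
Qed.

Let cont_square (f : R * (R * R) -> R) : continuous f ->
  continuous (fun t => square_integral (fun q => f (t, q))).
Proof. exact: (integral_on_continuous IQ). Qed.

Lemma growth_arith (x y J Z : R) : (x - y) ^+ 2 <= Z * J ->
  x ^+ 2 <= 2 * y ^+ 2 + 2 * Z * J.
Proof. by have := sqr_ge0 (x - 2 * y) => *; lra. Qed.

(** Only the gradient of the pressures is square integrable. The difference q at height Z is its
    value at 0 plus the integral of d_z q, and Cauchy-Schwarz bounds the square of that integral by
    Z times the integral of (d_z q)^2. The value at 0 contributes a finite constant by
    continuity. *)
Lemma pressure_growth (Cp : R) :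
  (forall t Z, t1 <= t <= t2 -> 0 <= Z ->
    box_integral Z (fun X => (dp vertical (t, X) - dpb vertical (t, X)) ^+ 2) <= Cp) ->
  exists2 C, 0 <= C & forall Z, 0 <= Z ->
    integral1 t1 t2 (fun t => square_integral (fun q => (p (t, (q, Z)) - pb (t, (q, Z))) ^+ 2))
    <= C * (1 + Z).
Proof.
move=> hCp.
have crz Z : continuous (fun r : R * (R * R) => (p (r.1, (r.2, Z)) - pb (r.1, (r.2, Z))) ^+ 2).
  by cont.
pose I0 := integral1 t1 t2 (fun t => square_integral (fun q => (p (t, (q, 0)) - pb (t, (q, 0))) ^+ 2)).
have cI Z := cont_square (crz Z).
have cI0 : continuous (fun t => square_integral (fun q => (p (t, (q, 0)) - pb (t, (q, 0))) ^+ 2)).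
  exact: cI 0.
have I00 : 0 <= I0.
  apply: (integral_on_ge0 IT); first exact: cI.
  move=> t _; apply: (integral_on_ge0 IQ); first by cont.
  by move=> q _; exact: sqr_ge0.
have Cp0 : 0 <= Cp.
  apply: (le_trans _ (hCp t1 0 _ (lexx 0))); last by rewrite lexx.
  apply: (integral_on_ge0 (@box_integral_on R 0)); first by cont.
  by move=> q _; exact: sqr_ge0.
have D0 : 0 <= (t2 - t1) * Cp by rewrite mulr_ge0// subr_ge0.
exists (2 * I0 + 2 * ((t2 - t1) * Cp)); first by rewrite addr_ge0// mulr_ge0.
move=> Z Z0.
have key t : t1 <= t <= t2 ->
    square_integral (fun q => (p (t, (q, Z)) - pb (t, (q, Z))) ^+ 2) <=
    2 * square_integral (fun q => (p (t, (q, 0)) - pb (t, (q, 0))) ^+ 2) + 2 * (Z * Cp).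
  move=> ht.
  pose g (X : R * R * R) := (dp vertical (t, X) - dpb vertical (t, X)) ^+ 2.
  have cg : continuous g by rewrite /g; cont.
  have cig : continuous (fun q => integral1 0 Z (fun z => g (q, z))).
    exact: (integral_on_continuous (integral_on_integral1 0 Z)).
  pose PZ q := (p (t, (q, Z)) - pb (t, (q, Z))) ^+ 2.
  pose P0 q := (p (t, (q, 0)) - pb (t, (q, 0))) ^+ 2.
  pose W q := integral1 0 Z (fun z => g (q, z)).
  have cPZ : continuous PZ by rewrite /PZ; cont.
  have cP0 : continuous P0 by rewrite /P0; cont.
  have eq_rhs : square_integral (fun q => 2 * P0 q + (2 * Z) * W q) =
      2 * square_integral P0 + 2 * Z * box_integral Z g.
    rewrite (@integral_onD _ _ _ _ IQ (fun q => 2 * P0 q) (fun q => 2 * Z * W q));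
      [|by cont|by cont].
    by rewrite (integral_onZ IQ 2 cP0) (integral_onZ IQ (2 * Z) cig).
  apply: (@le_trans _ _ (2 * square_integral P0 + 2 * Z * box_integral Z g)); last first.
    by rewrite mulrA lerD2l ler_wpM2l ?mulr_ge0// hCp.
  rewrite -eq_rhs; apply: (integral_on_le IQ cPZ); first by cont.
  move=> q _.
  have ftc : integral1 0 Z (fun z => dp vertical (t, (q, z)) - dpb vertical (t, (q, z))) =
      (p (t, (q, Z)) - pb (t, (q, Z))) - (p (t, (q, 0)) - pb (t, (q, 0))).
    apply: (@integral1_FTC _ _ _ (fun z => p (t, (q, z)) - pb (t, (q, z)))) => //; [by cont|by cont|].
    move=> z /andP[z0 _]; apply: is_derive_add; last apply: is_derive_opp.
      have := flow_partial_p hu t (j := vertical) (X := (q, z)).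
      by rewrite /coord /set_coord /vertical /= inordK//; apply.
    have := flow_partial_p hw t (j := vertical) (X := (q, z)).
    by rewrite /coord /set_coord /vertical /= inordK//; apply.
  have cs := integral1_cauchy_schwarz (f := fun z => dp vertical (t, (q, z)) - dpb vertical (t, (q, z))) Z0.
  move: cs; rewrite ftc => cs.
  have {}cs := cs ltac:(by cont).
  rewrite /PZ /P0 /W /g.
  set rZ := p (t, (q, Z)) - pb (t, (q, Z)) in cs *.
  set r0 := p (t, (q, 0)) - pb (t, (q, 0)) in cs *.
  exact: growth_arith cs.
apply: (@le_trans _ _ (integral1 t1 t2 (fun t => 2 * square_integral (fun q => (p (t, (q, 0)) - pb (t, (q, 0))) ^+ 2) + 2 * (Z * Cp)))).
  apply: (integral_on_le IT); [exact: cI| |].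
    by cont.
  by move=> t; rewrite /= in_itv/=; exact: key.
rewrite (integral_onD IT); [|by cont|by cont].
rewrite (integral_onZ IT)// -/I0 (integral_on_cst IT) integral1_cst//.
have := mulr_ge0 Z0 I00; have := mulr_ge0 Z0 D0; lra.
Qed.

(** The order of choices matters: first [eta], which makes the pressure part at most e / 2 at every
    height, then the height, which makes the rest, with its factor [eta^-1], at most e / 2. *)
Lemma small_flux (Bu Ca Cp e Z0 : R) : 0 <= Bu -> 0 < e -> 0 <= Z0 ->
  (forall i q, `|u i q| <= Bu) ->
  (forall t Z, t1 <= t <= t2 -> 0 <= Z ->
    box_integral Z (fun X => \sum_i (u i (t, X) - w i (t, X)) ^+ 2
                             + \sum_i du i vertical (t, X) ^+ 2) <= Ca) ->
  (forall t Z, t1 <= t <= t2 -> 0 <= Z ->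
    box_integral Z (fun X => (dp vertical (t, X) - dpb vertical (t, X)) ^+ 2) <= Cp) ->
  exists2 Z, Z0 <= Z & - integral1 t1 t2 (fun t => square_integral
    (fun q => flux nu (u := u) (w := w) (du := du) (p := p) (pb := pb) vertical (t, (q, Z)))) <= e.
Proof.
move=> Bu0 e0 Z00 uB hCa hCp.
have [C C0 hC] := pressure_growth hCp.
pose a (X : R * (R * R * R)) := \sum_i (u i X - w i X) ^+ 2 + \sum_i du i vertical X ^+ 2.
have ca : continuous a by rewrite /a; cont.
have cat (Z : R) : continuous (fun t : R => square_integral (fun q => a (t, (q, Z)))).
  by apply: (cont_square (f := fun r => a (r.1, (r.2, Z)))); cont.
have a0 q : 0 <= a q by rewrite addr_ge0// sumr_ge0// => i _; exact: sqr_ge0.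
pose A Z := integral1 t1 t2 (fun t => square_integral (fun q => a (t, (q, Z)))).
have cAt : continuous (fun r : R * R => square_integral (fun q => a (r.2, (q, r.1)))).
  by apply: (integral_on_continuous IQ (f := fun r : R * R * (R * R) => a (r.1.2, (r.2, r.1.1)))); cont.
have cA : continuous A by exact: (integral_on_continuous IT cAt).
have A0 Z : 0 <= A Z.
  apply: (integral_on_ge0 IT); first exact: cat.
  move=> t _; apply: (integral_on_ge0 IQ); [by cont|move=> q _; exact: a0].
(* Integrating the slices over z before t turns them into box integrals, bounded at each time by
   [Ca]. *)
have hA Z : 0 <= Z -> integral1 0 Z A <= (t2 - t1) * Ca.
  move=> hZ; rewrite /A (commuting_integral1 0 Z t1 t2 cAt).
  have -> : (fun t => integral1 0 Z (fun z => square_integral (fun q => a (t, (q, z))))) =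
      (fun t => box_integral Z (fun X => a (t, X))).
    apply/funext => t.
    by rewrite (commuting_square 0 Z (f := fun r => a (t, (r.2, r.1))))//; cont.
  apply: integral1_le_cst; first exact: (integral_on_continuous (@box_integral_on R Z)).
  by move=> t ht; exact: hCa.
(* Gives eta * C <= e / 2; C may be 0, hence C + 1. *)
pose eta := e / (2 * (C + 1)).
have eta0 : 0 < eta by rewrite divr_gt0// mulr_gt0// ltr_wpDl.
pose M := Bu + eta^-1 + nu.
have M0 : 0 < M by rewrite ltr_wpDr// ltr_wpDl// invr_gt0.
have [Z ZZ hZ] := good_height cA hA A0 (divr_gt0 e0 (mulr_gt0 (ltr0Sn R 1) M0)) Z00.
have Zpos : 0 <= Z by exact: le_trans ZZ.
have Z1 : 0 < 1 + Z by lra.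
exists Z => //.
pose F (r : R * (R * R)) := flux nu (u := u) (w := w) (du := du) (p := p) (pb := pb)
  vertical (r.1, (r.2, Z)).
have cF : continuous F.
  have cfl := cont_flux hu hw (j := vertical); rewrite /F; cont.
pose P (r : R * (R * R)) := (p (r.1, (r.2, Z)) - pb (r.1, (r.2, Z))) ^+ 2.
have cP : continuous P by rewrite /P; cont.
pose A1 (r : R * (R * R)) := a (r.1, (r.2, Z)).
have cA1 : continuous A1 by rewrite /A1; cont.
have IP := integral_on_prod IT IQ.
rewrite -[leLHS]/(- integral_prod (integral1 t1 t2) square_integral F) -(integral_onN IP cF).
apply: (@le_trans _ _ (integral_prod (integral1 t1 t2) square_integral
   (fun r => eta / (1 + Z) * P r + (1 + Z) * M * A1 r))).
  apply: (integral_on_le IP); [by cont|by cont|move=> r _].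
  have := flux_le (p (r.1, (r.2, Z)) - pb (r.1, (r.2, Z)))
    (fun i => u i (r.1, (r.2, Z)) - w i (r.1, (r.2, Z))) (fun i => du i vertical (r.1, (r.2, Z)))
    nu0 Bu0 eta0 Zpos (fun i => uB i (r.1, (r.2, Z))) vertical.
  by move=> h; apply: (le_trans h); rewrite /P /A1 /a /M; rewrite mulrA mulrA mulrAC.
rewrite (integral_onD IP); [|by cont|by cont].
rewrite (integral_onZ IP _ cP) (integral_onZ IP _ cA1).
have hP : integral_prod (integral1 t1 t2) square_integral P <= C * (1 + Z) by exact: hC.
have -> : integral_prod (integral1 t1 t2) square_integral A1 = A Z by [].
have s1 : eta / (1 + Z) * integral_prod (integral1 t1 t2) square_integral P <= e / 2.
  apply: (@le_trans _ _ (eta / (1 + Z) * (C * (1 + Z)))).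
    by apply: ler_wpM2l => //; rewrite divr_ge0// ltW.
  have -> : eta / (1 + Z) * (C * (1 + Z)) = eta * C by field; rewrite lt0r_neq0.
  rewrite /eta mulrAC ler_pdivrMr; last by rewrite mulr_gt0// ltr_wpDl.
  have := ltW e0; lra.
have s2 : (1 + Z) * M * A Z <= e / 2.
  rewrite mulrAC; apply: (le_trans (ler_wpM2r (ltW M0) hZ)).
  suff -> : e / (2 * M) * M = e / 2 by [].
  by field; rewrite lt0r_neq0.
by rewrite [leRHS]splitr; exact: lerD s1 s2.
Qed.


Lemma bottom_flux (B b : R) :
  (forall i t x y, u i (t, (x, y, 0)) = 0) -> (forall i q, `|w i q| <= B) ->
  (forall i t x y, t1 <= t <= t2 -> 0 <= x <= 2 * pi -> 0 <= y <= 2 * pi ->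
     `|du i vertical (t, (x, y, 0))| <= b) ->
  integral1 t1 t2 (fun t => square_integral
    (fun q => flux nu (u := u) (w := w) (du := du) (p := p) (pb := pb) vertical (t, (q, 0))))
    <= (t2 - t1) * (nu * (3 * (B * b)) * (2 * pi) ^+ 2).
Proof.
move=> u0 wB dub.
have cfl := cont_flux hu hw (j := vertical).
apply: integral1_le_cst.
  apply: (cont_square (f := fun r => flux nu (u := u) (w := w) (du := du) (p := p) (pb := pb)
    vertical (r.1, (r.2, 0)))); cont.
move=> t ht.
have sq1 : square_integral (fun=> 1) = (2 * pi) ^+ 2 :> R.
  have c1 : continuous (fun _ : R => 1 : R) by cont.
  have := square_integralM c1 c1; rewrite mulr1 integral1_cst ?mulr_ge0 ?pi_ge0// subr0 -expr2.
  exact.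
rewrite -sq1 -(integral_on_cst IQ); apply: (integral_on_le IQ); [by cont|by cont|].
move=> [x y] []; rewrite /= !in_itv/= => hx hy.
rewrite /flux (u0 vertical) mul0r add0r (flow_bottom hw) subrr mulr0 add0r.
rewrite -mulrN; apply: ler_wpM2l => //; rewrite -sumrN.
apply: (@le_trans _ _ (\sum_(i < 3) B * b)).
  apply: ler_sum => i _; rewrite u0 sub0r mulNr opprK.
  apply: (le_trans (ler_norm _)); rewrite normrM.
  by apply: ler_pM => //; exact: dub.
by rewrite sumr_const card_ord mulr_natl.
Qed.

Lemma step_arith (F1 F0 SS x1 x2 e1 e s d f : R) :
  - F1 <= e -> SS <= s + (t2 - t1) * d -> F0 <= (t2 - t1) * f -> x1 <= e1 ->
  2^-1 * x2 - 2^-1 * x1 + (F1 - F0) = SS ->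
  x2 <= e1 + 2 * e + 2 * s + 2 * (t2 - t1) * (d + f).
Proof. by move=> *; lra. Qed.

(* For K = 12 B + 1 the a priori bound N e^(K t) of the energy is improved to
   (N / 2) e^(K t) plus the data. *)
Lemma energy_step (B b Bu Ca Cp D E1 N K e Z0 : R) :
  0 <= B -> 0 <= Bu -> 0 < e -> 0 <= Z0 -> 0 <= N -> 6 * B < K ->
  (forall i q, `|u i q| <= Bu) -> (forall i q, `|w i q| <= B) ->
  (forall i j q, `|dw i j q| <= B) ->
  (forall i t x y, u i (t, (x, y, 0)) = 0) ->
  (forall i t x y, t1 <= t <= t2 -> 0 <= x <= 2 * pi -> 0 <= y <= 2 * pi ->
     `|du i vertical (t, (x, y, 0))| <= b) ->
  (forall t Z, t1 <= t <= t2 -> 0 <= Z ->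
    box_integral Z (fun X => \sum_i (u i (t, X) - w i (t, X)) ^+ 2
                             + \sum_i du i vertical (t, X) ^+ 2) <= Ca) ->
  (forall t Z, t1 <= t <= t2 -> 0 <= Z ->
    box_integral Z (fun X => (dp vertical (t, X) - dpb vertical (t, X)) ^+ 2) <= Cp) ->
  (forall t Z, t1 <= t <= t2 -> 0 <= Z ->
    box_integral Z (fun X => \sum_i \sum_j dw i j (t, X) ^+ 2) <= D) ->
  (forall Z, 0 <= Z -> box_integral Z (fun X => \sum_i (u i (t1, X) - w i (t1, X)) ^+ 2) <= E1) ->
  (forall t Z, t1 <= t <= t2 -> 0 <= Z ->
    box_integral Z (fun X => \sum_i (u i (t, X) - w i (t, X)) ^+ 2) <= N * expR (K * t)) ->
  exists2 Z, Z0 <= Z &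
    box_integral Z (fun X => \sum_i (u i (t2, X) - w i (t2, X)) ^+ 2) <=
    E1 + 2 * e + N * expR (K * t2) * (6 * B / K)
    + 2 * (t2 - t1) * (nu * D + nu * (3 * (B * b)) * (2 * pi) ^+ 2).
Proof.
move=> B0 Bu0 e0 Z00 N0 BK uB wB dwB u0 dub hCa hCp hD hE1 hN.
have [Z ZZ hZ] := small_flux Bu0 e0 Z00 uB hCa hCp.
have Zpos : 0 <= Z by exact: le_trans ZZ.
exists Z => //.
have IB := @box_integral_on R Z.
have K0 : 0 < K by apply: le_lt_trans BK; rewrite mulr_ge0.
have := energy_balance hu hw cddu hddu t12 Zpos.
have cfl := cont_flux hu hw (j := vertical).
have cD := cont_density hu hw.
have cS := cont_source hu hw (nu := nu).
pose FZ t (z : R) := square_integral (fun q => flux nu (u := u) (w := w) (du := du)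
  (p := p) (pb := pb) vertical (t, (q, z))).
have cFZ z : continuous (FZ ^~ z).
  by apply: (cont_square (f := fun r => flux nu (u := u) (w := w) (du := du) (p := p) (pb := pb)
    vertical (r.1, (r.2, z)))); cont.
have -> : (fun t => square_integral (fun q => flux nu (u := u) (w := w) (du := du)
    (p := p) (pb := pb) vertical (t, (q, Z)) - flux nu (u := u) (w := w) (du := du)
    (p := p) (pb := pb) vertical (t, (q, 0)))) = (fun t => FZ t Z - FZ t 0).
  by apply/funext => t; rewrite (integral_onB IQ)//; cont.
rewrite (integral_onB IT (cFZ Z) (cFZ 0)).
have hb := bottom_flux u0 wB dub.
pose V t X := \sum_i (u i (t, X) - w i (t, X)) ^+ 2.
have cV t : continuous (V t) by rewrite /V; cont.
have dens t : box_integral Z (slice (density (u := u) (w := w)) t) = 2^-1 * box_integral Z (V t).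
  by rewrite -(integral_onZ IB).
rewrite !dens.
(* The a priori bound replaces 3 B |v|^2 by a pure exponential, whose integral gains 1 / K. The
   factor 1/2 in [density] later turns 3 B / K into 6 B / K. *)
have src : integral1 t1 t2 (fun t => box_integral Z (slice (source nu (u := u) (w := w)
    (du := du) (dw := dw)) t)) <=
    3 * B * N * (expR (K * t2) / K) + (t2 - t1) * (nu * D).
  have cE : continuous (fun s => expR (K * s)).
    by apply: (cont_comp (@continuous_expR R)); cont.
  apply: (@le_trans _ _ (integral1 t1 t2 (fun t => 3 * B * N * expR (K * t) + nu * D))).
    apply: (integral_on_le IT); [exact: (integral_on_continuous IB cS)|by cont|].
    move=> t; rewrite /= in_itv/= => ht.
    have cdw2 : continuous (fun X => \sum_i \sum_j dw i j (t, X) ^+ 2) by cont.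
    apply: (@le_trans _ _ (box_integral Z (fun X => 3 * B * V t X +
        nu * \sum_i \sum_j dw i j (t, X) ^+ 2))).
      apply: (integral_on_le IB); [by rewrite /slice; cont|by cont|].
      by move=> X _; exact: source_le.
    rewrite (@integral_onD _ _ _ _ IB (fun X => 3 * B * V t X)
      (fun X => nu * \sum_i \sum_j dw i j (t, X) ^+ 2)); [|by cont|by cont].
    rewrite (integral_onZ IB (3 * B) (cV t)) (integral_onZ IB nu cdw2).
    apply: lerD; last by rewrite ler_wpM2l// hD.
    by rewrite -[leRHS]mulrA ler_wpM2l ?mulr_ge0// hN.
  have c1 : continuous (fun t => 3 * B * N * expR (K * t)) by cont.
  have c2 : continuous (fun _ : R => nu * D) by cont.
  rewrite (integral_onD IT c1 c2) (integral_onZ IT _ cE) (integral_on_cst IT) integral1_cst//.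
  rewrite [nu * D * _]mulrC lerD2r ler_wpM2l ?mulr_ge0//.
  exact: integral_exp.
have -> : N * expR (K * t2) * (6 * B / K) = 2 * (3 * B * N * (expR (K * t2) / K)).
  by field; rewrite lt0r_neq0.
exact: step_arith hZ src hb (hE1 _ Zpos).
Qed.

End EnergyStep.

(** * Classical solutions as flows *)

Section Lift.
Context {R : realType}.

Lemma near_eq_fmap {T U : Type} (F : set_system T) (f g : T -> U) : Filter F ->
  (\forall x \near F, f x = g x) -> f @ F = g @ F.
Proof.
move=> FF fg; apply/seteqP; split => A; apply: filterS2 fg => x /= e; by rewrite e.
Qed.

(** If the line through x in the direction v stays in D near x, the derivative relative to D is an
    ordinary two-sided one. [phi] is f along this line, with [s0] the parameter of x. *)
Lemma is_derive_in {V : normedModType R} (D : set V) (v : V) (f : V -> R) (x : V)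
    (phi : R -> R) (s0 : R) :
  derivable_in D v f x ->
  (\forall h \near (0 : R), D (x + h *: v) /\ phi (h + s0) = f (x + h *: v)) ->
  is_derive s0 1 phi (derive_in D v f x).
Proof.
move=> dvg nr.
have phi0 : phi s0 = f x.
  by have [_] := nbhs_singleton nr; rewrite add0r scale0r addr0.
have cv : h^-1 *: ((phi \o shift s0) (h *: 1) - phi s0) @[h --> 0^'] --> derive_in D v f x.
  have h1 : \forall h \near (0:R)^', h^-1 * (f (x + h *: v) - f x) =
      h^-1 *: ((phi \o shift s0) (h *: 1) - phi s0).
    apply: (nbhs_dnbhs); apply: filterS nr => h [_ e].
    by rewrite /= phi0 -e /GRing.scale/= mulr1.
  rewrite -(near_eq_fmap _ h1) => A /dvg; rewrite /= /within /=.
  have h2 : \forall h \near (0:R)^', D (x + h *: v).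
    by apply: nbhs_dnbhs; apply: filterS nr => h [].
  by apply: filterS2 h2 => h Dh; apply.
split; first by apply/cvg_ex; exists (derive_in D v f x).
exact: (cvg_lim _ cv).
Qed.

Definition clip (a b t : R) : R := Num.max a (Num.min t b).

Definition reflect_up (X : R * R * R) : R * R * R := (X.1, Num.max 0 X.2).

(* Constant extension to all times and to z < 0: joint continuity becomes global,
   and one-sided derivatives become two-sided, except d_z at z = 0 and d_t at the
   end points. *)
Definition lift (a b : R) (g : R -> scalar_field R) (q : R * (R * R * R)) : R :=
  g (clip a b q.1) (reflect_up q.2).

Lemma clip_itv a b t : a <= b -> a <= clip a b t <= b.
Proof. by move=> ab; rewrite /clip le_max lexx ge_max ab ge_min lexx orbT. Qed.

Lemma clip_id a b t : a <= t <= b -> clip a b t = t.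
Proof. by move=> /andP[ta tb]; rewrite /clip (min_idPl tb) (max_idPr ta). Qed.

Lemma half_space_reflect X : half_space (reflect_up X).
Proof. by rewrite /half_space /= le_max lexx. Qed.

Lemma cont_max {T : topologicalType} (f g : T -> R) :
  continuous f -> continuous g -> continuous (fun x => Num.max (f x) (g x)).
Proof. by move=> cf cg x; apply: continuous_max; [exact: cf | exact: cg]. Qed.

Lemma cont_min {T : topologicalType} (f g : T -> R) :
  continuous f -> continuous g -> continuous (fun x => Num.min (f x) (g x)).
Proof. by move=> cf cg x; apply: continuous_min; [exact: cf | exact: cg]. Qed.

Lemma cont_within {T U W : topologicalType} (A : set U) (f : U -> W) (k : T -> U) :
  {within A, continuous f} -> continuous k -> (forall x, A (k x)) ->
  continuous (fun x => f (k x)).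
Proof.
move=> /subspace_continuousP cf ck Ak x B fB.
have h : nbhs x (fun y => A (k y) -> B (f (k y))) := ck x _ (cf _ (Ak x) _ fB).
by apply: filterS h => y; apply; exact: Ak.
Qed.

Lemma cont_clip a b : continuous (clip a b).
Proof. by apply: cont_max; [cont | apply: cont_min; cont]. Qed.

Lemma cont_reflect : continuous reflect_up.
Proof. by apply: cont_pair; [cont | apply: cont_max; cont]. Qed.

Lemma add_basis (X : R * R * R) h (j : 'I_3) :
  X + h *: Defs.basis j = set_coord j X (h + coord j X).
Proof.
case: X => [[x y] z]; case: j => [[|[|[|k]]] kj] //=;
  rewrite /Defs.basis /set_coord /coord /=; congr (_, _, _);
  by rewrite /= /GRing.scale/= ?mulr1 ?mulr0 ?addr0// addrC.
Qed.

Section OnInterval.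
Context (J : set R) (a b : R) (ab : a <= b) (abJ : forall t, a <= t <= b -> J t).

Let clipJ t : J (clip a b t). Proof. by apply: abJ; exact: clip_itv. Qed.

Lemma cont_lift g : continuous_st J g -> continuous (lift a b g).
Proof.
move=> cg; apply: (cont_within (k := fun q => (clip a b q.1, reflect_up q.2)) cg).
  have := @cont_clip a b; have := cont_reflect => h1 h2; cont.
by move=> q; split; [exact: clipJ | exact: half_space_reflect].
Qed.

Lemma lift_partial g (j : 'I_3) t :
  (forall t X, J t -> half_space X -> derivable_in half_space (Defs.basis j) (g t) X) ->
  has_partial j (slice (lift a b g) t) (slice (lift a b (fun t => partial j (g t))) t).
Proof.
move=> dg X jX; apply: is_derive_in.
  by apply: dg; [exact: clipJ | exact: half_space_reflect].
(* A vertical line stays in the half-space only near points with z > 0; horizontal lines always stay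
   in it, and moving along them commutes with [reflect_up]. *)
have [jv|jv] := eqVneq (val j) 2%N.
  have X0 := jX jv.
  have rX : reflect_up X = X by rewrite /reflect_up (max_idPr (ltW X0)); case: (X).
  have near0 : \forall h \near (0 : R), - h < X.2 by apply: Nlt_nbhsl; rewrite oppr0.
  apply: filterS near0 => h hX.
  have hX0 : 0 <= h + X.2 by rewrite -lerBlDl sub0r ltW.
  rewrite rX add_basis /slice /lift/= /half_space /set_coord /coord jv /=.
  by rewrite /reflect_up/= (max_idPr hX0).
apply: filterS filterT => h _; rewrite add_basis /slice /lift/=.
have -> : reflect_up (set_coord j X (h + coord j X)) =
    set_coord j (reflect_up X) (h + coord j (reflect_up X)).
  by rewrite /set_coord /coord; case: j {dg jX} jv => [[|[|[|k]]] kj].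
split => //; move: jv; rewrite /half_space /set_coord /coord.
by case: j {dg jX} => [[|[|[|k]]] kj]//= _; rewrite le_max lexx.
Qed.

Lemma lift_time T g t X : 0 <= a -> b <= T -> a < t < b ->
  (forall t X, J t -> half_space X ->
     derivable_in (`[0, T] : set R) (1 : R) (fun s => g s X) t) ->
  is_derive t 1 (fun s => lift a b g (s, X)) (lift a b (time_derive T g) (t, X)).
Proof.
move=> a0 bT /andP[at_ tb] dg.
rewrite /lift/= (clip_id (t := t)) ?(ltW at_) ?(ltW tb)//.
apply: is_derive_in; first by apply: dg; [apply: abJ; rewrite !ltW | exact: half_space_reflect].
have n1 : \forall h \near (0 : R), - h < t - a by apply: Nlt_nbhsl; rewrite oppr0 subr_gt0.
have n2 : \forall h \near (0 : R), h < b - t by apply: lt_nbhsl; rewrite subr_gt0.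
apply: filterS2 n1 n2 => h h1 h2; rewrite /= in_itv/= [h *: 1]mulr1.
split; first by apply/andP; split; lra.
by rewrite clip_id [h + t]addrC//; apply/andP; split; lra.
Qed.

End OnInterval.

Lemma quotient_in_eq {V : normedModType R} (D : set V) (v x x' : V) (f : V -> R) :
  (forall h, D (x' + h *: v) <-> D (x + h *: v)) -> f x' = f x ->
  (forall h, D (x + h *: v) -> f (x' + h *: v) = f (x + h *: v)) ->
  quotient_in D v f x' = quotient_in D v f x.
Proof.
move=> DD fx ff; rewrite /quotient_in.
have -> : [set h | D (x' + h *: v)] = [set h | D (x + h *: v)].
  by apply/funext => h; apply/propext; exact: DD.
apply: near_eq_fmap.
have w : \forall h \near 0^', D (x + h *: v) ->
    h^-1 * (f (x' + h *: v) - f x') = h^-1 * (f (x + h *: v) - f x).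
  by apply: nearW => h hD; rewrite fx ff.
exact: w.
Qed.

Lemma partial_periodic (f : scalar_field R) j : periodic_h f -> periodic_h (partial j f).
Proof.
move=> pf x y z z0; split; rewrite /partial /derive_in;
  congr (lim _); apply: quotient_in_eq => [h||h]; rewrite ?add_basis /half_space /set_coord /coord/=;
  case: j => [[|[|[|k]]] kj] //=; try exact: (pf _ _ _ _).1; try exact: (pf _ _ _ _).2.
all: by move=> hz; rewrite ?addrA; (exact: (proj1 (pf _ _ _ hz)) || exact: (proj2 (pf _ _ _ hz))).
Qed.

(** Stated with what both systems provide: one continuous space derivative, and normal velocity 0 at
    the wall. For nu = 0 the right-hand side is 0 whatever value the second derivatives have. *)
Lemma solution_flow (T : R) (J : set R) (nu t1 t2 : R) (u : R -> vector_field R)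
    (p : R -> scalar_field R) :
  0 <= t1 -> t1 <= t2 -> t2 <= T -> (forall t, t1 <= t <= t2 -> J t) ->
  periodic_flow T u p ->
  (forall i, space_class J 1 (fun t => u t i)) ->
  (forall i, time_class T J (fun t => u t i)) -> space_class J 1 p ->
  momentum T J nu u p -> divergence_free J u ->
  (forall t x y, 0 <= t <= T -> u t (inord 2) (x, y, 0) = 0) ->
  flow t1 t2 (fun i => lift t1 t2 (fun t => u t i))
    (fun i j => lift t1 t2 (fun t => partial j (u t i)))
    (fun i => lift t1 t2 (time_derive T (fun t => u t i)))
    (lift t1 t2 p) (fun j => lift t1 t2 (fun t => partial j (p t)))
    (fun i q => nu * \sum_j lift t1 t2 (fun t => partial j (partial j (u t i))) q).
Proof.
move=> t10 t12 t2T tJ per su tu sp mom div bot.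
have cJ t : J (clip t1 t2 t) by apply: tJ; exact: clip_itv.
have cT t : 0 <= clip t1 t2 t <= T.
  by have /andP[h1 h2] := clip_itv t t12; rewrite (le_trans t10 h1) (le_trans h2 t2T).
split.
- by move=> i; apply: (cont_lift t12 tJ); have [] := su i.
- by move=> i j; apply: (cont_lift t12 tJ); have [_ /(_ j)[_ []]] := su i.
- by move=> i; apply: (cont_lift t12 tJ); have [] := tu i.
- by apply: (cont_lift t12 tJ); have [] := sp.
- by move=> j; apply: (cont_lift t12 tJ); have [_ /(_ j)[_ []]] := sp.
- by move=> t i j; apply: (lift_partial t12 tJ); have [_ /(_ j)[]] := su i.
- by move=> t j; apply: (lift_partial t12 tJ); have [_ /(_ j)[]] := sp.
- by move=> t X i ht; apply: (lift_time tJ) => //; have [] := tu i.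
- by move=> [t X]; apply: div; [exact: cJ | exact: half_space_reflect].
- move=> i [t X]; have := mom _ _ i (cJ t) (half_space_reflect X).
  rewrite /lift/=; set s1 := \sum_(j < 3) partial j (partial j _) _.
  by move/eqP; rewrite -addrA addrAC subr_eq add0r => /eqP <-; rewrite -!addrA.
- move=> t y z; have [pu pp] := per _ (cT t).
  have z0 : 0 <= Num.max 0 z by rewrite le_max lexx.
  have per2 (f : scalar_field R) : periodic_h f ->
      f (2 * pi, y, Num.max 0 z) = f (0, y, Num.max 0 z) /\
      f (y, 2 * pi, Num.max 0 z) = f (y, 0, Num.max 0 z).
    move=> pf; split.
      by have := proj1 (pf 0 y _ z0); rewrite add0r.
    by have := proj2 (pf y 0 _ z0); rewrite add0r.
  split=> [i|i j|]; rewrite /lift /reflect_up/=.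
  + exact: (per2 (u (clip t1 t2 t) i) (pu i)).
  + exact: (per2 (partial j (u (clip t1 t2 t) i)) (partial_periodic j (pu i))).
  + exact: (per2 (p (clip t1 t2 t)) pp).
- by move=> t x y; rewrite /lift /reflect_up/= maxxx bot.
Qed.

End Lift.

(** * The vorticity at the wall *)

Section BoundaryBound.
Context {R : realType}.
Local Open Scope complex_scope.

Lemma sum_le_esum (f : int * int -> R) (F : int * int -> \bar R) (A : R) :
  (\esum_(xi in [set: int * int]) F xi <= A%:E)%E ->
  (forall xi, ((f xi)%:E <= F xi)%E) ->
  forall s : seq (int * int), uniq s -> \sum_(xi <- s) f xi <= A.
Proof.
move=> FA fF s us; rewrite -lee_fin; apply: le_trans FA; apply: esum_ge.
exists [set` s]; first by split; [exact: finite_seq | exact: subsetT].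
rewrite -fsbig_seq//.
elim: s {us} => [|xi s IH]; first by rewrite !big_nil.
by rewrite !big_cons EFinD; apply: leeD.
Qed.

Lemma esum_nonneg (I : choiceType) (F : I -> \bar R) : (0 <= \esum_(i in [set: I]) F i)%E.
Proof.
apply: esum_ge; exists set0; first by split; [exact: finite_set0 | exact: sub0set].
by rewrite fsbig_set0.
Qed.

Lemma normc_ge0 (z : R[i]) : 0 <= Normc.normc z.
Proof. by case: z => x y; exact: sqrtr_ge0. Qed.

Lemma phase_le_sqrt (c s phi : R) : cos phi * c + sin phi * s <= Num.sqrt (c ^+ 2 + s ^+ 2).
Proof.
apply: (le_trans (ler_norm _)); rewrite -sqrtr_sqr; apply: ler_wsqrtr.
have := sqr_ge0 (cos phi * s - sin phi * c); have := cos2Dsin2 phi => e.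
have -> : c ^+ 2 + s ^+ 2 = (cos phi ^+ 2 + sin phi ^+ 2) * (c ^+ 2 + s ^+ 2) by rewrite e mul1r.
lra.
Qed.

(** Expanding the cosine gives the scalar product of the unit vector (cos phi, sin phi) with the
    cosine and sine integrals, which are (2 pi)^2 times the real part and minus the imaginary part
    of the coefficient. *)
Lemma fourier_mode_le (f : scalar_field R) xi phi :
  continuous (fun q : R * R => f (q.1, q.2, 0)) ->
  square_integral (fun q => f (q.1, q.2, 0) *
    cos (xi.1%:~R * q.1 + xi.2%:~R * q.2 - phi)) <=
  (2 * pi) ^+ 2 * Normc.normc (fourier f xi 0).
Proof.
move=> cf; have IQ := @square_integral_on R.
pose th (q : R * R) : R := xi.1%:~R * q.1 + xi.2%:~R * q.2.
have cth : continuous th by rewrite /th; cont.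
pose c q := f (q.1, q.2, 0) * cos (th q); pose s q := f (q.1, q.2, 0) * sin (th q).
have cc : continuous c by apply: contM => //; apply: (cont_comp (@continuous_cos R)).
have cs : continuous s by apply: contM => //; apply: (cont_comp (@continuous_sin R)).
have -> : square_integral (fun q => f (q.1, q.2, 0) * cos (th q - phi)) =
    cos phi * square_integral c + sin phi * square_integral s.
  rewrite -(integral_onZ IQ _ cc) -(integral_onZ IQ _ cs).
  rewrite -(integral_onD IQ); [|by cont|by cont].
  congr square_integral; apply/funext => q; rewrite /c /s cosB; ring.
rewrite /fourier (integral_rectE _ _ _ _ cc) (integral_rectE _ _ _ _ cs).
rewrite -/(square_integral c) -/(square_integral s) /= sqrrN.
have P0 : 0 < (2 * pi) ^+ 2 :> R by rewrite exprn_gt0// mulr_gt0// pi_gt0.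
move: (square_integral c) (square_integral s) => C S.
set P := (2 * pi) ^+ 2 in P0 *.
have -> : cos phi * C + sin phi * S = P * (cos phi * (P^-1 * C) + sin phi * (P^-1 * S)).
  by field; rewrite lt0r_neq0.
by rewrite ler_pM2l//; exact: phase_le_sqrt.
Qed.

Lemma toward_center (x s : R) : 0 <= x <= 2 * pi -> 0 < s -> s < 1 ->
  0 < x + s * (pi - x) < 2 * pi.
Proof.
move=> /andP[x0 x1] s0 s1; have spi := mulr_gt0 s0 (pi_gt0 R).
have h1 : 0 <= (1 - s) * x by rewrite mulr_ge0// subr_ge0 ltW.
have h2 : 0 <= (1 - s) * (2 * pi - x) by rewrite mulr_ge0 ?subr_ge0// ltW.
by apply/andP; split; lra.
Qed.

(** Moving from a point of the closed square towards the centre (pi, pi) enters the open square at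
    once; continuity does the rest. *)
Lemma closed_square_le (h : R * R -> R) (A : R) : continuous h ->
  (forall x y, 0 < x < 2 * pi -> 0 < y < 2 * pi -> h (x, y) <= A) ->
  forall x y, 0 <= x <= 2 * pi -> 0 <= y <= 2 * pi -> h (x, y) <= A.
Proof.
move=> ch hA x y hx hy; rewrite leNgt; apply/negP => Ah.
pose k s := h (x + s * (pi - x), y + s * (pi - y)).
have ck : continuous k by rewrite /k; cont.
have k0 : k 0 = h (x, y) by rewrite /k !mul0r !addr0.
have Ak : A < k 0 by rewrite k0.
have /nbhs_ballP[e e0 he] : \forall s \near (0 : R), A < k s.
  exact: cvgr_gt (ck 0) _ Ak.
rewrite /= in e0.
pose s := Num.min (e / 2) 2^-1.
have s0 : 0 < s by rewrite lt_min divr_gt0//= invr_gt0.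
have s1 : s < 1 by rewrite gt_min orbC; apply/orP; left; lra.
have := he s; rewrite /ball/= sub0r normrN gtr0_norm// => /(_ _).
suff se : s < e.
  move=> /(_ se); apply/negP; rewrite -leNgt; apply: hA; exact: toward_center.
by rewrite gt_min; apply/orP; left; lra.
Qed.

Lemma boundary_sup (f : scalar_field R) (A : R) :
  continuous (fun q : R * R => f (q.1, q.2, 0)) ->
  (forall s : seq (int * int), uniq s ->
     \sum_(xi <- s) Normc.normc (fourier f xi 0) <= A) ->
  forall x y, 0 <= x <= 2 * pi -> 0 <= y <= 2 * pi -> `|f (x, y, 0)| <= A.
Proof.
move=> cf hA x y hx hy.
have sup1 : f (x, y, 0) <= A.
  apply: (closed_square_le (h := fun q => f (q.1, q.2, 0))) => // x' y' hx' hy'.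
  apply: (fourier_sup_le (h := fun q => f (q.1, q.2, 0))
    (c := fun xi => Normc.normc (fourier f xi 0))) => // xi phi.
  exact: fourier_mode_le.
have sup2 : - f (x, y, 0) <= A.
  apply: (closed_square_le (h := fun q => - f (q.1, q.2, 0))) => //; first by cont.
  move=> x' y' hx' hy'.
  apply: (fourier_sup_le (h := fun q => - f (q.1, q.2, 0))
    (c := fun xi => Normc.normc (fourier f xi 0))) => //; first by cont.
  (* The sign of - f is absorbed by shifting the phase by pi, so the same coefficients serve for the
     lower bound. *)
  move=> xi phi; apply: le_trans (fourier_mode_le xi (phi + pi) cf).
  rewrite le_eqVlt; apply/orP; left; apply/eqP; congr square_integral; apply/funext => q /=.
  have -> : xi.1%:~R * q.1 + xi.2%:~R * q.2 - phi = xi.1%:~R * q.1 + xi.2%:~R * q.2 - (phi + pi) + pi by ring.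
  rewrite cosDpi; ring.
by rewrite ler_norml lerNl sup2.
Qed.

(** The supremum over [Omega mu] is tested at its corner z = 0. There every admissible extension
    takes the value of the Fourier coefficient, the weight is sqrt nu and the exponential is at
    least 1. *)
Lemma mode_norm_ge (nu eps0 mu : R) xi (alpha : 'I_3 -> nat) n (f : 'I_n -> scalar_field R) i :
  0 <= eps0 -> 0 < mu -> alpha (inord 0) = 0%N -> alpha (inord 1) = 0%N ->
  alpha (inord 2) = 0%N ->
  ((Num.sqrt nu * Normc.normc (fourier (f i) xi 0))%:E <=
   mode_norm (fun G => ereal_sup [set
     (weight nu (complex.Re z) * exp_weight eps0 mu xi z *
      modulus (fun i => symbol_h xi alpha * G i z))%:E | z in Omega mu])
     mu (alpha (inord 2)) (fun i => fourier (f i) xi))%E.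
Proof.
move=> e0 mu0 a0 a1 a2; apply: le_ereal_inf_tmp => _ [G hG <-].
apply: ereal_sup_ge.
exists ((weight nu (complex.Re (0 : R[i])) * exp_weight eps0 mu xi 0 *
      modulus (fun i => symbol_h xi alpha * G i 0))%:E).
  exists (0 : R[i]) => //; left; rewrite /= lexx ler01 normr0 mulr0; split => //.
have -> : weight nu (complex.Re (0 : R[i])) = Num.sqrt nu.
  by rewrite /weight /= lexx ler01 (max_idPl (sqrtr_ge0 _)).
rewrite lee_fin -mulrA ler_wpM2l ?sqrtr_ge0//.
have -> : symbol_h xi alpha = 1 :> R[i] by rewrite /symbol_h a0 a1 !expr0 mulr1.
have Gi : G i 0 = fourier (f i) xi 0.
  have := hG i; rewrite a2 /= => -[_ /(_ 0)]; apply.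
  by rewrite lexx addr_ge0// ltW.
have m1 : Normc.normc (fourier (f i) xi 0) <= modulus (fun i => 1 * G i 0).
  move: (fourier _ _ _) Gi => z0 Gi; rewrite /modulus (bigD1 i) //= mul1r Gi.
  rewrite -[leLHS]ger0_norm ?normc_ge0 // -sqrtr_sqr; apply: ler_wsqrtr.
  by rewrite lerDl; apply: sumr_ge0 => j _; exact: sqr_ge0.
have w1 : 1 <= exp_weight eps0 mu xi 0.
  rewrite -expR0 ler_expR; apply: mulr_ge0; last exact: sqrtr_ge0.
  by rewrite mulr_ge0// le_max lexx.
by rewrite -[leLHS]mul1r; apply: ler_pM => //; exact: normc_ge0.
Qed.

Lemma X_norm_ge0 nu eps0 mu alpha (v : vector_field R) : (0 <= X_norm nu eps0 mu alpha v)%E.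
Proof. by rewrite /X_norm adde_ge0// esum_nonneg. Qed.

Lemma vorticity_boundary (nu eps0 a mu0 gamma t M : R) (v : vector_field R) (i : 'I_2) :
  0 < nu -> 0 <= eps0 -> gamma * t < mu0 ->
  (triple_norm nu eps0 a mu0 gamma t v <= M%:E)%E ->
  continuous (fun q : R * R => v (inord i) (q.1, q.2, 0)) ->
  forall x y, 0 <= x <= 2 * pi -> 0 <= y <= 2 * pi ->
    `|v (inord i) (x, y, 0)| <= M / Num.sqrt nu.
Proof.
move=> nu0 e0 tmu hM cv.
(* An arbitrary admissible radius: the value at z = 0 does not depend on it. All terms of the triple
   norm are nonnegative, so the one with [alpha = 0] in the X norm can be isolated. *)
pose mu := (mu0 - gamma * t) / 2.
have mu_pos : 0 < mu by rewrite divr_gt0// subr_gt0.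
have muI : mu \in `]0, mu0 - gamma * t[.
  by rewrite in_itv/= mu_pos /mu ltr_pdivrMr// mulr_natr mulr2n ltrDl subr_gt0.
have Y0 : (0 <= Yt_norm eps0 a mu0 gamma t v)%E.
  apply: ereal_sup_ge; eexists; first by exists mu => //.
  by rewrite adde_ge0// sume_ge0// => al _; rewrite ?mule_ge0 ?esum_nonneg// lee_fin powR_ge0.
have Z0 : (0 <= Z_norm v)%E by apply: sume_ge0 => al _; exact: poweR_ge0.
have hX : (Xt_norm nu eps0 a mu0 gamma t v <= M%:E)%E.
  by apply: le_trans hM; rewrite /triple_norm -addeA leeDl// adde_ge0.
pose al0 : {ffun 'I_3 -> 'I_3} := [ffun=> ord0].
have hX0 : (X_norm nu eps0 mu (fun i => al0 i) v <= M%:E)%E.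
  apply: le_trans hX; apply: ereal_sup_ge; eexists; first by exists mu => //.
  rewrite (bigD1 al0)/=; last first.
    by rewrite /degree big1// => j _; rewrite ffunE.
  rewrite -addeA leeDl// adde_ge0// sume_ge0// => al _; rewrite ?mule_ge0 ?X_norm_ge0//.
  by rewrite lee_fin powR_ge0.
have hS : (sup_norm (weight nu) eps0 mu (fun i => al0 i) (horizontal v) <= M%:E)%E.
  by apply: le_trans hX0; rewrite /X_norm leeDl// esum_nonneg.
have al00 j : al0 j = 0%N :> nat by rewrite ffunE.
have sq0 : 0 < Num.sqrt nu by rewrite sqrtr_gt0.
apply: boundary_sup => // s us.
rewrite ler_pdivlMr// mulrC mulr_sumr.
apply: (sum_le_esum hS) us => xi.
exact: (@mode_norm_ge nu eps0 mu xi (fun j => al0 j) _ (horizontal v) i e0 mu_pos (al00 _) (al00 _) (al00 _)).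
Qed.

End BoundaryBound.

(** * The inviscid limit *)

Section SquareNorm.
Context {R : realType}.

Definition square_norm (I : finType) (v : I -> R * R * R -> R) : \bar R :=
  (\int[volume]_(X in cell) (\sum_i v i X ^+ 2)%:E)%E.

(** Fields are unconstrained at z < 0. A globally continuous w that agrees with v on the half-space
    gives access to measurability and to box integrals. *)
Definition restricts (I : finType) (v w : I -> R * R * R -> R) :=
  (forall i, continuous (w i)) /\ (forall i X, half_space X -> v i X = w i X).

Lemma restrictsB (I : finType) (v v' w w' : I -> R * R * R -> R) :
  restricts v w -> restricts v' w' ->
  restricts (fun i => v i \- v' i) (fun i X => w i X - w' i X).
Proof.
move=> [cw vw] [cw' vw']; split=> [i|i X hX]; first by cont.
by rewrite /= vw// vw'.
Qed.

Lemma square_norm_ge0 (I : finType) (v : I -> R * R * R -> R) : (0 <= square_norm v)%E.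
Proof.
by apply: integral_ge0 => X _; rewrite lee_fin; apply: sumr_ge0 => i _; exact: sqr_ge0.
Qed.

Lemma square_norm_eq (I : finType) (v w : I -> R * R * R -> R) :
  (forall i X, half_space X -> v i X = w i X) -> square_norm v = square_norm w.
Proof.
move=> vw; apply: eq_integral => X; rewrite inE => -[_ _ X0].
by congr EFin; apply: eq_bigr => i _; rewrite vw.
Qed.

Lemma square_norm_box (I : finType) (v w : I -> R * R * R -> R) c Z :
  restricts v w -> (square_norm v <= c%:E)%E -> box_integral Z (fun X => \sum_i w i X ^+ 2) <= c.
Proof.
move=> [cw vw]; rewrite (square_norm_eq vw) -lee_fin; apply: le_trans.
apply: box_integral_le_cell; first by cont.
by move=> X; apply: sumr_ge0 => i _; exact: sqr_ge0.
Qed.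

Lemma box_square_norm (I : finType) (v w : I -> R * R * R -> R) c :
  restricts v w ->
  (forall Z0, exists2 Z, Z0 <= Z & box_integral Z (fun X => \sum_i w i X ^+ 2) <= c) ->
  (square_norm v <= c%:E)%E.
Proof.
move=> [cw vw] h; rewrite (square_norm_eq vw); apply: integral_cell_le => //; first by cont.
by move=> X; apply: sumr_ge0 => i _; exact: sqr_ge0.
Qed.

(** From (a - b)^2 <= 2 a^2 + 2 b^2 on each box; this replaces the triangle inequality of the L^2
    norm. *)
Lemma square_normB (I : finType) (v v' w w' : I -> R * R * R -> R) c c' :
  restricts v w -> restricts v' w' ->
  (square_norm v <= c%:E)%E -> (square_norm v' <= c'%:E)%E ->
  (square_norm (fun i => (v i \- v' i)%R) <= (2 * c + 2 * c')%:E)%E.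
Proof.
move=> r r' h h'; apply: (box_square_norm (restrictsB r r')) => Z0; exists Z0 => //.
have [cw _] := r; have [cw' _] := r'; have IB := @box_integral_on R Z0.
pose f X := \sum_i w i X ^+ 2; pose f' X := \sum_i w' i X ^+ 2.
have cf : continuous f by rewrite /f; cont.
have cf' : continuous f' by rewrite /f'; cont.
apply: (@le_trans _ _ (box_integral Z0 (fun X => 2 * f X + 2 * f' X))).
  apply: (integral_on_le IB); [by cont|by cont|move=> X _].
  rewrite !mulr_sumr -big_split; apply: ler_sum => i _ /=.
  by have := sqr_ge0 (w i X + w' i X); lra.
rewrite (@integral_onD _ _ _ _ IB (fun X => 2 * f X) (fun X => 2 * f' X)); [|by cont|by cont].
rewrite (integral_onZ IB 2 cf) (integral_onZ IB 2 cf').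
by apply: lerD; rewrite ler_pM2l//; [exact: square_norm_box r h | exact: square_norm_box r' h'].
Qed.

Lemma L2norm_le (I : finType) (v : I -> R * R * R -> R) c :
  (square_norm v <= c%:E)%E -> (L2norm v <= (Num.sqrt c)%:E)%E.
Proof.
rewrite -[L2norm v]/(square_norm v `^ 2^-1)%E.
have := square_norm_ge0 v; case: (square_norm v) => [r| |]; rewrite ?leye_eq//.
by rewrite poweR_EFin !lee_fin => r0 rc; rewrite powR12_sqrt//; exact: ler_wsqrtr.
Qed.

Lemma square_norm_le (I : finType) (v : I -> R * R * R -> R) c :
  (L2norm v <= c%:E)%E -> (square_norm v <= (c ^+ 2)%:E)%E.
Proof.
rewrite -[L2norm v]/(square_norm v `^ 2^-1)%E.
have := square_norm_ge0 v; case: (square_norm v) => [r| |]; rewrite ?leye_eq//.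
  rewrite poweR_EFin !lee_fin => r0; rewrite powR12_sqrt// => rc.
  have c0 : 0 <= c by apply: le_trans rc; exact: sqrtr_ge0.
  by rewrite -(sqr_sqrtr r0) ler_pXn2r// nnegrE// sqrtr_ge0.
by rewrite poweRyr// invr_neq0.
Qed.

Lemma square_norm_fin (I : finType) (v : I -> R * R * R -> R) :
  (L2norm v < +oo)%E -> exists c, (square_norm v <= c%:E)%E.
Proof.
rewrite -[L2norm v]/(square_norm v `^ 2^-1)%E.
have := square_norm_ge0 v; case: (square_norm v) => [r| |] _ => //.
- by exists r.
- by rewrite poweRyr// invr_neq0.
- by exists 0; exact: leNye.
Qed.

Lemma square_norm_cvg0 (I : finType) (F : set_system R) (v : R -> I -> R * R * R -> R) e :
  Filter F -> 0 < e -> L2norm (v s) @[s --> F] --> 0%E ->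
  \forall s \near F, (square_norm (v s) <= e%:E)%E.
Proof.
move=> FF e0 /(_ [set y | (y < (Num.sqrt e)%:E)%E]).
have o : nbhs (0%E : \bar R) [set y | (y < (Num.sqrt e)%:E)%E].
  apply: open_nbhs_nbhs; split; first exact: open_ereal_lt_ereal.
  by rewrite /= lte_fin sqrtr_gt0.
move=> /(_ o) h; have {}h : F (fun s => L2norm (v s) < (Num.sqrt e)%:E)%E by exact: h.
apply: filterS h => s /ltW /square_norm_le.
by rewrite sqr_sqrtr// ltW.
Qed.

End SquareNorm.

(** * Velocity gradient and vorticity under the no-slip condition *)

Section Boundary.
Context {R : realType}.
Implicit Types (v : vector_field R) (J : set R).

Lemma partial_boundary (f : scalar_field R) (j : 'I_3) x y : val j != 2%N ->
  (forall x y, f (x, y, 0) = 0) -> derivable_in half_space (Defs.basis j) f (x, y, 0) ->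
  partial j f (x, y, 0) = 0.
Proof.
move=> jv f0 df.
have := @is_derive_in _ _ half_space (Defs.basis j) f (x, y, 0) (fun=> 0) 0 df.
move=> h; suff d : is_derive (0 : R) 1 (fun=> 0) (partial j f (x, y, 0)).
  by case: d => _ <-; rewrite derive_cst.
apply: h; apply: filterS filterT => h _.
rewrite add_basis /set_coord /coord /half_space.
by case: j jv {df} => [[|[|[|k]]] kj]//= _; rewrite f0.
Qed.

Lemma no_slip_gradient v x y b : 0 <= b ->
  (forall i x y, v i (x, y, 0) = 0) ->
  (forall i j, derivable_in half_space (Defs.basis j) (v i) (x, y, 0)) ->
  \sum_(j < 3) partial j (v j) (x, y, 0) = 0 ->
  (forall i : 'I_2, `|curl v (inord i) (x, y, 0)| <= b) ->
  forall i, `|partial (inord 2) (v i) (x, y, 0)| <= b.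
Proof.
move=> b0 v0 dv div hc i.
have z (k l : nat) : (l < 2)%N -> partial (inord l) (v (inord k)) (x, y, 0) = 0.
  by move=> l2; apply: partial_boundary => //; rewrite /= inordK//; case: l l2 => [|[|]].
have := hc ord0; have := hc (Ordinal (isT : (1 < 2)%N)).
rewrite /curl /= !inordK//= (z 2%N 1%N)// (z 2%N 0%N)// subr0 sub0r normrN => h0 h1.
have [i0 | [i1 | i2]] : i = inord 0 \/ i = inord 1 \/ i = inord 2.
- case: i => [[|[|[|k]]] ki] //; [left|right; left|right; right]; apply: val_inj; by rewrite /= inordK.
- by rewrite i0.
- by rewrite i1.
rewrite i2; move: div; rewrite sum_ord3.
by rewrite (z 0%N 0%N)// (z 1%N 1%N)// !add0r => ->; rewrite normr0.
Qed.

End Boundary.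

(** * Comparison of a viscous solution with the Euler solution *)

Section Comparison.
Context {R : realType} (T nu : R) (u0 : vector_field R) (u ubar : R -> vector_field R)
  (p pbar : R -> scalar_field R).
Context (T0 : 0 < T) (nu0 : 0 < nu) (ns : navier_stokes nu T u0 u p) (eu : euler T u0 ubar pbar).

Lemma time_slice_restricts (I : finType) (J : set R) (g : I -> R -> scalar_field R) t :
  (forall i, continuous_st J (g i)) -> J t ->
  restricts (fun i => g i t) (fun i X => g i t (reflect_up X)).
Proof.
move=> cg Jt; split => [i|i [[x y] z] z0]; last by rewrite /reflect_up /= (max_idPr z0).
apply: (cont_within (k := fun X => (t, reflect_up X)) (cg i)); last first.
  by move=> X; split => //; exact: half_space_reflect.
by have := @cont_reflect R => h; cont.
Qed.

Lemma lift_slice (a b t : R) (g : R -> scalar_field R) X :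
  a <= t <= b -> lift a b g (t, X) = g t (reflect_up X).
Proof. by move=> h; rewrite /lift /= clip_id. Qed.

Lemma lift_restricts (I : finType) (J : set R) (g : I -> R -> scalar_field R) a b t :
  (forall i, continuous_st J (g i)) -> J t -> a <= t <= b ->
  restricts (fun i => g i t) (fun i X => lift a b (g i) (t, X)).
Proof.
move=> cg Jt tab; have := time_slice_restricts cg Jt; congr restricts.
by apply/funext => i; apply/funext => X; rewrite lift_slice.
Qed.

Lemma wall_bound (eps0 a mu0 gamma t M : R) : 0 <= eps0 -> gamma * t < mu0 -> 0 < t <= T ->
  (triple_norm nu eps0 a mu0 gamma t (curl (u t)) <= M%:E)%E ->
  forall i x y, 0 <= x <= 2 * pi -> 0 <= y <= 2 * pi ->
  `|partial (inord 2) (u t i) (x, y, 0)| <= M / Num.sqrt nu.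
Proof.
move=> e0 gt Jt hM i x y hx hy.
have [_ _ [su _ _] [_ div] [_ noslip]] := ns.
have t0T : 0 <= t <= T by case/andP: Jt => h1 h2; rewrite (ltW h1).
have Jt' : `]0, T]%classic t by rewrite /= in_itv.
have X0 : half_space (x, y, 0) by rewrite /half_space /= lexx.
have cp (j k : 'I_3) : continuous (fun q : R * R => partial j (u t k) (q.1, q.2, 0)).
  have [_ /(_ j)[_ [c _]]] := su k.
  apply: (cont_within (k := fun q : R * R => (t, (q.1, q.2, 0))) c); first by cont.
  by move=> q; split => //; rewrite /half_space /= lexx.
have cc (k : 'I_2) : continuous (fun q : R * R => curl (u t) (inord k) (q.1, q.2, 0)).
  by case: k => [[|[|k]] kk] //; rewrite /curl /= inordK//=; cont.
have hc k := vorticity_boundary nu0 e0 gt hM (@cc k) hx hy.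
apply: no_slip_gradient => //.
- by apply: le_trans (hc ord0).
- by move=> k x' y'; exact: noslip.
- by move=> k j; have [_ /(_ j)[d _]] := su k; exact: d.
- exact: div.
Qed.

Let gap t (i : 'I_3) := u t i \- ubar t i.

Lemma euler_restricts t : 0 <= t <= T -> restricts (ubar t) (fun i X => ubar t i (reflect_up X)).
Proof.
have [_ _ [su _ _] _ _] := eu; move=> ht.
by apply: (time_slice_restricts (g := fun i t => ubar t i) (J := `[0, T]%classic)) => // i; have [] := su i.
Qed.

Lemma navier_stokes_restricts t : 0 <= t <= T -> exists w, restricts (u t) w.
Proof.
move=> /andP[]; rewrite le_eqVlt => /orP[/eqP <- _|t0 tT].
  (* The regularity of the viscous solution is given for t > 0 only; at t = 0 it coincides with the
     Euler solution, which is continuous there. *)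
  exists (fun i X => ubar 0 i (reflect_up X)).
  have h0 : 0 <= (0 : R) <= T by rewrite lexx ltW.
  have [cw eq] := euler_restricts h0; split => // i X hX.
  have [_ _ _ _ [iu _]] := ns; have [_ _ _ _ [ib _]] := eu.
  by rewrite iu// -(ib i X hX) eq.
have [_ _ [su _ _] _ _] := ns.
exists (fun i X => u t i (reflect_up X)).
apply: (time_slice_restricts (g := fun i t => u t i) (J := `]0, T]%classic)).
  by move=> i; have [] := su i.
by rewrite /= in_itv/= t0.
Qed.

Lemma increments t e : 0 <= t <= T -> 0 < e ->
  \forall s \near t, 0 <= s <= T ->
    (square_norm (fun i => (u s i \- u t i)%R) <= e%:E)%E /\
    (square_norm (fun i => (ubar s i \- ubar t i)%R) <= e%:E)%E.
Proof.
move=> ht e0.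
have [_ [_ cu _] _ _ _] := ns; have [_ [_ cb _] _ _ _] := eu.
have FF : Filter (within `[0, T] (nbhs t)) by exact: within_filter.
have h1 := square_norm_cvg0 FF e0 (cu t ht).
have h2 := square_norm_cvg0 FF e0 (cb t ht).
have {}h1 : \forall s \near t, `[0, T]%classic s -> _ := h1.
have {}h2 : \forall s \near t, `[0, T]%classic s -> _ := h2.
by apply: filterS2 h1 h2 => s h1 h2 hs; split; [apply: h1|apply: h2]; rewrite /= in_itv.
Qed.

(** The initial data agree, so the gap is the difference of the two increments from time 0. *)
Lemma gap_initial e : 0 < e -> exists2 d, 0 < d &
  forall t, 0 <= t <= T -> t < d -> (square_norm (gap t) <= e%:E)%E.
Proof.
move=> e0; have h0 : 0 <= (0 : R) <= T by rewrite lexx ltW.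
have /nbhs_ballP[d d0 hd] := increments h0 (divr_gt0 e0 (ltr0Sn R 3)).
exists d => // t ht td; have t0 : 0 <= t by case/andP: ht.
have [] := hd t _ ht; first by rewrite /ball/= sub0r normrN ger0_norm.
have [w r] := navier_stokes_restricts ht; have [w0 r0] := navier_stokes_restricts h0.
have rb := euler_restricts ht; have rb0 := euler_restricts h0.
move=> hu hb; have := square_normB (restrictsB r r0) (restrictsB rb rb0) hu hb.
have -> : 2 * (e / 4) + 2 * (e / 4) = e by field.
apply: le_trans; rewrite le_eqVlt; apply/orP; left; apply/eqP.
apply: square_norm_eq => i X hX.
have [_ _ _ _ [iu _]] := ns; have [_ _ _ _ [ib _]] := eu.
by rewrite /gap/= iu// ib//; ring.
Qed.

(** Supplies the finite N from which the halving starts. Energies are given as finite at each time;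
    L^2 continuity makes the bound local in time, and compactness of [0, T] makes it uniform. *)
Lemma gap_bounded : exists2 c, 0 <= c & forall t, 0 <= t <= T -> (square_norm (gap t) <= c%:E)%E.
Proof.
pose bound c t := 0 <= t <= T -> (square_norm (gap t) <= c%:E)%E.
suff : \forall c \near +oo, `[0, T]%classic `<=` bound c.
  move=> h; have : \forall c \near +oo, 0 <= c /\ `[0, T]%classic `<=` bound c.
    by apply: filterS2 h (nbhs_pinfty_ge (num_real (0 : R))) => c h1 h2; split.
  case/filter_ex => c [c0 hc]; exists c => // t ht; by apply: hc; rewrite //= in_itv.
have /compact_near_coveringP := @segment_compact R 0 T; apply => t; rewrite /= in_itv/= => ht.
have [_ [fu _ _] _ _ _] := ns; have [_ [fb _ _] _ _ _] := eu.
have [a ha] := square_norm_fin (fu t ht); have [b hb] := square_norm_fin (fb t ht).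
have near_t := increments ht (ltr01 : 0 < 1 :> R).
have [wt rt] := navier_stokes_restricts ht; have rbt := euler_restricts ht.
(* From gap s = ((u s - u t) - (ubar s - ubar t)) - (ubar t - u t), with three applications of
   [square_normB]. *)
pose c := 2 * (2 * 1 + 2 * 1) + 2 * (2 * b + 2 * a).
have local s : 0 <= s <= T ->
    (square_norm (fun i => (u s i \- u t i)%R) <= 1%:E)%E /\
    (square_norm (fun i => (ubar s i \- ubar t i)%R) <= 1%:E)%E ->
    (square_norm (gap s) <= c%:E)%E.
  move=> hs [h1 h2]; have [w r] := navier_stokes_restricts hs; have rb := euler_restricts hs.
  have := square_normB (restrictsB (restrictsB r rt) (restrictsB rb rbt)) (restrictsB rbt rt)
    (square_normB (restrictsB r rt) (restrictsB rb rbt) h1 h2) (square_normB rbt rt hb ha).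
  apply: le_trans; rewrite le_eqVlt; apply/orP; left; apply/eqP.
  by apply: square_norm_eq => i X hX; rewrite /gap/=; ring.
have {}near_t : \forall s \near t, bound c s.
  by apply: filterS near_t => s hs h0T; exact: local (hs h0T).
exists (bound c, [set c' | c <= c']).
  by split; [exact: near_t | exact: nbhs_pinfty_ge (num_real c)].
by move=> [s c'] [hs cc'] h0T; apply: (le_trans (hs h0T)); rewrite lee_fin.
Qed.

Section Step.
Context (B b : R)
  (uB : forall t, 0 <= t <= T ->
    [/\ forall i X, half_space X -> `|ubar t i X| <= B,
        forall ij X, half_space X -> `|gradient (ubar t) ij X| <= B,
        (L2norm (gradient (ubar t)) <= B%:E)%E &
        (L2norm (fun i : 'I_3 => partial i (pbar t)) <= B%:E)%E])
  (wall : forall t i x y, 0 < t <= T -> 0 <= x <= 2 * pi -> 0 <= y <= 2 * pi ->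
    `|partial (inord 2) (u t i) (x, y, 0)| <= b).

Let B0 : 0 <= B.
Proof.
have [] := @uB 0; first by rewrite lexx ltW.
by move=> /(_ ord0 (0, 0, 0)) h _ _ _; apply: le_trans (h _) => //; rewrite /half_space /= lexx.
Qed.

(** Makes 6 B / K <= 1/2; the 1 keeps K positive when B = 0. *)
Let K := 12 * B + 1.
Let data := 2 * T * (nu * B ^+ 2 + nu * (3 * (B * b)) * (2 * pi) ^+ 2).

(** The bounds [Bu] and [c] found in the proof may degenerate as t1 or nu tends to 0. They only
    serve to choose the height Z and leave no trace in the estimate, which involves the Euler bound
    B and the wall bound b alone. *)
Lemma gap_step t1 t2 N e Z0 : 0 < t1 -> t1 <= t2 -> t2 <= T -> 0 < e -> 0 <= Z0 -> 0 <= N ->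
  (square_norm (gap t1) <= e%:E)%E ->
  (forall t, 0 <= t <= T -> (square_norm (gap t) <= (N * expR (K * t))%:E)%E) ->
  exists2 Z, Z0 <= Z & box_integral Z (fun X => \sum_i
      (lift t1 t2 (fun t => u t i) (t2, X) - lift t1 t2 (fun t => ubar t i) (t2, X)) ^+ 2)
    <= e + 2 * e + N * expR (K * t2) * (6 * B / K)
       + 2 * (t2 - t1) * (nu * B ^+ 2 + nu * (3 * (B * b)) * (2 * pi) ^+ 2).
Proof.
move=> t10 t12 t2T e0 Z00 N0 he hN.
have [peru [_ _ feu] [su tu sp] [momu divu] [_ noslip]] := ns.
have [perb [_ _ feb] [sb tb spb] [momb divb] [_ slip]] := eu.
have in_u t : t1 <= t <= t2 -> `]0, T]%classic t.
  by move=> /andP[h1 h2]; rewrite /= in_itv/= (lt_le_trans t10 h1) (le_trans h2 t2T).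
have in_T t : t1 <= t <= t2 -> 0 <= t <= T.
  by move=> /andP[h1 h2]; rewrite (le_trans (ltW t10) h1) (le_trans h2 t2T).
have in_b t : t1 <= t <= t2 -> `[0, T]%classic t by move=> /in_T; rewrite /= in_itv.
have su1 i : space_class `]0, T]%classic 1 (fun t => u t i).
  by have [c h] := su i; split => // j; have [d [c' _]] := h j; split => //; split.
have hu := solution_flow (ltW t10) t12 t2T in_u peru su1 tu sp momu divu
  (fun t x y ht => noslip t (inord 2) x y ht).
have hb := solution_flow (ltW t10) t12 t2T in_b perb sb tb spb momb divb slip.
have {}hb : flow t1 t2 (fun i => lift t1 t2 (fun t => ubar t i))
    (fun i j => lift t1 t2 (fun t => partial j (ubar t i)))
    (fun i => lift t1 t2 (time_derive T (fun t => ubar t i)))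
    (lift t1 t2 pbar) (fun j => lift t1 t2 (fun t => partial j (pbar t))) (fun _ _ => 0).
  by move: hb; congr flow; apply/funext => i; apply/funext => q; rewrite mul0r.
have cddu i j : continuous (lift t1 t2 (fun t => partial j (partial j (u t i)))).
  by apply: (cont_lift t12 in_u); have [_ /(_ j)[_ [_ /(_ j)[_ []]]]] := su i.
have hddu t i j : has_partial j (slice (lift t1 t2 (fun t => partial j (u t i))) t)
    (slice (lift t1 t2 (fun t => partial j (partial j (u t i)))) t).
  by apply: (lift_partial t12 in_u); have [_ /(_ j)[_ [_ /(_ j)[]]]] := su i.
have [Bu hBu] : exists Bu, forall t, t1 <= t <= T ->
    [/\ forall i X, half_space X -> `|u t i X| <= Bu,
        forall ij X, half_space X -> `|gradient (u t) ij X| <= Bu,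
        (L2norm (gradient (u t)) <= Bu%:E)%E &
        (L2norm (fun i : 'I_3 => partial i (p t)) <= Bu%:E)%E].
  by apply: feu; rewrite /= in_itv/= t10 (le_trans t12).
have K0 : 6 * B < K by rewrite /K; move: B0; lra.
have ru t : t1 <= t <= t2 -> restricts (u t) (fun i X => lift t1 t2 (fun t => u t i) (t, X)).
  move=> ht; apply: (lift_restricts (g := fun i t => u t i) _ (in_u t ht) ht) => i.
  by have [] := su i.
have rb t : t1 <= t <= t2 ->
    restricts (ubar t) (fun i X => lift t1 t2 (fun t => ubar t i) (t, X)).
  move=> ht; apply: (lift_restricts (g := fun i t => ubar t i) _ (in_b t ht) ht) => i.
  by have [] := sb i.
have rgu t : t1 <= t <= t2 -> restricts (gradient (u t))
    (fun ij X => lift t1 t2 (fun t => partial ij.2 (u t ij.1)) (t, X)).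
  move=> ht; apply: (lift_restricts (g := fun ij t => partial ij.2 (u t ij.1)) _ (in_u t ht) ht).
  by move=> [i j]; have [_ /(_ j)[_ []]] := su i.
have rgb t : t1 <= t <= t2 -> restricts (gradient (ubar t))
    (fun ij X => lift t1 t2 (fun t => partial ij.2 (ubar t ij.1)) (t, X)).
  move=> ht; apply: (lift_restricts (g := fun ij t => partial ij.2 (ubar t ij.1)) _ (in_b t ht) ht).
  by move=> [i j]; have [_ /(_ j)[_ []]] := sb i.
have rp t : t1 <= t <= t2 -> restricts (fun j : 'I_3 => partial j (p t))
    (fun j X => lift t1 t2 (fun t => partial j (p t)) (t, X)).
  move=> ht; apply: (lift_restricts (g := fun j t => partial j (p t)) _ (in_u t ht) ht) => j.
  by have [_ /(_ j)[_ []]] := sp.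
have rpb t : t1 <= t <= t2 -> restricts (fun j : 'I_3 => partial j (pbar t))
    (fun j X => lift t1 t2 (fun t => partial j (pbar t)) (t, X)).
  move=> ht; apply: (lift_restricts (g := fun j t => partial j (pbar t)) _ (in_b t ht) ht) => j.
  by have [_ /(_ j)[_ []]] := spb.
have hBut t : t1 <= t <= t2 -> t1 <= t <= T.
  by move=> /andP[-> h]; rewrite (le_trans h t2T).
have gap_box t Z c : t1 <= t <= t2 -> (square_norm (gap t) <= c%:E)%E ->
    box_integral Z (fun X => \sum_i
      (lift t1 t2 (fun t => u t i) (t, X) - lift t1 t2 (fun t => ubar t i) (t, X)) ^+ 2) <= c.
  by move=> ht; exact: square_norm_box (restrictsB (ru t ht) (rb t ht)).
have [c c0 hc] := gap_bounded.
have Bu0 : 0 <= Bu.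
  have h1 : t1 <= t1 <= T by rewrite lexx (le_trans t12).
  have [h _ _ _] := hBu t1 h1.
  by apply: le_trans (h ord0 (0, 0, 0) _) => //; rewrite /half_space /= lexx.
have in_clip t : t1 <= clip t1 t2 t <= t2 by exact: clip_itv.
(* [Ca] adds the energy of the gap and that of the full gradient of u; [Cp] is the bound of
   [square_normB] for the two pressure gradients. *)
apply: (energy_step (Bu := Bu) (Ca := c + Bu ^+ 2) (Cp := 2 * Bu ^+ 2 + 2 * B ^+ 2)
  hu hb cddu hddu t12 (ltW nu0)) => //.
- move=> i [t X]; have [h _ _ _] := hBu _ (hBut _ (in_clip t)).
  exact: h (half_space_reflect X).
- move=> i [t X]; have [h _ _ _] := uB (in_T _ (in_clip t)).
  exact: h (half_space_reflect X).
- move=> i j [t X]; have [_ h _ _] := uB (in_T _ (in_clip t)).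
  exact: (h (i, j)) (half_space_reflect X).
- by move=> i t x y; rewrite /lift /reflect_up /= maxxx noslip// in_T// in_clip.
- move=> i t x y ht hx hy; rewrite lift_slice// /reflect_up /= maxxx; apply: wall => //.
  by have := in_u t ht; rewrite /= in_itv.
- move=> t Z ht Z1; have IB := @box_integral_on R Z.
  have [cu _] := ru t ht; have [cb _] := rb t ht; have [cgu _] := rgu t ht.
  pose f X := \sum_i
    (lift t1 t2 (fun t => u t i) (t, X) - lift t1 t2 (fun t => ubar t i) (t, X)) ^+ 2.
  pose g X := \sum_(ij : 'I_3 * 'I_3) lift t1 t2 (fun t => partial ij.2 (u t ij.1)) (t, X) ^+ 2.
  have cf : continuous f by rewrite /f; cont.
  have cg : continuous g by rewrite /g; cont.
  have hf : box_integral Z f <= c by apply: gap_box ht (hc t (in_T t ht)).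
  have hg : box_integral Z g <= Bu ^+ 2.
    by apply: (square_norm_box _ (rgu t ht)); apply: square_norm_le; have [] := hBu t (hBut t ht).
  apply: le_trans (lerD hf hg); rewrite -(integral_onD IB cf cg).
  apply: (integral_on_le IB); [|by cont|].
    have cd i : continuous (fun X => lift t1 t2 (fun t => partial (inord 2) (u t i)) (t, X)).
      exact: cgu (i, inord 2).
    by cont.
  move=> X _; rewrite lerD2l /g.
  rewrite -(pair_bigA _ (fun i j => lift t1 t2 (fun t => partial j (u t i)) (t, X) ^+ 2)) /=.
  apply: ler_sum => i _; rewrite (bigD1 (inord 2))//= lerDl.
  by apply: sumr_ge0 => j _; exact: sqr_ge0.
- move=> t Z ht Z1; have IB := @box_integral_on R Z.
  have [cp _] := rp t ht; have [cpb _] := rpb t ht.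
  have [_ _ _ hp] := hBu t (hBut t ht); have [_ _ _ hpb] := uB (in_T t ht).
  have := square_norm_box Z (restrictsB (rp t ht) (rpb t ht))
    (square_normB (rp t ht) (rpb t ht) (square_norm_le hp) (square_norm_le hpb)).
  apply: le_trans; apply: (integral_on_le IB); [by cont|by cont|].
  move=> X _; rewrite [leRHS](bigD1 (inord 2))//= lerDl.
  by apply: sumr_ge0 => j _; exact: sqr_ge0.
- move=> t Z ht Z1.
  have [_ _ hg _] := uB (in_T t ht).
  have := square_norm_box Z (rgb t ht) (square_norm_le hg).
  apply: le_trans; rewrite le_eqVlt; apply/orP; left; apply/eqP; congr box_integral.
  apply/funext => X.
  by rewrite (pair_bigA _ (fun i j => lift t1 t2 (fun t => partial j (ubar t i)) (t, X) ^+ 2)).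
- by move=> Z _; apply: gap_box => //; rewrite lexx.
- by move=> t Z ht _; apply: gap_box => //; exact: hN (in_T t ht).
Qed.

Let b0 : 0 <= b.
Proof.
have pi2 : 0 <= (0 : R) <= 2 * pi by rewrite lexx mulr_ge0// pi_ge0.
have hT : 0 < T <= T by rewrite T0 lexx.
exact: le_trans (normr_ge0 _) (wall ord0 hT pi2 pi2).
Qed.

Let rate_ge0 : 0 <= nu * B ^+ 2 + nu * (3 * (B * b)) * (2 * pi) ^+ 2.
Proof.
have n0 := ltW nu0; apply: addr_ge0; first by rewrite mulr_ge0// sqr_ge0.
by rewrite mulr_ge0 ?sqr_ge0// mulr_ge0// mulr_ge0// mulr_ge0.
Qed.

Let data_ge0 : 0 <= data.
Proof. by apply: mulr_ge0 rate_ge0; rewrite mulr_ge0// ltW. Qed.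

Let K_ge0 : 0 <= K. Proof. by rewrite addr_ge0// mulr_ge0. Qed.

Lemma halve_arith (N E d e x t t1 r : R) : 0 <= N -> 0 <= r -> 0 <= t1 -> 1 <= E -> x <= 2^-1 ->
  t <= T -> d = 2 * T * r -> e / 3 + 2 * (e / 3) + N * E * x + 2 * (t - t1) * r <= (N / 2 + d) * E + e.
Proof.
move=> N0 r0 t10 E1 x2 tT ->.
have h1 : 0 <= N * E * (2^-1 - x) by rewrite !mulr_ge0 ?subr_ge0// (le_trans ler01).
have h2 : 0 <= (T - (t - t1)) * r by rewrite mulr_ge0// subr_ge0; lra.
have h3 : 0 <= T * r * (E - 1) by rewrite !mulr_ge0 ?subr_ge0// ltW.
lra.
Qed.

Lemma gap_halve N : 0 <= N ->
  (forall t, 0 <= t <= T -> (square_norm (gap t) <= (N * expR (K * t))%:E)%E) ->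
  forall t, 0 <= t <= T -> (square_norm (gap t) <= ((N / 2 + data) * expR (K * t))%:E)%E.
Proof.
move=> N0 hN t ht; have [t0 tT] := andP ht; apply/lee_addgt0Pr => e e0.
(* The slack e is split in three: one third for the energy at the starting time, two for the top
   flux, which enters with a factor 2. *)
have [d d0 hd] := gap_initial (divr_gt0 e0 (ltr0Sn R 2)).
have N2 : 0 <= N / 2 + data by rewrite addr_ge0// divr_ge0.
have E1 : 1 <= expR (K * t) by rewrite -expR0 ler_expR mulr_ge0.
have [td|dt] := ltP t d.
  apply: (le_trans (hd t ht td)); rewrite -EFinD lee_fin.
  have := mulr_ge0 N2 (le_trans ler01 E1); move: e0; lra.
(* The starting time d / 2 is positive, so the viscous equations hold from there on, and small
   enough for the gap to be below e / 3. *)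
have dh : 0 < d / 2 by rewrite divr_gt0.
have dt2 : d / 2 < d by rewrite ltr_pdivrMr// mulr_natr mulr2n ltrDl.
have dT : d / 2 <= t by rewrite (le_trans (ltW dt2)).
have dI : 0 <= d / 2 <= T by rewrite (ltW dh) (le_trans dT).
have d_arith : e / 3 + 2 * (e / 3) + N * expR (K * t) * (6 * B / K) + 2 * (t - d / 2) *
    (nu * B ^+ 2 + nu * (3 * (B * b)) * (2 * pi) ^+ 2) <= (N / 2 + data) * expR (K * t) + e.
  apply: halve_arith => //; first exact: ltW.
  by rewrite ler_pdivrMr /K; move: B0; lra.
rewrite -EFinD; apply: le_trans (_ : (_ <= _%:E)%E) _; last first.
  by rewrite lee_fin; exact: d_arith.
have dtt : d / 2 <= t <= t by rewrite dT lexx.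
have [_ _ [su _ _] _ _] := ns; have [_ _ [sb _ _] _ _] := eu.
have ru : restricts (u t) (fun i X => lift (d / 2) t (fun t => u t i) (t, X)).
  apply: (lift_restricts (g := fun i t => u t i) (J := `]0, T]%classic)) => //.
    by move=> i; have [] := su i.
  by rewrite /= in_itv/= (lt_le_trans d0).
have rb : restricts (ubar t) (fun i X => lift (d / 2) t (fun t => ubar t i) (t, X)).
  apply: (lift_restricts (g := fun i t => ubar t i) (J := `[0, T]%classic)) => //.
  by move=> i; have [] := sb i.
apply: (box_square_norm (restrictsB ru rb)) => Z0.
have Z1 : 0 <= Num.max 0 Z0 by rewrite le_max lexx.
have [Z ZZ hZ] := gap_step dh dT tT (divr_gt0 e0 (ltr0Sn R 2)) Z1 N0 (hd _ dI dt2) hN.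
by exists Z => //; apply: le_trans ZZ; rewrite le_max lexx orbT.
Qed.

(** 2 [data] is the fixed point of N -> N / 2 + [data], and the excess over it is halved at each
    iteration. *)
Lemma gap_geometric c : 0 <= c -> (forall t, 0 <= t <= T -> (square_norm (gap t) <= c%:E)%E) ->
  forall k t, 0 <= t <= T ->
  (square_norm (gap t) <= ((c / 2 ^+ k + 2 * data) * expR (K * t))%:E)%E.
Proof.
move=> c0 hc; elim=> [|k IH] t ht.
  apply: (le_trans (hc t ht)); rewrite lee_fin expr0 divr1.
  have E1 : 1 <= expR (K * t) by rewrite -expR0 ler_expR mulr_ge0//; case/andP: ht.
  apply: (@le_trans _ _ (c + 2 * data)); first by rewrite lerDl mulr_ge0.
  by rewrite ler_peMr// addr_ge0// mulr_ge0.
have N0 : 0 <= c / 2 ^+ k + 2 * data.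
  by apply: addr_ge0; [rewrite divr_ge0// exprn_ge0 | exact: mulr_ge0].
have := gap_halve N0 IH ht.
have -> // : (c / 2 ^+ k + 2 * data) / 2 + data = c / 2 ^+ k.+1 + 2 * data.
by rewrite exprS; field; rewrite expf_neq0.
Qed.

Lemma gap_le t : 0 <= t <= T ->
  (square_norm (fun i => (u t i \- ubar t i)%R) <=
   (2 * (2 * T * (nu * B ^+ 2 + nu * (3 * (B * b)) * (2 * pi) ^+ 2)) *
    expR ((12 * B + 1) * T))%:E)%E.
Proof.
move=> ht; have [c c0 hc] := gap_bounded; apply/lee_addgt0Pr => e e0.
have E0 := expR_gt0 (K * T).
have q0 : 0 < e / (c * expR (K * T) + 1) by rewrite divr_gt0// ltr_wpDl// mulr_ge0// ltW.
have [k hk] : exists k, 1 / 2 ^+ k < e / (c * expR (K * T) + 1).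
  by apply: (@filter_ex _ \oo); exact: (near_infty_natSinv_expn_lt (PosNum q0)).
rewrite -/data -/K; apply: (le_trans (gap_geometric c0 hc k ht)); rewrite -EFinD lee_fin.
have Et : expR (K * t) <= expR (K * T).
  by rewrite ler_expR ler_wpM2l//; case/andP: ht.
have N0 : 0 <= c / 2 ^+ k + 2 * data.
  by apply: addr_ge0; [rewrite divr_ge0// exprn_ge0 | exact: mulr_ge0].
apply: (le_trans (ler_wpM2l N0 Et)); rewrite mulrDl [leRHS]addrC lerD2r.
rewrite ltr_pdivlMr in hk; last by rewrite ltr_wpDl// mulr_ge0// ltW.
apply: le_trans (ltW hk); have -> : c / 2 ^+ k * expR (K * T) = 1 / 2 ^+ k * (c * expR (K * T)) by ring.
by apply: ler_wpM2l; rewrite ?lerDl// divr_ge0// exprn_ge0.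
Qed.

End Step.

End Comparison.

(** The wall bound V / sqrt nu costs half a power of nu, leaving V sqrt nu; the remaining term uses
    nu <= sqrt nu for nu <= 1. *)
Lemma viscous_arith (R : realType) (T B V nu E c : R) : 0 < T -> 0 < nu -> nu <= 1 -> 0 <= E ->
  2 * (2 * T * (nu * B ^+ 2 + nu * (3 * (B * (V / Num.sqrt nu))) * c)) * E <=
  4 * T * (B ^+ 2 + 3 * (B * V) * c) * E * Num.sqrt nu.
Proof.
move=> T0 nu0 nu1 E0; set s := Num.sqrt nu.
have s0 : 0 < s by rewrite sqrtr_gt0.
have e : nu = s ^+ 2 by rewrite sqr_sqrtr// ltW.
have s1 : s <= 1 by rewrite -sqrtr1; exact: ler_wsqrtr.
have -> : 2 * (2 * T * (nu * B ^+ 2 + nu * (3 * (B * (V / s))) * c)) * E =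
    4 * T * (B ^+ 2 + 3 * (B * V) * c) * E * s - 4 * (T * E * B ^+ 2 * (s * (1 - s))).
  by rewrite e; field; rewrite gt_eqF.
rewrite gerBl mulr_ge0//; apply: mulr_ge0; last by rewrite mulr_ge0 ?subr_ge0// ltW.
by rewrite mulr_ge0 ?sqr_ge0// mulr_ge0// ltW.
Qed.

Theorem theorem3p2 (R : realType) (theta0 : R) (htheta0 : green_rate theta0) :
  exists2 eps1 : R, 0 < eps1 < 1 &
  forall (eps0 : R), 0 < eps0 <= eps1 ->
  forall (a : R), 0 < a < 2^-1 ->
  forall (mu0 M C T gamma : R) (u0 : vector_field R)
    (u : R -> R -> vector_field R) (p : R -> R -> scalar_field R)
    (ubar : R -> vector_field R) (pbar : R -> scalar_field R),
  0 < mu0 -> 0 < T -> 0 < gamma -> T <= mu0 / (2 * gamma) ->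
  (forall nu, 0 < nu <= 1 ->
     (triple_norm nu eps0 a mu0 gamma 0 (curl u0) <= M%:E)%E) ->
  (forall nu, 0 < nu <= 1 -> navier_stokes nu T u0 (u nu) (p nu)) ->
  (forall nu t, 0 < nu <= 1 -> 0 <= t <= T ->
     (triple_norm nu eps0 a mu0 gamma t (curl (u nu t)) <= (C * M)%:E)%E) ->
  euler T u0 ubar pbar ->
  ereal_sup [set L2norm (fun i => u nu t i \- ubar t i) | t in `[0, T]]
    @[nu --> 0^'+] --> 0%E.
Proof.
(* The exponential weight enters through being at least 1, which holds for every nonnegative [eps0],
   so any number in (0, 1) can be taken. *)
exists 2^-1; first by apply/andP; split; lra.
move=> eps0 /andP[/ltW e0 _] a _ mu0 M C T gamma u0 u p ubar pbar mu00 T0 g0 Tg _ ns hM eu.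
have [B uB] : exists B, forall t, 0 <= t <= T ->
    [/\ forall i X, half_space X -> `|ubar t i X| <= B,
        forall ij X, half_space X -> `|gradient (ubar t) ij X| <= B,
        (L2norm (gradient (ubar t)) <= B%:E)%E &
        (L2norm (fun i : 'I_3 => partial i (pbar t)) <= B%:E)%E].
  by have [_ [_ _ feb] _ _ _] := eu; apply: feb; rewrite /= in_itv/= lexx ltW.
(* Since T <= mu0 / (2 gamma), some analyticity radius is left at every time up to T. *)
have gT t : 0 < t <= T -> gamma * t < mu0.
  move=> /andP[_ tT]; apply: (@le_lt_trans _ _ (mu0 / 2)); last by lra.
  have := ler_wpM2l (ltW g0) (le_trans tT Tg).
  by have -> : gamma * (mu0 / (2 * gamma)) = mu0 / 2 by field; rewrite gt_eqF.
have wall nu t i x y : 0 < nu <= 1 -> 0 < t <= T -> 0 <= x <= 2 * pi -> 0 <= y <= 2 * pi ->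
    `|partial (inord 2) (u nu t i) (x, y, 0)| <= C * M / Num.sqrt nu.
  move=> hnu ht hx hy; have [nu0 _] := andP hnu; have [t0 tT] := andP ht.
  apply: (wall_bound nu0 (ns nu hnu) e0 (gT t ht) ht _ _ hx hy).
  by apply: hM => //; rewrite (ltW t0).
(* A sqrt nu bounds the squared L^2 distance at all times, and A does not depend on nu. *)
pose A := 4 * T * (B ^+ 2 + 3 * (B * (C * M)) * (2 * pi) ^+ 2) * expR ((12 * B + 1) * T).
pose S nu := ereal_sup [set L2norm (fun i => u nu t i \- ubar t i) | t in `[0, T]].
have sup_le nu : 0 < nu <= 1 -> (S nu <= (Num.sqrt (A * Num.sqrt nu))%:E)%E.
  move=> hnu; have [nu0 nu1] := andP hnu.
  apply: ge_ereal_sup => _ [t + <-]; rewrite /= in_itv/= => ht.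
  apply: le_trans (L2norm_le (gap_le T0 nu0 (ns nu hnu) eu uB (fun t i x y => @wall nu t i x y hnu) ht)) _.
  by rewrite lee_fin; apply: ler_wsqrtr; apply: viscous_arith => //; exact: expR_ge0.
have cvgA : (Num.sqrt (A * Num.sqrt nu))%:E @[nu --> 0^'+] --> (0%E : \bar R).
  have c : continuous (fun nu : R => Num.sqrt (A * Num.sqrt nu)).
    have h := @sqrt_continuous R; apply: (cont_comp h); apply: contM; first by cont.
    exact: h.
  have -> : 0%E = (Num.sqrt (A * Num.sqrt 0))%:E :> \bar R by rewrite sqrtr0 mulr0 sqrtr0.
  apply: cvg_EFin; first exact: filterS filterT.
  exact: cvg_at_right_filter (c 0).
(* The supremum is over a set containing the value at t = 0, hence it is not -oo. *)
have sup_ge nu : (0 <= S nu)%E.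
  apply: ereal_sup_ge; exists (L2norm (fun i => (u nu 0 i \- ubar 0 i)%R)).
    by exists 0 => //; rewrite /= in_itv/= lexx ltW.
  exact: poweR_ge0.
apply: (@squeeze_cvge _ _ _ _ (fun=> 0%E) S _ _ _ _ cvgA); last exact: cvg_cst.
by near=> nu; rewrite sup_ge sup_le//; apply/andP; split; near: nu; [exact: nbhs_right_gt | exact: nbhs_right_le].
Unshelve. all: by end_near.
Qed.
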